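(* Let $\Omega\subset\mathbb R^2$ be a bounded rational convex polygon with interior $\Omega^\circ$ and let $K\subset\Omega^\circ$ be compact. There is a constant $C=C(\Omega,K)$ such that for every $N\ge1$, every strongly generic $N$-point configuration $P\subset K$, and every $\varphi\in C_c^1(\Omega^\circ)$, $$\left|\int_{\Omega^\circ}\varphi\,d\bigl(\mathrm{MA}(F_P)-\nu_P\bigr)\right|\le C\sqrt N\bigl(\|\varphi\|_\infty+\|\nabla\varphi\|_\infty\bigr),\qquad \nu_P=\sum_{p\in P}\delta_p .$$ Equivalently, for $u_P=N^{-1/2}F_P$ and $\mu_P=N^{-1}\nu_P$, $$\left|\int_{\Omega^\circ}\varphi\,d\bigl(\mathrm{MA}(u_P)-\mu_P\bigr)\right|\le \frac{C}{\sqrt N}\bigl(\|\varphi\|_\infty+\|\nabla\varphi\|_\infty\bigr).$$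
   Context: A bounded rational convex polygon is a compact convex polygon $\Omega\subset\mathbb R^2$ with nonempty interior $\Omega^\circ$, of the form $\Omega=\bigcap_{r=1}^s\{x:\langle n_r,x\rangle+a_r\ge0\}$ with primitive $n_r\in\mathbb Z^2$, $a_r\in\mathbb R$. An $\Omega$-tropical series is a continuous function $F:\Omega\to\mathbb R_{\ge0}$ with $F=0$ on $\partial\Omega$ which near every point of $\Omega^\circ$ has the form $F(x)=\min_{m\in A}(c_m+\langle m,x\rangle)$ with $A\subset\mathbb Z^2$ finite and $c_m\in\mathbb R$; it is concave. Its corner locus $V(F)\subset\Omega^\circ$ is the set of points where the minimum is attained by at least two distinct affine functions. For nonempty finite $P\subset\Omega^\circ$, the tropical relaxation $F_P=G_P0_\Omega$ is the pointwise infimum of all $\Omega$-tropical series $G$ with $P\subset V(G)$; it is itself such a series. Put $\Gamma_P=V(F_P)$. For concave $F$, $\partial^+F(x)=\{p\in\mathbb R^2:F(y)\le F(x)+\langle p,y-x\rangle\ \forall y\in\Omega\}$ and $\mathrm{MA}(F)$ is the Radon measure on $\Omega^\circ$ with $\mathrm{MA}(F)(B)=\mathrm{Leb}_2\bigl(\bigcup_{x\in B}\partial^+F(x)\bigr)$ for Borel $B\subset\Omega^\circ$. The linearity cells of $F_P$ are the closures of the maximal connected open subsets of $\Omega^\circ$ on which $F_P$ is affine; each has a gradient in $\mathbb Z^2$. $\Gamma_P$ is a finite embedded polyhedral graph, whose vertices are the points $v\in\Omega^\circ$ with $\partial^+F_P(v)$ two-dimensional and whose edges are the straight segments into which the vertices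 divide it; an edge separating cells of gradients $m_0,m_1$ has weight $w\ge1$ where $m_1-m_0=wn$ with $n\in\mathbb Z^2$ primitive. The gradient-labelled marked type of $P=(p_1,\dots,p_N)$ consists of the embedded face poset of this subdivision of $\Omega$ (cells, edges, vertices, incidences, cyclic orders), the gradient of each two-dimensional cell, all edge weights, all incidences with the sides and vertices of $\Omega$, and for each $i$ the face containing $p_i$ in its relative interior. $P$ (a set of $N$ distinct points of $\Omega^\circ$) is strongly generic if (i) every $p_i$ lies in the relative interior of an edge of $\Gamma_P$; (ii) distinct $p_i$ lie on distinct edges; (iii) the gradient-labelled marked type is unchanged under all sufficiently small independent perturbations of the points $p_i$. *)

(* Defs.v *)
From HB Require Import structures.
From mathcomp Require Import all_boot all_order all_algebra.
From mathcomp Require Import all_classical all_reals all_analysis.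

Set Implicit Arguments.
Unset Strict Implicit.
Unset Printing Implicit Defensive.

Import Order.TTheory GRing.Theory Num.Theory.
Import numFieldNormedType.Exports.

Local Open Scope classical_set_scope.
Local Open Scope ring_scope.

Definition dot (R : realType) (p x : R * R) : R := p.1 * x.1 + p.2 * x.2.

Definition ivec (R : realType) (m : int * int) : R * R := (m.1%:~R, m.2%:~R).

Definition primitive (n : int * int) : Prop := coprimez n.1 n.2.

Definition rational_polygon (R : realType) (Om : set (R * R)) : Prop :=
  [/\ compact Om, interior Om !=set0 &
      exists (s : nat) (n : 'I_s -> int * int) (a : 'I_s -> R),
        (forall r, primitive (n r)) /\
        Om = [set x | forall r, 0 <= dot (ivec R (n r)) x + a r]].

(** Tropical series *)

(* F y = min_(m in A) (c m + <m, y>); A is then automatically nonempty *)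
Definition tropical_min (R : realType) (F : R * R -> R) (A : set (int * int))
    (c : int * int -> R) (y : R * R) : Prop :=
  (forall m, A m -> F y <= c m + dot (ivec R m) y) /\
  (exists2 m, A m & F y = c m + dot (ivec R m) y).

Definition tropical_near (R : realType) (F : R * R -> R) (x : R * R)
    (A : set (int * int)) (c : int * int -> R) : Prop :=
  finite_set A /\ \forall y \near x, tropical_min F A c y.

(* Only the values of F on Om matter. *)
Definition tropical_series (R : realType) (Om : set (R * R))
    (F : R * R -> R) : Prop :=
  [/\ {within Om, continuous F},
      (forall x, Om x -> 0 <= F x),
      (forall x, (Om `\` interior Om) x -> F x = 0) &
      (forall x, interior Om x -> exists A c, tropical_near F x A c)].

(* Asking for some, or for every, local expression of F at x is equivalent:
   if a single affine function of a local expression attains the minimum at x,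
   then F is affine near x, and no expression has two minimizers at x. *)
Definition corner_locus (R : realType) (Om : set (R * R)) (F : R * R -> R) :
    set (R * R) :=
  [set x | interior Om x /\ exists A c, tropical_near F x A c /\
    exists m m', [/\ A m, A m', m != m',
      F x = c m + dot (ivec R m) x & F x = c m' + dot (ivec R m') x]].

Definition relaxation (R : realType) (Om : set (R * R)) (N : nat)
    (p : 'I_N -> R * R) (x : R * R) : R :=
  inf [set G x | G in [set G | tropical_series Om G /\
                              range p `<=` corner_locus Om G]].

(** The Monge-Ampere measure *)

Definition superdiff (R : realType) (Om : set (R * R)) (F : R * R -> R)
    (x : R * R) : set (R * R) :=
  [set q | forall y, Om y -> F y <= F x + dot q (y - x)].

Definition leb2 (R : realType) :
    set (measurableTypeR R * measurableTypeR R) -> \bar R :=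
  (@lebesgue_measure R \x @lebesgue_measure R)%E.

(* A bare set function, which the library integral accepts as is; integrals are
   taken over interior Om.  For F a positive multiple of a tropical series it is
   a Radon measure: F has countably many faces in interior Om, so the union
   below is a countable union of compact convex sets, hence Borel. *)
Definition MA (R : realType) (Om : set (R * R)) (F : R * R -> R) :
    set (measurableTypeR R * measurableTypeR R) -> \bar R :=
  fun B => @leb2 R (\bigcup_(x in B `&` interior Om) superdiff Om F x).

Definition nu (R : realType) (N : nat) (p : 'I_N -> R * R) :
    set (measurableTypeR R * measurableTypeR R) -> \bar R :=
  fun B => (\sum_(i < N)
    dirac (p i : measurableTypeR R * measurableTypeR R) B)%E.

(** The subdivision of Om defined by F *)

Definition affine_set (R : realType) (B : set (R * R)) : Prop :=
  forall x y (t : R), B x -> B y -> B ((1 - t) *: x + t *: y).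

Definition affine_hull (R : realType) (A : set (R * R)) : set (R * R) :=
  \bigcap_(B in [set B | affine_set B /\ A `<=` B]) B.

Definition relint (R : realType) (A : set (R * R)) : set (R * R) :=
  [set x | A x /\ \forall y \near x, affine_hull A y -> A y].

Definition linearity_domain (R : realType) (Om : set (R * R))
    (F : R * R -> R) (U : set (R * R)) : Prop :=
  [/\ open U, connected U, U !=set0, U `<=` interior Om &
      exists (q : R * R) (c : R), forall x, U x -> F x = c + dot q x].

Definition cell (R : realType) (Om : set (R * R)) (F : R * R -> R)
    (A : set (R * R)) : Prop :=
  exists U, [/\ linearity_domain Om F U,
    (forall V, linearity_domain Om F V -> U `<=` V -> V = U) &
    A = closure U].

Definition vertices (R : realType) (Om : set (R * R)) (F : R * R -> R) :
    set (R * R) :=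
  [set v | interior Om v /\ affine_hull (superdiff Om F v) = setT].

Definition vertex_face (R : realType) (Om : set (R * R)) (F : R * R -> R)
    (A : set (R * R)) : Prop :=
  exists2 v, vertices Om F v & A = [set v].

(* F is locally tropical, so away from its vertices the corner locus is locally
   a straight line: the components below are open segments. *)
Definition edge (R : realType) (Om : set (R * R)) (F : R * R -> R)
    (A : set (R * R)) : Prop :=
  let S := corner_locus Om F `\` vertices Om F in
  exists2 x, S x & A = closure (connected_component S x).

(* The exposed proper faces of a polygon are its sides and its vertices, the
   latter as singletons. *)
Definition boundary_face (R : realType) (Om : set (R * R))
    (A : set (R * R)) : Prop :=
  exists2 q : R * R, q != 0 &
    A = [set x | Om x /\ forall y, Om y -> dot q x <= dot q y].

Definition face (R : realType) (Om : set (R * R)) (F : R * R -> R) :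
    set (set (R * R)) :=
  [set A | [\/ cell Om F A, edge Om F A, vertex_face Om F A |
               boundary_face Om A]].

Definition gradient (R : realType) (F : R * R -> R) (A : set (R * R))
    (m : int * int) : Prop :=
  exists c : R, forall x, A x -> F x = c + dot (ivec R m) x.

Definition edge_weight (R : realType) (Om : set (R * R)) (F : R * R -> R)
    (E : set (R * R)) (w : nat) : Prop :=
  (0 < w)%N /\ exists A0 A1 m0 m1 n,
  [/\ [/\ cell Om F A0, cell Om F A1 & A0 <> A1],
      E `<=` A0 /\ E `<=` A1,
      gradient F A0 m0 /\ gradient F A1 m1 &
      primitive n /\ m1 - m0 = n *+ w].

(* For faces of a subdivision this amounts to B `<=` A. *)
Definition incident (R : realType) (A B : set (R * R)) : Prop :=
  A `&` relint B !=set0.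

Definition has_angle (R : realType) (d : R * R) (t : R) : Prop :=
  exists2 r : R, 0 < r & d = (r * cos t, r * sin t).

Definition ccw (R : realType) (d1 d2 d3 : R * R) : Prop :=
  exists t1 t2 t3 : R,
    [/\ has_angle d1 t1, has_angle d2 t2, has_angle d3 t3 &
        [/\ t1 < t2, t2 < t3 & t3 < t1 + 2 * pi]].

(* Counterclockwise order of the faces B1, B2, B3 incident to A, as seen from
   the relative interior of A: this covers the cyclic order of the edges and
   cells around a vertex, that of the edges and vertices around a cell, and the
   two sides of an edge.  As cells are convex, distinct faces incident to A
   are seen in disjoint sets of directions, in an order that does not depend on
   the chosen points. *)
Definition cyclic_order (R : realType) (A B1 B2 B3 : set (R * R)) : Prop :=
  exists q x1 x2 x3,
    [/\ relint A q, relint B1 x1, relint B2 x2, relint B3 x3 &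
        ccw (x1 - q) (x2 - q) (x3 - q)].

Definition adjacent (R : realType) (A B : set (R * R)) : Prop :=
  A <> B /\ (incident A B \/ incident B A).

(* Phi is an isomorphism from the gradient-labelled marked type of (F, p) onto
   that of (F', p').  The sides and vertices of Om are faces fixed by Phi. *)
Record marked_type_iso (R : realType) (Om : set (R * R))
    (F F' : R * R -> R) (N : nat) (p p' : 'I_N -> R * R)
    (Phi : set (R * R) -> set (R * R)) : Prop := MarkedTypeIso {
  iso_bij : set_bij (face Om F) (face Om F') Phi ;
  iso_boundary : forall A, boundary_face Om A -> Phi A = A ;
  iso_cell : forall A, face Om F A -> (cell Om F A <-> cell Om F' (Phi A)) ;
  iso_edge : forall A, face Om F A -> (edge Om F A <-> edge Om F' (Phi A)) ;
  iso_vertex : forall A, face Om F A ->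
    (vertex_face Om F A <-> vertex_face Om F' (Phi A)) ;
  iso_incident : forall A B, face Om F A -> face Om F B ->
    (incident A B <-> incident (Phi A) (Phi B)) ;
  iso_cyclic : forall A B1 B2 B3, face Om F A ->
    face Om F B1 -> face Om F B2 -> face Om F B3 ->
    B1 <> B2 -> B2 <> B3 -> B1 <> B3 ->
    adjacent A B1 -> adjacent A B2 -> adjacent A B3 ->
    (cyclic_order A B1 B2 B3 <->
     cyclic_order (Phi A) (Phi B1) (Phi B2) (Phi B3)) ;
  iso_gradient : forall A m, cell Om F A ->
    (gradient F A m <-> gradient F' (Phi A) m) ;
  iso_weight : forall E w, edge Om F E ->
    (edge_weight Om F E w <-> edge_weight Om F' (Phi E) w) ;
  iso_mark : forall A i, face Om F A ->
    (relint A (p i) <-> relint (Phi A) (p' i))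
}.

Definition same_marked_type (R : realType) (Om : set (R * R)) (N : nat)
    (p p' : 'I_N -> R * R) : Prop :=
  exists Phi, marked_type_iso Om (relaxation Om p) (relaxation Om p') p p' Phi.

Definition strongly_generic (R : realType) (Om : set (R * R)) (N : nat)
    (p : 'I_N -> R * R) : Prop :=
  [/\ injective p /\ (forall i, interior Om (p i)),
      (forall i, exists2 E, edge Om (relaxation Om p) E & relint E (p i)),
      (forall i j E, edge Om (relaxation Om p) E ->
        relint E (p i) -> relint E (p j) -> i = j) &
      exists2 e : R, 0 < e & forall p' : 'I_N -> R * R,
        (forall i, `|p' i - p i| < e) -> same_marked_type Om p p'].

(** Test functions *)

Definition partial1 (R : realType) (phi : R * R -> R) (x : R * R) : R :=
  'D_((1, 0) : R * R) phi x.

Definition partial2 (R : realType) (phi : R * R -> R) (x : R * R) : R :=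
  'D_((0, 1) : R * R) phi x.

(* Only the values of phi on the open set U matter. *)
Definition Cc1 (R : realType) (U : set (R * R)) (phi : R * R -> R) : Prop :=
  [/\ (forall x, U x -> differentiable phi x),
      (forall x, U x -> {for x, continuous (partial1 phi)}),
      (forall x, U x -> {for x, continuous (partial2 phi)}) &
      exists L, [/\ compact L, L `<=` U &
        forall x, U x -> ~ L x -> phi x = 0]].

Definition supnorm (R : realType) (U : set (R * R)) (f : R * R -> R) : R :=
  sup [set `|f x| | x in U].

Definition gradnorm (R : realType) (phi : R * R -> R) (x : R * R) : R :=
  Num.sqrt (partial1 phi x ^+ 2 + partial2 phi x ^+ 2).

Definition C1norm (R : realType) (U : set (R * R)) (phi : R * R -> R) : R :=
  supnorm U phi + supnorm U (gradnorm phi).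

(* Main.v *)
Require Import Defs.
From mathcomp Require Import all_boot all_order all_algebra.
From mathcomp Require Import all_classical all_reals all_analysis.
From mathcomp Require Import measurable_realfun.
From mathcomp Require Import ring lra.
Import Order.TTheory GRing.Theory Num.Theory.
Import numFieldNormedType.Exports.
Local Open Scope classical_set_scope.
Local Open Scope ring_scope.
Set Implicit Arguments.
Unset Strict Implicit.
Unset Printing Implicit Defensive.

(** Let [F] be the relaxation of a strongly generic configuration [p] of [N] points,
and let [psi q] be the maximum of [F x - dot q x] over [Om], reached at some point
[x q]; so [q] is a supergradient of [F] at [x q]. Both measures are read in the
plane of gradients.

The Monge-Ampere measure is the image of Lebesgue measure by [x], restricted to the
interior of [Om]. So the integral of a test function [phi], extended by [0] to the
boundary, is that of [phi (x q)] over the plane. On the other side, call a lattice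
gradient [m] free when [psi m + dot m y] is positive on [Om]. Free gradients
correspond bijectively to the marked points, each one being active at its point
([free_points_bij]), and a gradient which is not free touches [F] on the boundary
([nonfree_boundary]), where [phi] vanishes. So with a suitable choice of the [x m]
the sum of [phi] over the marked points is the sum of [phi (x m)] over all of the
lattice. The difference is a sum over unit cells of the lattice of integrals of
[phi (x q) - phi (x m)], with [m] a corner of the cell of [q]. As [x] is a monotone
map, the distance between [x q] and [x m] is at most a sum of second differences of
[psi] at [m] ([osc_ge]). Over a box of side [r] these telescope to a quantity of order
[r] ([osc_sum]), and the gradients of [F] at interior points lie in a box of side
of order [sqrt N] ([gradient_bound]). This gives the estimate
([transport_estimate]). It is proved for [t * F] with any [t > 0], the lattice being
scaled by [t]; the two inequalities are the cases [t = 1] and [t = 1 / sqrt N].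

The bijection rests on minimality and on genericity. If no marked point had exactly
one active gradient in a set [S] of free gradients, the coefficients of [S] could
all be lowered and the points would stay on the corner locus, against the
minimality of [F] ([free_unique]). Choosing points one after the other in this way
gives an injection of the free gradients into the marked points. Conversely a
marked point lies on two cells, which is a linear equation between two coefficients
of [F]. Nearby configurations have the same cells, gradients and incidences, so
they satisfy the same equations, with the same constants for the coefficients that
are not free. If there were more points than free gradients, the points would
satisfy a linear relation, which some small displacement violates
([free_ge_points]).

The size of the gradients is found by counting. Every lattice gradient whose
variation on [Om] is less than the maximum of [F] is free, and there are [N] free
gradients, so this maximum is of order [sqrt N] at most ([height_bound]). A free
gradient is active at a marked point, where a ball of fixed size around the point
lies in [Om] and [F >= 0] on it, so it is of order [sqrt N] too. Rationality of the
polygon extends the bound to all gradients at interior points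
([gradient_near_free]). *)

(** * The plane, and concavity along a segment *)

Section Plane.
Variable R : realType.
Implicit Types (x y z p q v : R * R) (t c e : R).

Definition l1 x : R := `|x.1| + `|x.2|.

Lemma fstB x y : (x - y).1 = x.1 - y.1. Proof. by []. Qed.
Lemma sndB x y : (x - y).2 = x.2 - y.2. Proof. by []. Qed.
Lemma fstN x : (- x).1 = - x.1. Proof. by []. Qed.
Lemma sndN x : (- x).2 = - x.2. Proof. by []. Qed.
Lemma fstD x y : (x + y).1 = x.1 + y.1. Proof. by []. Qed.
Lemma sndD x y : (x + y).2 = x.2 + y.2. Proof. by []. Qed.
Lemma fstZ t x : (t *: x).1 = t * x.1. Proof. by []. Qed.
Lemma sndZ t x : (t *: x).2 = t * x.2. Proof. by []. Qed.
Definition pairE := (fstB, sndB, fstD, sndD, fstZ, sndZ, fstN, sndN).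

Lemma dotDr p x y : dot p (x + y) = dot p x + dot p y.
Proof. by rewrite /dot !pairE; ring. Qed.
Lemma dotBr p x y : dot p (x - y) = dot p x - dot p y.
Proof. by rewrite /dot !pairE; ring. Qed.
Lemma dotZr p t x : dot p (t *: x) = t * dot p x.
Proof. by rewrite /dot !pairE; ring. Qed.
Lemma dotDl p q x : dot (p + q) x = dot p x + dot q x.
Proof. by rewrite /dot !pairE; ring. Qed.
Lemma dotBl p q x : dot (p - q) x = dot p x - dot q x.
Proof. by rewrite /dot !pairE; ring. Qed.
Lemma dotZl t q x : dot (t *: q) x = t * dot q x.
Proof. by rewrite /dot !pairE; ring. Qed.
Lemma dot0l x : dot 0 x = 0.
Proof. by rewrite /dot /= !mul0r addr0. Qed.
Lemma dot0r x : dot x 0 = 0.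
Proof. by rewrite /dot /= !mulr0 addr0. Qed.

Lemma ivecB (m n : int * int) : ivec R (m - n) = ivec R m - ivec R n.
Proof. by rewrite /ivec /= !intrB. Qed.
Lemma ivecD (m n : int * int) : ivec R (m + n) = ivec R m + ivec R n.
Proof. by rewrite /ivec /= !intrD. Qed.

Lemma ivec_inj : injective (ivec R).
Proof.
by move=> [a b] [c d] [] /eqP + /eqP; rewrite !eqr_int => /eqP -> /eqP ->.
Qed.

Lemma l1_ge0 x : 0 <= l1 x.
Proof. exact: addr_ge0. Qed.

Lemma l1D x y : l1 (x + y) <= l1 x + l1 y.
Proof.
by rewrite /l1 !pairE; have := ler_normD x.1 y.1; have := ler_normD x.2 y.2; lra.
Qed.

Lemma l1N x : l1 (- x) = l1 x.
Proof. by rewrite /l1 !pairE !normrN. Qed.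

Lemma l1C x y : l1 (x - y) = l1 (y - x).
Proof. by rewrite -l1N opprB. Qed.

Lemma l1Z t x : l1 (t *: x) = `|t| * l1 x.
Proof. by rewrite /l1 !pairE !normrM mulrDr. Qed.

Lemma l1_eq0 x : l1 x = 0 -> x = 0.
Proof.
case: x => a b; rewrite /l1 /= => /eqP.
by rewrite paddr_eq0// !normr_eq0 => /andP[/eqP -> /eqP ->].
Qed.

Lemma l1_gt0 x : x != 0 -> 0 < l1 x.
Proof.
move=> x0; rewrite lt_neqAle l1_ge0 andbT eq_sym.
by apply: contra_neq x0 => /l1_eq0.
Qed.

Lemma dot_le_l1 p x : `|dot p x| <= l1 p * l1 x.
Proof.
rewrite /dot /l1; apply: (le_trans (ler_normD _ _)).
rewrite !normrM mulrDl !mulrDr.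
have := mulr_ge0 (normr_ge0 p.1) (normr_ge0 x.2).
have := mulr_ge0 (normr_ge0 p.2) (normr_ge0 x.1).
by lra.
Qed.

Definition sgv q : R * R := (Num.sg q.1, Num.sg q.2).

Lemma dot_sgv q : dot q (sgv q) = l1 q.
Proof. by rewrite /dot /l1 /sgv /= !normrEsg ![_ * Num.sg _]mulrC. Qed.

Lemma l1_sgv q : l1 (sgv q) <= 2.
Proof.
rewrite /l1 /sgv /=.
have H (a : R) : `|Num.sg a| <= 1 by rewrite normr_sg; case: (a != 0).
by have := H q.1; have := H q.2; lra.
Qed.

Lemma near_l1P x (P : R * R -> Prop) : (\forall y \near x, P y) <->
  exists2 e : R, 0 < e & forall y, l1 (y - x) < e -> P y.
Proof.
split.
  move=> /nbhs_ballP[e /= e0 H]; exists e => // y; rewrite l1C /l1 !pairE => h.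
  by apply: H; split; rewrite /ball/=;
    have := normr_ge0 (x.1 - y.1); have := normr_ge0 (x.2 - y.2); lra.
move=> [e e0 H]; apply/nbhs_ballP; exists (e / 2) => /=; first by lra.
move=> y [h1 h2]; apply: H; rewrite l1C /l1 !pairE.
by move: h1 h2; rewrite /ball/=; lra.
Qed.

Lemma near_realP (x : R) (P : R -> Prop) : (\forall y \near x, P y) <->
  exists2 e : R, 0 < e & forall y : R, `|y - x| < e -> P y.
Proof.
split.
  move=> /nbhs_ballP[e /= e0 H]; exists e => // y h.
  by apply: H; rewrite /ball/= distrC.
move=> [e e0 H]; apply/nbhs_ballP; exists e => //= y h1.
by apply: H; rewrite distrC.
Qed.

Lemma interior_l1P (A : set (R * R)) x : interior A x <->
  exists2 e : R, 0 < e & forall y, l1 (y - x) < e -> A y.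
Proof. exact: (near_l1P x A). Qed.

Lemma within_l1P (A : set (R * R)) (f : R * R -> R) :
  {within A, continuous f} <->
  forall x, A x -> forall e, 0 < e ->
    exists2 d : R, 0 < d & forall y, A y -> l1 (y - x) < d -> `|f y - f x| < e.
Proof.
split.
  move=> /subspace_continuousP H x Ax e e0.
  have /cvgrPdist_lt/(_ e e0) := H x Ax.
  rewrite /prop_near1 /within /= => /near_l1P[d d0 K]; exists d => // y Ay yd.
  by rewrite distrC; exact: K.
move=> H; apply/subspace_continuousP => x Ax; apply/cvgrPdist_lt => e e0.
have [d d0 K] := H x Ax e e0.
rewrite /prop_near1 /within /=; apply/near_l1P; exists d => // y yd Ay.
by rewrite distrC; exact: K.
Qed.

Lemma within_realP (A : set R) (f : R -> R) :
  {within A, continuous f} <->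
  forall x : R, A x -> forall e, 0 < e ->
    exists2 d : R, 0 < d & forall y : R, A y -> `|y - x| < d -> `|f y - f x| < e.
Proof.
split.
  move=> /subspace_continuousP H x Ax e e0.
  have /cvgrPdist_lt/(_ e e0) := H x Ax.
  rewrite /prop_near1 /within /= => /near_realP[d d0 K]; exists d => // y Ay yd.
  by rewrite distrC; exact: K.
move=> H; apply/subspace_continuousP => x Ax; apply/cvgrPdist_lt => e e0.
have [d d0 K] := H x Ax e e0.
rewrite /prop_near1 /within /=; apply/near_realP; exists d => // y yd Ay.
by rewrite distrC; exact: K.
Qed.

Lemma closed_l1 (A : set (R * R)) x : closed A ->
  (forall e, 0 < e -> exists2 y, A y & l1 (y - x) < e) -> A x.
Proof.
move=> cA H; apply: cA => B /near_l1P[e e0 K].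
by have [y Ay yx] := H e e0; exists y; split => //; exact: K.
Qed.

Lemma closure_l1P (A : set (R * R)) x : closure A x <->
  (forall e, 0 < e -> exists2 y, A y & l1 (y - x) < e).
Proof.
split.
  move=> cA e e0; have /cA[y [Ay yx]] : nbhs x [set y | l1 (y - x) < e].
    by apply/(near_l1P x (fun y => l1 (y - x) < e)); exists e.
  by exists y.
move=> H B /near_l1P[e e0 K].
by have [y Ay yx] := H e e0; exists y; split => //; exact: K.
Qed.

Lemma open_l1P (A : set (R * R)) : open A <->
  forall x, A x -> exists2 e : R, 0 < e & forall y, l1 (y - x) < e -> A y.
Proof.
rewrite openE; split => [H x /H /interior_l1P //|H x Ax].
by apply/interior_l1P; exact: H.
Qed.

(** If the gap [k] between [h] and its chord took a negative value, so would
[k t + e t (1 - t)] for a small [e], at an interior minimum. Near that minimum the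
affine majorant of [h] gives a strictly concave parabola above it that touches it
there, and such a parabola has no local minimum. *)
Lemma chord_le (h : R -> R) : {within `[0, 1], continuous h} ->
  (forall t, 0 < t < 1 -> exists a b : R,
     (\forall s \near t, h s <= a + b * s) /\ h t = a + b * t) ->
  forall t, 0 <= t <= 1 -> (1 - t) * h 0 + t * h 1 <= h t.
Proof.
move=> /within_realP ch sup t1 t1P; rewrite leNgt; apply/negP => bad.
pose k s := h s - ((1 - s) * h 0 + s * h 1).
have kt1 : k t1 < 0 by rewrite /k; lra.
pose e := - k t1.
have e0 : 0 < e by rewrite /e; lra.
pose k2 s := k s + e * (s * (1 - s)).
have ck2 : {within `[0, 1], continuous k2}.
  apply/within_realP => x x01 d d0.
  pose M := 1 + `|h 0| + `|h 1| + e.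
  have M0 : 0 < M.
    by rewrite /M; have := normr_ge0 (h 0); have := normr_ge0 (h 1); lra.
  have [d1 d10 H] := ch x x01 (d / 2) ltac:(lra).
  exists (Num.min d1 (d / 2 / M)).
    by rewrite lt_min d10 /= divr_gt0//; lra.
  move=> y y01; rewrite lt_min => /andP[yd1]; rewrite ltr_pdivlMr// => yd2.
  have Hy := H y y01 yd1.
  have -> : k2 y - k2 x =
    (h y - h x) + (y - x) * (h 0 - h 1 + e * (1 - x - y)).
    by rewrite /k2 /k; ring.
  apply: (le_lt_trans (ler_normD _ _)).
  suff : `|(y - x) * (h 0 - h 1 + e * (1 - x - y))| <= d / 2 by lra.
  rewrite normrM; apply: (le_trans _ (ltW yd2)); apply: ler_wpM2l => //.
  apply: (le_trans (ler_normD _ _)); rewrite /M.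
  have := ler_normB (h 0) (h 1).
  have : `|e * (1 - x - y)| <= e.
    rewrite normrM gtr0_norm// -[X in _ <= X]mulr1 ler_wpM2l ?(ltW e0)//.
    move: x01 y01; rewrite /= !in_itv /= => x01 y01; rewrite ler_norml; lra.
  by lra.
have [c c01 cmin] := EVT_min ler01 ck2.
have t1I : t1 \in `[0, 1] by rewrite in_itv /=.
have kc : k2 c < 0.
  apply: le_lt_trans (cmin _ t1I) _; rewrite /k2 /e.
  have -> : k t1 + - k t1 * (t1 * (1 - t1)) = k t1 * (1 - t1 * (1 - t1)) by ring.
  by rewrite nmulr_rlt0//; nra.
move: c01; rewrite in_itv /= => c01.
have c0 : c != 0.
  by apply: contraTneq kc => ->; rewrite /k2 /k -leNgt; lra.
have c1 : c != 1.
  by apply: contraTneq kc => ->; rewrite /k2 /k -leNgt; lra.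
have c01' : 0 < c < 1 by rewrite !lt_neqAle c1 eq_sym c0.
have [a [b [/near_realP[d d0 nb] hc]]] := sup c c01'.
pose s := Num.min (d / 2) (Num.min c (1 - c)).
have s0 : 0 < s by rewrite !lt_min; apply/and3P; split; lra.
have sd : s < d by rewrite /s gt_min; apply/orP; left; lra.
have sc : s <= c by rewrite /s !ge_min lexx orbT.
have sc1 : s <= 1 - c by rewrite /s !ge_min lexx !orbT.
have /nb h1 : `|(c + s) - c| < d by rewrite addrAC subrr add0r gtr0_norm.
have /nb h2 : `|(c - s) - c| < d by rewrite addrAC subrr add0r normrN gtr0_norm.
have g1 : k2 c <= k2 (c + s) by apply: cmin; rewrite in_itv /=; lra.
have g2 : k2 c <= k2 (c - s) by apply: cmin; rewrite in_itv /=; lra.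
have : 0 < e * (s * s) by rewrite !mulr_gt0.
by move: g1 g2 h1 h2; rewrite /k2 /k hc; nra.
Qed.

End Plane.

(** * Tropical series on a convex body *)

Definition convex_body (R : realType) (Om : set (R * R)) : Prop :=
  [/\ compact Om, interior Om !=set0 &
    forall x y (t : R), interior Om x -> Om y -> 0 <= t < 1 ->
      interior Om (x + t *: (y - x))].

(** Up to sign the concave conjugate of [F]: the affine function of gradient [q]
and constant term [psi q] is the lowest one above [F]. *)
Definition psi (R : realType) (Om : set (R * R)) (F : R * R -> R) (q : R * R) :
  R := sup [set F y - dot q y | y in Om].

(** The lattice gradients of the affine functions that attain the minimum at [x];
all local expressions of a tropical series agree on them. *)
Definition active (R : realType) (Om : set (R * R)) (F : R * R -> R) (x : R * R)
  (m : int * int) : Prop := superdiff Om F x (ivec R m).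

Lemma near_finite_set (R : realType) (T : eqType) (A : set T) (x : R * R)
    (P : T -> R * R -> Prop) : finite_set A ->
  (forall m, A m -> \forall y \near x, P m y) ->
  \forall y \near x, forall m, A m -> P m y.
Proof.
move=> /finite_seqP[s ->] H.
elim: s H => [|m s IH] H; first by apply: filterE.
have H1 := H m (mem_head _ _).
have H2 := IH (fun k ks => H k (mem_behead (ks : k \in behead (m :: s)))).
near=> y => k; rewrite /= inE => /orP[/eqP ->|ks]; first by near: y.
have : forall k, [set` s] k -> P k y by near: y.
exact.
Unshelve. all: by end_near. Qed.

Lemma near_interior (R : realType) (A : set (R * R)) (x : R * R) :
  interior A x -> \forall y \near x, interior A y.
Proof.
by move=> ix; apply: open_nbhs_nbhs; split => //; exact: open_interior.
Qed.

Lemma finite_lattice_ball (R : realType) (K : R) :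
  finite_set [set m : int * int | l1 (ivec R m) <= K].
Proof.
pose n := (Num.trunc `|K|).+1.
have HI : finite_set [set i : int | `|i%:~R| <= `|K|].
  apply: (@sub_finite_set _ _ ([set (k : nat)%:Z | k in `I_n] `|`
                              [set - (k : nat)%:Z | k in `I_n])); last first.
    by rewrite finite_setU; split; apply: finite_image; exact: finite_II.
  move=> i /= iK.
  have lt : (`|i| < n)%N.
    rewrite -(ltr_nat R); apply: le_lt_trans (truncnS_gt `|K|).
    by move: iK; rewrite -intr_norm -abszE.
  case: (leP 0 i) => i0; [left|right]; exists `|i|%N => //.
    by rewrite gez0_abs.
  by rewrite ltz0_abs// opprK.
apply: (sub_finite_set _ (finite_setX HI HI)) => -[i j]; rewrite /l1 /ivec /=.
move=> le; have := ler_norm K.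
have := normr_ge0 (i%:~R : R); have := normr_ge0 (j%:~R : R).
by split; rewrite /=; lra.
Qed.

Section Body.
Variables (R : realType) (Om : set (R * R)).
Hypothesis Hb : convex_body Om.
Implicit Types (F G : R * R -> R) (x y z p q v : R * R) (m : int * int).

Lemma body_closed : closed Om.
Proof.
by case: Hb => cO _ _; apply: compact_closed.
Qed.

Lemma body_nonempty : Om !=set0.
Proof. by case: Hb => _ [x ix] _; exists x; exact: interior_subset. Qed.

Lemma body_seg x y (t : R) : interior Om x -> Om y -> 0 <= t <= 1 ->
  Om (x + t *: (y - x)).
Proof.
case: Hb => _ _ seg ix Oy t01; case: (ltP t 1) => t1.
  by apply: interior_subset; apply: seg => //; lra.
have -> : t = 1 by lra.
by rewrite scale1r addrC subrK.
Qed.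

Lemma body_max F : {within Om, continuous F} ->
  exists2 c, Om c & forall y, Om y -> F y <= F c.
Proof.
case: Hb => cO _ _ cF.
have [c cO' H] := compact_EVT_max body_nonempty cO cF.
exists c; first by move: cO'; rewrite inE.
by move=> y Oy; apply: H; rewrite inE.
Qed.

Lemma within_affine (A : set (R * R)) q (c : R) :
  {within A, continuous (fun y => c + dot q y)}.
Proof.
apply/within_l1P => x Ax e e0.
exists (e / (l1 q + 1)); first by rewrite divr_gt0//; have := l1_ge0 q; lra.
move=> y Ay; rewrite ltr_pdivlMr; last by have := l1_ge0 q; lra.
move=> H; rewrite opprD addrACA subrr add0r -dotBr; apply: le_lt_trans (dot_le_l1 _ _) _.
by have := l1_ge0 (y - x); have := l1_ge0 q; lra.
Qed.

Lemma within_subdot F q : {within Om, continuous F} ->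
  {within Om, continuous (fun y => F y - dot q y)}.
Proof.
move=> /within_l1P cF; apply/within_l1P => x Ox e e0.
have [d1 d10 H1] := cF x Ox (e / 2) ltac:(lra).
have [d2 d20 H2] := (within_l1P _ _).1 (@within_affine Om q 0) x Ox (e / 2) ltac:(lra).
exists (Num.min d1 d2); first by rewrite lt_min d10.
move=> y Oy; rewrite lt_min => /andP[yd1 yd2].
have := H1 y Oy yd1; have := H2 y Oy yd2; rewrite !add0r => h2 h1.
have -> : F y - dot q y - (F x - dot q x) =
  (F y - F x) - (dot q y - dot q x) by ring.
by apply: le_lt_trans (ler_normB _ _) _; lra.
Qed.

Lemma psi_has_sup F q : {within Om, continuous F} ->
  has_sup [set F y - dot q y | y in Om].
Proof.
move=> /(@within_subdot F q) /body_max[c Oc H]; split.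
  by exists (F c - dot q c); exists c.
by exists (F c - dot q c) => _ [y Oy <-]; exact: H.
Qed.

Lemma psi_ub F q y : {within Om, continuous F} -> Om y ->
  F y <= psi Om F q + dot q y.
Proof.
move=> cF Oy; rewrite -lerBlDr; apply: sup_upper_bound; last by exists y.
exact: psi_has_sup.
Qed.

Lemma superdiff_psi F x q : {within Om, continuous F} -> Om x ->
  superdiff Om F x q <-> F x = psi Om F q + dot q x.
Proof.
move=> cF Ox; split=> [sq|Fx y Oy].
  apply/eqP; rewrite eq_le psi_ub//= -lerBrDr; apply: ge_sup.
    by have [] := psi_has_sup q cF.
  by move=> _ [y Oy <-]; have := sq y Oy; rewrite dotBr; lra.
by have := psi_ub q cF Oy; rewrite Fx dotBr; lra.
Qed.

Lemma psi_attained F q : {within Om, continuous F} ->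
  exists2 x, Om x & superdiff Om F x q.
Proof.
move=> cF; have [c Oc H] := body_max (@within_subdot F q cF).
by exists c => // y Oy; have := H y Oy; rewrite dotBr; lra.
Qed.

Section Series.
Variable G : R * R -> R.
Hypothesis tG : tropical_series Om G.

Let cG : {within Om, continuous G}. Proof. by case: tG. Qed.

Lemma series_concave x y (t : R) : interior Om x -> Om y -> 0 <= t <= 1 ->
  (1 - t) * G x + t * G y <= G (x + t *: (y - x)).
Proof.
move=> ix Oy t01.
have O s : 0 <= s <= 1 -> Om (x + s *: (y - x)) by exact: body_seg.
have segB (s u : R) : (x + s *: (y - x)) - (x + u *: (y - x)) = (s - u) *: (y - x).
  by rewrite opprD addrACA subrr add0r scalerBl.
pose L := l1 (y - x) + 1.
have L0 : 0 < L by rewrite /L; have := l1_ge0 (y - x); lra.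
have := @chord_le R (fun s => G (x + s *: (y - x))).
rewrite scale0r addr0 scale1r [x + (y - x)]addrC subrK; apply => //.
  apply/within_realP => s; rewrite /= in_itv /= => s01 e e0.
  have [d d0 H] := (within_l1P _ _).1 cG _ (O _ s01) e e0.
  exists (d / L); first by rewrite divr_gt0.
  move=> u; rewrite /= in_itv /= => u01; rewrite ltr_pdivlMr// => us.
  apply: H; first exact: O.
  rewrite segB l1Z; have := normr_ge0 (u - s); rewrite /L in us.
  by have := l1_ge0 (y - x); nra.
move=> s s01; case: Hb => _ _ seg.
have iz : interior Om (x + s *: (y - x)) by apply: seg => //; lra.
case: tG => _ _ _ /(_ _ iz)[A [c [fA nA]]].
have [m Am Gz] := (nbhs_singleton nA).2.
exists (c m + dot (ivec R m) x), (dot (ivec R m) (y - x)).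
split; last by rewrite Gz dotDr dotZr; ring.
move: nA => /near_l1P[d d0 H]; apply/near_realP; exists (d / L).
  by rewrite divr_gt0.
move=> u; rewrite ltr_pdivlMr// => us.
have /H[/(_ m Am) + _] : l1 ((x + u *: (y - x)) - (x + s *: (y - x))) < d.
  rewrite segB l1Z; have := normr_ge0 (u - s); rewrite /L in us.
  by have := l1_ge0 (y - x); nra.
by rewrite dotDr dotZr; lra.
Qed.

(** Concavity turns a supporting affine function near an interior point into a
global one. *)
Lemma series_support x q : interior Om x ->
  (\forall y \near x, G y <= G x + dot q (y - x)) -> superdiff Om G x q.
Proof.
move=> ix /near_l1P[d d0 H] y Oy.
pose L := l1 (y - x) + d.
have L0 : 0 < L by rewrite /L; have := l1_ge0 (y - x); lra.
pose t := d / 2 / L.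
have t0 : 0 < t by rewrite /t !divr_gt0.
have t1 : t < 1.
  by rewrite /t ltr_pdivrMr// mul1r /L; have := l1_ge0 (y - x); lra.
have := series_concave ix Oy (t := t) ltac:(lra).
have /H : l1 (x + t *: (y - x) - x) < d.
  rewrite addrAC subrr add0r l1Z gtr0_norm// /t mulrAC ltr_pdivrMr// /L.
  by have := l1_ge0 (y - x); nra.
rewrite [x + _ - x]addrAC subrr add0r dotZr => h1 h2.
have : t * (G x + dot q (y - x) - G y) >= 0 by lra.
by rewrite pmulr_rge0//; lra.
Qed.

Lemma active_of_expression x A c m : interior Om x -> tropical_near G x A c -> A m ->
  G x = c m + dot (ivec R m) x -> active Om G x m.
Proof.
move=> ix [fA nA] Am Gx; apply: series_support => //.
move: nA => /near_l1P[d d0 H]; apply/near_l1P; exists d => // y yx.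
by have [/(_ m Am) + _] := H y yx; rewrite Gx dotBr; lra.
Qed.

Lemma series_has_active x : interior Om x -> exists m, active Om G x m.
Proof.
move=> ix; case: (tG) => _ _ _ /(_ _ ix)[A [c nA]].
have [m Am Gx] := (nbhs_singleton nA.2).2.
by exists m; exact: active_of_expression nA Am Gx.
Qed.

End Series.

(** From a point at depth [e] one can walk a distance proportional to [e] against
the gradient and stay in [Om], where [G] is nonnegative. *)
Lemma gradient_le_height G x q (e : R) : 0 < e ->
  (forall z, Om z -> 0 <= G z) -> (forall y, l1 (y - x) < e -> Om y) ->
  superdiff Om G x q -> e * l1 q <= 4 * G x.
Proof.
move=> e0 G0 sub sq.
(* [l1 (sgv q)] is at most [2], so this step has length at most [e / 2] *)
have Oy : Om (x - (e / 4) *: sgv q).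
  apply: sub; rewrite addrAC subrr add0r l1N l1Z gtr0_norm; last by lra.
  by have := l1_sgv q; nra.
have := sq _ Oy; have := G0 _ Oy.
by rewrite [x - _ - _]addrAC subrr add0r -scaleNr dotZr dot_sgv; lra.
Qed.

Lemma active_finite G x : (forall z, Om z -> 0 <= G z) -> interior Om x ->
  finite_set [set m | active Om G x m].
Proof.
move=> G0 /interior_l1P[e e0 sub].
apply: (sub_finite_set _ (@finite_lattice_ball R (4 * G x / e))) => m am /=.
by have := gradient_le_height e0 G0 sub am; rewrite ler_pdivlMr// mulrC.
Qed.

(** Near an interior point the active gradients are bounded in terms of the depth
and of the maximum of [G], so they all lie in one finite box. *)
Lemma active_near G : {within Om, continuous G} ->
  (forall x, Om x -> 0 <= G x) -> (forall x, (Om `\` interior Om) x -> G x = 0) ->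
  (forall x, interior Om x -> exists m, active Om G x m) ->
  forall x, interior Om x -> exists K0 : R, forall K, K0 <= K ->
    tropical_near G x [set m | l1 (ivec R m) <= K]
      (fun m => psi Om G (ivec R m)).
Proof.
move=> cG G0 Gb Gm x ix.
have [z Oz Gz] := body_max cG.
have /interior_l1P[e e0 sub] := ix.
exists (8 * G z / e) => K K0; split; first exact: finite_lattice_ball.
apply/near_l1P; exists (e / 2); first by lra.
move=> y yx.
have sub' w : l1 (w - y) < e / 2 -> Om w.
  move=> wy; apply: sub; have := l1D (w - y) (y - x).
  by rewrite addrA subrK; lra.
have iy : interior Om y by apply/interior_l1P; exists (e / 2) => //; lra.
have Oy := interior_subset iy.
split=> [m _|]; first exact: psi_ub.
have [m am] := Gm y iy; exists m; last exact/superdiff_psi.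
have := gradient_le_height (e := e / 2) ltac:(lra) G0 sub' am; have := Gz y Oy => h1 h2.
by rewrite /=; apply: le_trans K0; rewrite ler_pdivlMr//; lra.
Qed.

Lemma tropical_series_of_active G : {within Om, continuous G} ->
  (forall x, Om x -> 0 <= G x) -> (forall x, (Om `\` interior Om) x -> G x = 0) ->
  (forall x, interior Om x -> exists m, active Om G x m) -> tropical_series Om G.
Proof.
move=> cG G0 Gb Gm; split => // x ix.
have [K0 H] := active_near cG G0 Gb Gm ix.
by exists [set m | l1 (ivec R m) <= K0], (fun m => psi Om G (ivec R m)); exact: H.
Qed.

(** Taking the local expression over a large box, any two active gradients can be
exhibited as minimizers of one expression. *)
Lemma corner_locusP G x : tropical_series Om G -> interior Om x ->
  corner_locus Om G x <-> exists m m', [/\ m != m', active Om G x m & active Om G x m'].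
Proof.
move=> tG ix; split.
  move=> [_ [A [c [nA [m [m' [Am Am' mm' Gm Gm']]]]]]].
  by exists m, m'; split => //; apply: (active_of_expression tG ix nA).
move=> [m [m' [mm' am am']]]; split => //.
case: (tG) => cG G0 Gb _.
have [K0 H] := active_near cG G0 Gb (series_has_active tG) ix.
pose K := Num.max K0 (Num.max (l1 (ivec R m)) (l1 (ivec R m'))).
exists [set m | l1 (ivec R m) <= K], (fun m => psi Om G (ivec R m)); split.
  by apply: H; rewrite le_max lexx.
have Ox := interior_subset ix.
exists m, m'; split => //; rewrite /= ?le_max ?lexx ?orbT//; exact/superdiff_psi.
Qed.

(** The finitely many affine functions that lie strictly above [G] at [x] stay
above it nearby. *)
Lemma series_local G x : tropical_series Om G -> interior Om x ->
  \forall y \near x, interior Om y /\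
    exists m, [/\ active Om G x m, active Om G y m & G y = G x + dot (ivec R m) (y - x)].
Proof.
move=> tG ix; case: (tG) => cG G0 Gb /(_ x ix)[A [c [fA nA]]].
have Ox := interior_subset ix.
have nI := near_interior ix.
have gap : \forall y \near x, forall m, A m ->
    G x < c m + dot (ivec R m) x -> G y < c m + dot (ivec R m) y.
  apply: near_finite_set fA _ => m Am.
  case: (ltP (G x) (c m + dot (ivec R m) x)) => [lt|_]; last by apply: filterE.
  have [d1 d10 H1] := (within_l1P _ _).1 cG x Ox
     ((c m + dot (ivec R m) x - G x) / 2) ltac:(lra).
  have [d2 d20 H2] := (within_l1P _ _).1 (@within_affine Om (ivec R m) (c m)) x Ox
     ((c m + dot (ivec R m) x - G x) / 2) ltac:(lra).
  have /interior_l1P[e e0 sub] := ix.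
  apply/near_l1P; exists (Num.min e (Num.min d1 d2)); first by rewrite !lt_min e0 d10.
  move=> y; rewrite !lt_min => /and3P[ye yd1 yd2] _.
  have := H1 y (sub y ye) yd1; have := H2 y (sub y ye) yd2.
  by rewrite !ltr_norml; lra.
near=> y; have iy : interior Om y by near: y.
split => //; have [ub [m Am Gy]] : tropical_min G A c y by near: y.
have Gx : G x = c m + dot (ivec R m) x.
  apply/eqP; rewrite eq_le (nbhs_singleton nA).1//= leNgt; apply/negP => lt.
  have : forall m, A m -> G x < c m + dot (ivec R m) x -> G y < c m + dot (ivec R m) y.
    by near: y.
  by move=> /(_ m Am lt); rewrite Gy ltxx.
exists m; have am : active Om G x m by apply: (active_of_expression tG ix _ Am Gx).
split => //; last by rewrite Gy Gx dotBr; ring.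
have Oy := interior_subset iy.
apply/superdiff_psi => //; move/superdiff_psi: am => /(_ cG Ox) am.
by rewrite Gy; lra.
Unshelve. all: by end_near. Qed.

End Body.

(** * Infima of series, and minimality of the relaxation *)

Lemma finite_small (R : realType) (T : eqType) (A : set T) (P : T -> R -> Prop) :
  finite_set A ->
  (forall m, A m -> exists2 d : R, 0 < d & forall e, 0 < e <= d -> P m e) ->
  exists2 d : R, 0 < d & forall m, A m -> forall e, 0 < e <= d -> P m e.
Proof.
move=> /finite_seqP[s ->]; elim: s => [|m s IH] H; first by exists 1.
have [d1 d10 H1] := H m (mem_head _ _).
have [k ks|d2 d20 H2] := IH.
  by apply: H; rewrite /= inE ks orbT.
exists (Num.min d1 d2); first by rewrite lt_min d10.
move=> k; rewrite /= inE => /orP[/eqP ->|ks] e; rewrite le_min => /and3P[e0 e1 e2].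
  by apply: H1; rewrite e0.
by apply: H2 => //; rewrite e0.
Qed.

Section Relaxation.
Variables (R : realType) (Om : set (R * R)).
Hypothesis Hb : convex_body Om.
Implicit Types (F G : R * R -> R) (x y z q v : R * R) (m : int * int).

Section Infimum.
Variable GG : set (R * R -> R).
Hypothesis GG0 : GG !=set0.
Hypothesis tGG : forall G, GG G -> tropical_series Om G.
Let F x := inf [set G x | G in GG].

Let has_infG x : Om x -> has_inf [set G x | G in GG].
Proof.
move=> Ox; split; first by case: GG0 => G gG; exists (G x); exists G.
by exists 0 => _ [G /tGG[_ G0 _ _] <-]; exact: G0.
Qed.

Lemma infseries_le G x : GG G -> Om x -> F x <= G x.
Proof. by move=> gG Ox; apply: ge_inf; [case: (has_infG Ox)|exists G]. Qed.

Lemma infseries_ge0 x : Om x -> 0 <= F x.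
Proof.
move=> Ox; apply: lb_le_inf; first by case: (has_infG Ox).
by move=> _ [G /tGG[_ G0 _ _] <-]; exact: G0.
Qed.

(** Near an interior point the gradients of all competing series of bounded
height lie in one finite set, so the infimum inherits one of them. *)
Lemma infseries_has_active x : interior Om x -> exists m, active Om F x m.
Proof.
move=> ix; have Ox := interior_subset ix.
have /interior_l1P[e e0 sub] := ix.
apply: contrapT => /forallNP H.
pose A := [set m | l1 (ivec R m) <= 4 * (F x + 1) / e].
have [m mA|d d0 Hd] := @finite_small R _ A (fun m e => exists2 y, Om y &
  F x + e + dot (ivec R m) (y - x) < F y) (finite_lattice_ball _).
  have /existsNP[y /not_implyP[Oy /negP]] := H m; rewrite -ltNge => lt.
  exists ((F y - F x - dot (ivec R m) (y - x)) / 2); first by lra.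
  by move=> d d0; exists y => //; lra.
pose d1 := Num.min d 1.
have d10 : 0 < d1 by rewrite lt_min d0 ltr01.
have d11 : d1 <= 1 by rewrite ge_min lexx orbT.
have [_ [G gG <-] Gx] := inf_adherent d10 (has_infG Ox).
have tG := tGG gG.
have [m am] := series_has_active Hb tG ix.
have [_ G0 _ _] := tG.
have bound := gradient_le_height e0 G0 sub am.
have mA : A m.
  by rewrite /A /= ler_pdivlMr//; move: Gx; rewrite -/(F x); lra.
have d1d : 0 < d1 <= d by rewrite d10 ge_min lexx.
have [y Oy lt] := Hd m mA d1 d1d.
have := infseries_le gG Oy; have := am y Oy; move: Gx; rewrite -/(F x).
by lra.
Qed.

(** Inside [Om] the bound on the gradients makes the infimum locally Lipschitz; at
the boundary it is squeezed between [0] and any one of the series. *)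
Lemma infseries_cont : {within Om, continuous F}.
Proof.
case: GG0 => G gG; have [cG G0 Gb _] := tGG gG.
apply/within_l1P => x Ox e e0.
case: (pselect (interior Om x)) => [ix|nix]; last first.
  have Gx : G x = 0 by exact: Gb.
  have Fx : F x = 0.
    apply/eqP; rewrite eq_le infseries_ge0// andbT.
    by rewrite -Gx; exact: infseries_le.
  have [d d0 H] := (within_l1P _ _).1 cG x Ox e e0; exists d => // y Oy yx.
  have := H y Oy yx; rewrite Fx Gx !subr0 !ger0_norm ?infseries_ge0 ?G0//.
  exact/le_lt_trans/infseries_le.
have [z Oz Gz] := body_max Hb cG.
have /interior_l1P[r r0 sub] := ix.
pose L := 8 * G z / r + 1.
have L0 : 0 < L.
  by rewrite /L ltr_wpDl// divr_ge0 ?(ltW r0)// mulr_ge0// G0.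
have Lb y m : l1 (y - x) < r / 2 -> active Om F y m -> l1 (ivec R m) <= L - 1.
  move=> yx am.
  have sub' w : l1 (w - y) < r / 2 -> Om w.
    move=> wy; apply: sub; have := l1D (w - y) (y - x).
    by rewrite addrA subrK; lra.
  have Oy : Om y by apply: sub; lra.
  have := gradient_le_height (e := r / 2) ltac:(lra) infseries_ge0 sub' am.
  have := Gz y Oy; have := infseries_le gG Oy => h1 h2 h3.
  by rewrite /L addrK ler_pdivlMr//; lra.
exists (Num.min (r / 2) (e / L)).
  by rewrite lt_min !divr_gt0.
move=> y Oy; rewrite lt_min => /andP[yr]; rewrite ltr_pdivlMr// => ye.
have iy : interior Om y.
  apply/interior_l1P; exists (r / 2); first by lra.
  move=> w wy; apply: sub; have := l1D (w - y) (y - x).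
  by rewrite addrA subrK; lra.
have [m am] := infseries_has_active ix; have [k ak] := infseries_has_active iy.
have bm := Lb x m ltac:(by rewrite subrr /l1 normr0 addr0; lra) am.
have bk := Lb y k yr ak.
have h1 := am y Oy; have h2 := ak x Ox.
have := dot_le_l1 (ivec R m) (y - x); have := dot_le_l1 (ivec R k) (x - y).
rewrite [l1 (x - y)]l1C !ler_norml ltr_norml => /andP[_ u1] /andP[_ u2].
have := l1_ge0 (y - x) => l0.
have := ler_wpM2r l0 bm; have := ler_wpM2r l0 bk.
by nra.
Qed.

Lemma infseries_tropical : tropical_series Om F.
Proof.
apply: tropical_series_of_active => //.
- exact: infseries_cont.
- exact: infseries_ge0.
- move=> x [Ox nix]; case: GG0 => G gG; have [_ _ Gb _] := tGG gG.
  apply/eqP; rewrite eq_le infseries_ge0// andbT -(Gb x)//.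
  exact: infseries_le.
- exact: infseries_has_active.
Qed.

End Infimum.

Section Lowering.
Variables (F : R * R -> R) (e : R) (S : seq (int * int)).
Hypothesis tF : tropical_series Om F.
Hypothesis e0 : 0 < e.
Let line m x := psi Om F (ivec R m) - e + dot (ivec R m) x.
Hypothesis Se : forall m, m \in S -> forall x, Om x -> 0 <= line m x.

(** [F] with the coefficients of the gradients in [T] lowered by [e]. *)
Definition lower (T : seq (int * int)) x :=
  foldr (fun m g => Num.min g (psi Om F (ivec R m) - e + dot (ivec R m) x))
    (F x) T.

Lemma lower_le T x : lower T x <= F x.
Proof.
by elim: T => //= m T IH; apply: le_trans IH; rewrite ge_min lexx.
Qed.

Lemma lower_line T m x : m \in T -> lower T x <= line m x.
Proof.
elim: T => //= k T IH; rewrite inE => /orP[/eqP <-|/IH H].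
  by rewrite ge_min lexx orbT.
by apply: le_trans H; rewrite ge_min lexx.
Qed.

Lemma lower_cases T x :
  lower T x = F x \/ exists2 m, m \in T & lower T x = line m x.
Proof.
elim: T => [|k T IH] /=; first by left.
rewrite /Num.min; case: ifP => _.
  case: IH => [->|[m mT ->]]; [by left|right; exists m => //].
  by rewrite inE mT orbT.
by right; exists k => //; rewrite mem_head.
Qed.

Lemma lower_cont T : {within Om, continuous (lower T)}.
Proof.
elim: T => [|m T IH]; first by case: tF.
apply/within_l1P => x Ox d d0.
have [d1 d10 H1] := (within_l1P _ _).1 IH x Ox d d0.
have [d2 d20 H2] := (within_l1P _ _).1 (@within_affine _ Om (ivec R m)
  (psi Om F (ivec R m) - e)) x Ox d d0.
exists (Num.min d1 d2); first by rewrite lt_min d10.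
move=> y Oy; rewrite lt_min => /andP[y1 y2].
have /= := H2 y Oy y2; have := H1 y Oy y1; rewrite /= !ltr_norml.
set a := lower T y; set b := lower T x.
set c := _ + dot _ y; set k := _ + dot _ x => h1 h2.
rewrite /Num.min; case: (ltP a c) => h3; case: (ltP b k) => h4; lra.
Qed.

Lemma lower_series : tropical_series Om (lower S).
Proof.
have [cF F0 Fb _] := tF.
have L0 x : Om x -> 0 <= lower S x.
  move=> Ox; case: (lower_cases S x) => [->|[m mS ->]]; first exact: F0.
  exact: Se.
apply: tropical_series_of_active => //.
- exact: lower_cont.
- move=> x [Ox nix]; apply/eqP; rewrite eq_le L0// andbT.
  by rewrite -(Fb x)//; exact: lower_le.
- move=> x ix; have Ox := interior_subset ix.
  case: (lower_cases S x) => [E|[m mS E]].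
    have [m am] := series_has_active Hb tF ix; exists m => y Oy; rewrite E.
    exact: le_trans (lower_le _ _) (am y Oy).
  exists m => y Oy; rewrite E; apply: le_trans (lower_line _ mS) _.
  by rewrite /line dotBr; lra.
Qed.

(** A corner survives when none of its active gradients is lowered, or at least
two of them are: these then attain the new minimum together. *)
Lemma lower_corner x : interior Om x -> corner_locus Om F x ->
  (forall m, m \in S -> ~ active Om F x m -> F x <= line m x) ->
  (forall m, m \in S -> active Om F x m ->
     exists m', [/\ m' \in S, active Om F x m' & m' != m]) ->
  corner_locus Om (lower S) x.
Proof.
move=> ix /(corner_locusP Hb tF ix)[k [k' [kk' ak ak']]] small two.
have [cF _ _ _] := tF; have Ox := interior_subset ix.
apply/(corner_locusP Hb lower_series ix).
case: (pselect (exists2 m, m \in S & active Om F x m)) => [[m mS am]|none].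
  have [m' [m'S am' mm']] := two m mS am.
  have lineF n : active Om F x n -> line n x = F x - e.
    by move=> /(superdiff_psi Hb _ cF Ox) ->; rewrite /line; ring.
  have E : lower S x = F x - e.
    apply/eqP; rewrite eq_le; apply/andP; split.
      by rewrite -(lineF m am) lower_line.
    case: (lower_cases S x) => [->|[n nS ->]]; first by rewrite gerBl ltW.
    case: (pselect (active Om F x n)) => [/lineF ->//|an].
    by apply: le_trans (small n nS an); rewrite gerBl ltW.
  have up n : n \in S -> active Om F x n -> active Om (lower S) x n.
    move=> nS an y Oy; apply: le_trans (lower_line _ nS) _.
    by rewrite E -(lineF n an) /line dotBr; lra.
  by exists m', m; split => //; exact: up.
have E : lower S x = F x.
  apply/eqP; rewrite eq_le lower_le/=.
  case: (lower_cases S x) => [->//|[n nS ->]]; apply: small => // an.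
  by apply: none; exists n.
have up n : active Om F x n -> active Om (lower S) x n.
  move=> an y Oy; apply: le_trans (lower_le _ _) _; rewrite E; exact: an.
by exists k, k'; split => //; exact: up.
Qed.

End Lowering.

(** The gradients whose coefficient can be lowered without making [F] negative. *)
Definition free_coef F m := exists2 d : R, 0 < d &
  forall x, Om x -> d <= psi Om F (ivec R m) + dot (ivec R m) x.

Section Minimal.
Variables (N : nat) (p : 'I_N -> R * R).
Let F := relaxation Om p.
Let GG := [set G | tropical_series Om G /\ range p `<=` corner_locus Om G].
Hypothesis GG0 : GG !=set0.

Lemma relaxation_series : tropical_series Om F.
Proof. by apply: infseries_tropical => // G []. Qed.

Lemma relaxation_le G x : tropical_series Om G ->
  range p `<=` corner_locus Om G -> Om x -> F x <= G x.
Proof. by move=> tG pG Ox; apply: infseries_le => // H []. Qed.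

Hypothesis pF : forall i, corner_locus Om F (p i).

(** If no marked point had exactly one active gradient in [S], all coefficients of
[S] could be lowered together with the points kept on the corner locus, against
the minimality of the relaxation. *)
Lemma free_unique (S : seq (int * int)) : S != [::] ->
  (forall m, m \in S -> free_coef F m) ->
  exists i m, [/\ m \in S, active Om F (p i) m &
    forall m', m' \in S -> active Om F (p i) m' -> m' = m].
Proof.
move=> S0 freeS; apply: contrapT => H.
have two i m : m \in S -> active Om F (p i) m ->
    exists m', [/\ m' \in S, active Om F (p i) m' & m' != m].
  move=> mS am; apply: contrapT => H'; apply: H; exists i, m; split => // m' m'S am'.
  by apply: contrapT => /eqP mm'; apply: H'; exists m'.
have tF := relaxation_series; have [cF F0 Fb _] := tF.
have ip i : interior Om (p i) by case: (pF i).
have Op i := interior_subset (ip i).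
have [m mS|d1 d10 H1] := @finite_small R _ [set` S] (fun m e => forall x, Om x ->
    0 <= psi Om F (ivec R m) - e + dot (ivec R m) x) (finite_seq _).
  have [d d0 Hd] := freeS m mS; exists d => // e e0 x Ox.
  by have := Hd x Ox; lra.
have [im|d2 d20 H2] := @finite_small R _ [set` [seq (i, m) | i <- enum 'I_N, m <- S]]
    (fun im e => ~ active Om F (p im.1) im.2 ->
      F (p im.1) <= psi Om F (ivec R im.2) - e + dot (ivec R im.2) (p im.1))
    (finite_seq _).
  move=> _; case: (pselect (active Om F (p im.1) im.2)) => [a|na]; first by exists 1.
  exists (psi Om F (ivec R im.2) + dot (ivec R im.2) (p im.1) - F (p im.1)).
    rewrite subr_gt0 lt_neqAle psi_ub// andbT; apply/negP => /eqP E.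
    by apply: na; apply/superdiff_psi.
  by move=> e e0 _; lra.
pose e := Num.min d1 d2.
have e0 : 0 < e by rewrite lt_min d10.
have e1 : 0 < e <= d1 by rewrite e0 ge_min lexx.
have e2 : 0 < e <= d2 by rewrite e0 ge_min lexx orbT.
have Se m : m \in S -> forall x, Om x ->
    0 <= psi Om F (ivec R m) - e + dot (ivec R m) x.
  by move=> mS x Ox; apply: H1.
have tL := lower_series tF Se.
have pL : range p `<=` corner_locus Om (lower F e S).
  move=> _ [i _ <-]; apply: lower_corner => //; last by move=> m; exact: two.
  move=> m mS na; apply: (H2 (i, m)) => //=.
  by apply/allpairsP; exists (i, m); split => //; rewrite mem_enum.
case: S S0 freeS two H H1 H2 Se tL pL => // m S _ _ _ _ _ _ _ tL pL.
have [x Ox ax] := psi_attained Hb (ivec R m) cF.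
have := relaxation_le tL pL Ox.
have := @lower_line F e (m :: S) m x (mem_head _ _).
by move/(superdiff_psi Hb _ cF Ox): ax => ->; lra.
Qed.

End Minimal.

(** If the coefficient is blocked, the lowest affine majorant vanishes somewhere on
[Om]. It cannot do so at an interior point: being nonnegative it would be zero,
and so would [F]. *)
Lemma nonfree_boundary F m : tropical_series Om F -> (exists2 x, Om x & 0 < F x) ->
  ~ free_coef F m -> exists2 y, (Om `\` interior Om) y & active Om F y m.
Proof.
move=> tF [x0 Ox0 Fx0] nf; have [cF F0 Fb _] := tF.
have [c Oc Hc] := body_max Hb (@within_affine _ Om (- ivec R m) 0).
have v0 : psi Om F (ivec R m) + dot (ivec R m) c <= 0.
  rewrite leNgt; apply/negP => v0; apply: nf.
  exists (psi Om F (ivec R m) + dot (ivec R m) c) => // x Ox.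
  have := Hc x Ox; rewrite -[- ivec R m]scaleN1r !dotZl; lra.
have Fc := psi_ub Hb (ivec R m) cF Oc; have F0c := F0 c Oc.
have ac : active Om F c m by apply/superdiff_psi => //; lra.
exists c => //; split => // ic.
have /interior_l1P[e e0 sub] := ic.
have := gradient_le_height e0 F0 sub ac; have -> : F c = 0 by lra.
rewrite mulr0 pmulr_rle0// => lm.
have /l1_eq0 m0 : l1 (ivec R m) = 0.
  by apply/eqP; rewrite eq_le lm l1_ge0.
by have := psi_ub Hb (ivec R m) cF Ox0; move: v0; rewrite m0 !dot0l; lra.
Qed.

End Relaxation.

(** Choose an index with a single partner in [s], remove that partner, repeat. *)
Lemma greedy_injection (T : eqType) (I : Type) (rel : I -> T -> Prop) (s : seq T) :
  inhabited I ->
  (forall S : seq T, S != [::] -> {subset S <= s} ->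
     exists i m, [/\ m \in S, rel i m & forall m', m' \in S -> rel i m' -> m' = m]) ->
  exists f : T -> I, {in s &, injective f} /\ (forall m, m \in s -> rel (f m) m).
Proof.
move=> [i0] H.
have : forall n (S : seq T), (size S <= n)%N -> {subset S <= s} ->
    exists f : T -> I, {in S &, injective f} /\ (forall m, m \in S -> rel (f m) m).
  elim=> [|n IH] S.
    by rewrite leqn0 => /nilP -> _; exists (fun=> i0).
  move=> Sn Ss; have [->|S0] := eqVneq S [::]; first by exists (fun=> i0).
  have [i [m [mS im uniq_m]]] := H S S0 Ss.
  pose S' := [seq k <- S | k != m].
  have [| |f [finj frel]] := IH S'.
  - rewrite -ltnS; apply: leq_trans Sn; rewrite size_filter.
    rewrite -[X in (_ < X)%N](count_predC (pred1 m)) -[X in (X < _)%N]add0n.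
    by rewrite ltn_add2r -has_count has_pred1.
  - by move=> k; rewrite mem_filter => /andP[_ /Ss].
  have inS' k : k \in S -> k != m -> k \in S' by rewrite mem_filter => -> ->.
  have fi k : k \in S -> k != m -> f k <> i.
    move=> kS km E; have := frel k (inS' k kS km); rewrite E => ik.
    by move: km; rewrite (uniq_m k kS ik) eqxx.
  exists (fun k => if k == m then i else f k); split.
    move=> a b aS bS; case: eqVneq => [->|am]; case: eqVneq => [->//|bm] E.
    - by have := fi b bS bm; rewrite E.
    - by have := fi a aS am; rewrite E.
    - by apply: finj => //; exact: inS'.
  move=> k kS; case: eqVneq => [->//|km]; apply: frel; exact: inS'.
by move=> /(_ (size s) s (leqnn _) (fun _ h => h)).
Qed.

(** * Polygons *)

Section Polygon.
Variables (R : realType) (Om : set (R * R)) (s : nat).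
Variables (n : 'I_s -> int * int) (a : 'I_s -> R).
Hypothesis nprim : forall r, primitive (n r).
Hypothesis OmE : Om = [set x | forall r, 0 <= dot (ivec R (n r)) x + a r].
Hypothesis cOm : compact Om.
Hypothesis int0 : interior Om !=set0.
Implicit Types (x y q : R * R).

Lemma normal_neq0 r : ivec R (n r) != 0.
Proof.
apply/eqP => E; have /ivec_inj nr : ivec R (n r) = ivec R 0 by rewrite E.
have := nprim r.
by rewrite /primitive nr /coprimez /= gcdz0.
Qed.

Lemma polygon_interior x :
  interior Om x <-> forall r, 0 < dot (ivec R (n r)) x + a r.
Proof.
split.
  move=> /interior_l1P[e e0 sub] r.
  have : Om (x - (e / 4) *: sgv (ivec R (n r))).
    apply: sub; rewrite addrAC subrr add0r l1N l1Z gtr0_norm; last by lra.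
    by have := l1_sgv (ivec R (n r)); nra.
  rewrite OmE /= => /(_ r); rewrite dotBr dotZr dot_sgv.
  have := l1_gt0 (normal_neq0 r); nra.
move=> H; rewrite OmE.
have : \forall y \near x, forall r : 'I_s, setT r ->
    0 < dot (ivec R (n r)) y + a r.
  apply: near_finite_set => [|r _]; first exact: finite_finset.
  have [d d0 Hd] := (within_l1P _ _).1 (@within_affine _ setT (ivec R (n r)) (a r))
    x I _ (H r).
  apply/near_l1P; exists d => // y yx.
  by have := Hd y I yx; rewrite ltr_norml; lra.
by rewrite /interior; apply: filterS => y Hy r; exact/ltW/Hy.
Qed.

Lemma polygon_body : convex_body Om.
Proof.
split => // x y t /polygon_interior ix Oy t01; apply/polygon_interior => r.
have := ix r; move: Oy; rewrite OmE /= => /(_ r).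
by rewrite dotDr dotZr dotBr; nra.
Qed.

(** The sum of the normals of the sides through [y] is minimal exactly on the
intersection of these sides, and [y] satisfies all other constraints strictly. *)
Lemma boundary_in_face y : (Om `\` interior Om) y ->
  exists2 B, boundary_face Om B & relint B y.
Proof.
move=> [Oy niy]; have [z iz] := int0.
pose J r := dot (ivec R (n r)) y + a r == 0.
have [r0 Jr0] : exists r0, J r0.
  apply: contrapT => /forallNP H; apply: niy; apply/polygon_interior => r.
  rewrite lt_neqAle eq_sym; apply/andP; split; first exact/negP/H.
  by move: Oy; rewrite OmE; apply.
pose q := \sum_(r | J r) ivec R (n r).
have dotq x : dot q x = \sum_(r | J r) dot (ivec R (n r)) x.
  rewrite /q; elim/big_rec2 : _ => [|i u v _ <-]; first exact: dot0l.
  exact: dotDl.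
have Jy r : J r -> dot (ivec R (n r)) y = - a r.
  by move=> /eqP; lra.
have qle x : Om x -> dot q y <= dot q x.
  rewrite !dotq OmE /= => Ox; apply: ler_sum => r Jr.
  by rewrite (Jy r Jr); have := Ox r; lra.
pose B := [set x | Om x /\ forall z, Om z -> dot q x <= dot q z].
have BJ x : B x -> forall r, J r -> dot (ivec R (n r)) x + a r = 0.
  move=> [Ox /(_ y Oy)]; rewrite !dotq => le r Jr.
  apply/eqP; move: Ox; rewrite OmE /= eq_le => /[dup] Ox -> /[!andbT].
  move: le; rewrite (bigD1 r)//= [X in _ <= X](bigD1 r)//= (Jy r Jr).
  have : \sum_(i | J i && (i != r)) dot (ivec R (n i)) y <=
         \sum_(i | J i && (i != r)) dot (ivec R (n i)) x.
    by apply: ler_sum => i /andP[Ji _]; rewrite (Jy i Ji); have := Ox i; lra.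
  by lra.
exists B.
  exists q => //; apply: contraTneq Jr0 => q0.
  have : \sum_(r | J r) dot (ivec R (n r)) (z - y) = 0 by rewrite -dotq q0 dot0l.
  move=> sum0; apply/negP => Jr0.
  have pos r : J r -> 0 < dot (ivec R (n r)) (z - y).
    by move=> Jr; rewrite dotBr (Jy r Jr); have /polygon_interior/(_ r) := iz; lra.
  have := sum0; rewrite (bigD1 r0)//=.
  have : 0 <= \sum_(i | J i && (i != r0)) dot (ivec R (n i)) (z - y).
    by apply: sumr_ge0 => i /andP[Ji _]; exact/ltW/pos.
  by have := pos r0 Jr0; lra.
have By : B y by split.
split => //.
have : \forall x \near y, forall r : 'I_s, setT r ->
    ~~ J r -> 0 < dot (ivec R (n r)) x + a r.
  apply: near_finite_set => [|r _]; first exact: finite_finset.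
  have [Jr|Jr] := boolP (J r); first by apply: filterE.
  have pr : 0 < dot (ivec R (n r)) y + a r.
    rewrite lt_neqAle eq_sym Jr/=.
    by move: Oy; rewrite OmE; apply.
  have [d d0 Hd] := (within_l1P _ _).1 (@within_affine _ setT (ivec R (n r)) (a r))
    y I _ pr.
  apply/near_l1P; exists d => // x yx _.
  by have := Hd x I yx; rewrite ltr_norml; lra.
apply: filterS => x Hx hx.
have xJ r : J r -> dot (ivec R (n r)) x + a r = 0.
  move=> Jr; apply: (hx [set x | dot (ivec R (n r)) x + a r = 0]).
  split; last by move=> u /BJ; apply.
  by move=> u v t /= h1 h2; rewrite dotDr !dotZr; nra.
split.
  rewrite OmE => r /=; have [Jr|Jr] := boolP (J r); first by rewrite xJ.
  exact/ltW/Hx.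
move=> u Ou; apply: le_trans (qle u Ou); rewrite !dotq; apply: ler_sum => r Jr.
by rewrite (Jy r Jr); have := xJ r Jr; lra.
Qed.

Lemma boundary_face_sub B : boundary_face Om B -> B `<=` Om `\` interior Om.
Proof.
move=> [q q0 ->] x [Ox H]; split => // /interior_l1P[e e0 sub].
have Oy : Om (x - (e / 4) *: sgv q).
  apply: sub; rewrite addrAC subrr add0r l1N l1Z gtr0_norm; last by lra.
  by have := l1_sgv q; nra.
have := H _ Oy; rewrite dotBr dotZr dot_sgv.
by have := l1_gt0 q0; nra.
Qed.

End Polygon.

(** * Cells and edges *)

Lemma convex_connected (R : realType) (A : set (R * R)) :
  (forall x y (t : R), A x -> A y -> 0 <= t <= 1 -> A (x + t *: (y - x))) ->
  connected A.
Proof.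
move=> cA; have [->|/set0P[x Ax]] := eqVneq A set0; first exact: connected0.
pose seg y := [set x + t *: (y - x) | t in `[(0 : R), 1]].
have -> : A = \bigcup_(y in A) seg y.
  apply/seteqP; split => z.
    move=> Az; exists z => //; exists 1; first by rewrite /= in_itv /= ler01 lexx.
    by rewrite scale1r addrC subrK.
  by move=> [y Ay [t]]; rewrite /= in_itv /= => t01 <-; exact: cA.
apply: bigcup_connected.
  exists x => y Ay; exists 0; first by rewrite /= in_itv /= ler01 lexx.
  by rewrite scale0r addr0.
move=> y Ay; apply: connected_continuous_connected; first exact: segment_connected.
apply: continuous_subspaceT => t; apply/cvgrPdist_lt => e e0 /=.
apply/near_realP.
have L0 : 0 < `|y - x| + 1 by rewrite ltr_pwDr.
exists (e / (`|y - x| + 1)); first by rewrite divr_gt0.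
move=> u; rewrite ltr_pdivlMr// => us.
rewrite opprD addrACA subrr add0r -scalerBl normrZ distrC.
by apply: le_lt_trans us; rewrite ler_wpM2l// lerDl.
Qed.

Lemma parallel_vec (R : realType) (d u : R * R) : d != 0 ->
  d.1 * u.2 = d.2 * u.1 -> exists c : R, u = c *: d.
Proof.
case: d u => [d1 d2] [u1 u2] /= d0 E.
have [z1|n1] := eqVneq d1 0.
  have n2 : d2 != 0 by apply: contraNneq d0 => ->; rewrite z1.
  exists (u2 / d2); rewrite /GRing.scale /= /scale_pair /=; congr (_, _).
    move: E; rewrite z1 mul0r => /esym/eqP; rewrite mulf_eq0 (negbTE n2) /=.
    by move=> /eqP ->; rewrite scaler0.
  by rewrite /GRing.scale /= divfK.
exists (u1 / d1); rewrite /GRing.scale /= /scale_pair /=; congr (_, _).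
  by rewrite /GRing.scale /= divfK.
by rewrite /GRing.scale /= mulrAC [u1 * _]mulrC -E mulrAC divff// mul1r.
Qed.

Lemma hull_noncollinear (R : realType) (A : set (R * R)) q0 q1 q2 :
  A q0 -> A q1 -> A q2 ->
  (q1 - q0).1 * (q2 - q0).2 != (q1 - q0).2 * (q2 - q0).1 ->
  affine_hull A = setT.
Proof.
move=> A0 A1 A2 D0; apply/seteqP; split => // x _ B [afB AB].
have [[B0 B1] B2] := (AB _ A0, AB _ A1, AB _ A2).
set u := q1 - q0 in D0; set v := q2 - q0 in D0; pose w := x - q0.
pose D := u.1 * v.2 - u.2 * v.1.
have DD : D != 0 by rewrite subr_eq0.
pose al := (w.1 * v.2 - w.2 * v.1) / D; pose be := (u.1 * w.2 - u.2 * w.1) / D.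
have xE : x = (1 - 2^-1) *: ((1 - 2 * al) *: q0 + (2 * al) *: q1) +
              2^-1 *: ((1 - 2 * be) *: q0 + (2 * be) *: q2).
  have E1 : al * u.1 + be * v.1 = w.1 by rewrite /al /be /D; field.
  have E2 : al * u.2 + be * v.2 = w.2 by rewrite /al /be /D; field.
  move: E1 E2; rewrite /u /v /w !pairE => E1 E2.
  by apply: injective_projections; rewrite !pairE; lra.
rewrite xE; apply: (afB); exact: (afB).
Qed.

Section Cells.
Variables (R : realType) (Om : set (R * R)) (F : R * R -> R).
Hypothesis Hb : convex_body Om.
Hypothesis tF : tropical_series Om F.
Implicit Types (x y z q v : R * R) (m k : int * int).

Let cF : {within Om, continuous F}. Proof. by case: tF. Qed.
Let F0 : forall x, Om x -> 0 <= F x. Proof. by case: tF. Qed.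

(** Where the affine function of gradient [m] is active: the cell of gradient [m]
as soon as it has interior points. *)
Definition touch m : set (R * R) := [set x | Om x /\ active Om F x m].

Lemma touchP m x : Om x ->
  touch m x <-> F x = psi Om F (ivec R m) + dot (ivec R m) x.
Proof.
move=> Ox; split => [[_] /(superdiff_psi Hb _ cF Ox)//|E].
by split => //; apply/superdiff_psi.
Qed.

Lemma touch_closed m x :
  (forall e, 0 < e -> exists2 y, touch m y & l1 (y - x) < e) -> touch m x.
Proof.
move=> H; have Ox : Om x.
  apply: closed_l1 => [|e e0]; first exact: body_closed.
  by have [y [Oy _] yx] := H e e0; exists y.
apply/touchP => //; apply/eqP; rewrite eq_le psi_ub//= leNgt; apply/negP => lt.
set g := psi _ _ _ + _ in lt.
have [d1 d10 H1] := (within_l1P _ _).1 cF x Ox ((g - F x) / 2) ltac:(lra).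
have [d2 d20 H2] := (within_l1P _ _).1 (@within_affine _ Om (ivec R m)
  (psi Om F (ivec R m))) x Ox ((g - F x) / 2) ltac:(lra).
have [|y ty] := H (Num.min d1 d2); first by rewrite lt_min d10.
rewrite lt_min => /andP[y1 y2]; have Oy := ty.1.
have := H1 y Oy y1; have := H2 y Oy y2; move/(touchP m Oy): ty => <-.
by rewrite !ltr_norml -/g; lra.
Qed.

Lemma touch_seg m x y (t : R) : interior Om x -> touch m x -> touch m y ->
  0 <= t <= 1 -> touch m (x + t *: (y - x)).
Proof.
move=> ix tx ty t01; have Oz := body_seg Hb ix ty.1 t01.
apply/touchP => //; apply/eqP; rewrite eq_le psi_ub//=.
apply: le_trans (series_concave Hb tF ix ty.1 t01).
rewrite dotDr dotZr dotBr.
move/(touchP m tx.1): tx => ->; move/(touchP m ty.1) : (ty) => ->; lra.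
Qed.

(** A point near the segment is itself on a segment towards [y] that starts near
[x]. *)
Lemma touch_int_seg m x y (t : R) : interior (touch m) x -> touch m y ->
  0 <= t < 1 -> interior (touch m) (x + t *: (y - x)).
Proof.
move=> itx ty t01.
have iI : interior (touch m) `<=` interior Om.
  by apply: interiorS => z [].
have /open_l1P/(_ x itx)[e e0 sub] : open (interior (touch m)) by exact: open_interior.
apply/interior_l1P; exists ((1 - t) * e); first by rewrite mulr_gt0//; lra.
move=> w wz.
pose x' := x + (1 - t)^-1 *: (w - (x + t *: (y - x))).
have t1 : 0 < 1 - t by lra.
have itx' : interior (touch m) x'.
  apply: sub; rewrite addrAC subrr add0r l1Z gtr0_norm ?invr_gt0//.
  by rewrite mulrC ltr_pdivrMr// mulrC.
have -> : w = x' + t *: (y - x').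
  have -> : x' + t *: (y - x') = (1 - t) *: x' + t *: y.
    by rewrite scalerBr scalerBl scale1r addrA addrAC.
  rewrite /x' scalerDr scalerA divff ?gt_eqF// scale1r.
  rewrite scalerBr scalerBl scale1r opprD opprB !addrA.
  by apply: injective_projections; rewrite !pairE; ring.
apply: touch_seg => //; [exact: iI|exact: interior_subset|lra].
Qed.

Lemma cell_touch A m : cell Om F A -> gradient F A m -> A `<=` touch m.
Proof.
move=> [U [[oU _ [u Uu] UO _] _ ->]] [c Hc].
have UcU : U `<=` closure U by exact: subset_closure.
have iu := UO _ Uu; have Ou := interior_subset iu.
have au : active Om F u m.
  apply: series_support => //.
  have : nbhs u U by apply: open_nbhs_nbhs; split.
  by apply: filterS => y Uy; rewrite !Hc; [rewrite dotBr; lra|exact: UcU|exact: UcU].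
have cE : c = psi Om F (ivec R m).
  have := (superdiff_psi Hb _ cF Ou).1 au; rewrite (Hc u (UcU u Uu)).
  by move=> /addIr.
move=> x clx; have Ox : Om x.
  apply: closed_l1 => [|e e0]; first exact: body_closed.
  have [y Uy yx] := (closure_l1P _ _).1 clx e e0.
  by exists y => //; exact: interior_subset (UO y Uy).
by apply/touchP => //; rewrite (Hc x clx) cE.
Qed.

(** The interior is convex, hence connected, and a larger linearity domain has the
same affine function, hence lies in [touch m]. Convexity gives that the closure
of the interior is all of [touch m]. *)
Lemma touch_cell m : interior (touch m) !=set0 ->
  exists A, [/\ cell Om F A, gradient F A m & touch m `<=` A].
Proof.
move=> [u itu]; set U := interior (touch m).
have iI : U `<=` interior Om by apply: interiorS => z [].
have FU x : U x -> F x = psi Om F (ivec R m) + dot (ivec R m) x.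
  by move=> /interior_subset tx; exact/(touchP m tx.1).
have oU : open U by exact: open_interior.
exists (closure U); split.
- exists U; split => //.
    split => //.
    + apply: convex_connected => x y t Ux Uy t01; case: (ltP t 1) => t1.
        by apply: touch_int_seg => //; [exact: interior_subset|lra].
      by have -> : t = 1; [lra|rewrite scale1r addrC subrK].
    + by exists u.
    + by exists (ivec R m), (psi Om F (ivec R m)).
  move=> V [oV _ _ VO [q [c Hc]]] UV; apply/seteqP; split => //.
  have iu : interior Om u by exact: iI.
  have /open_l1P/(_ u itu)[e e0 sub] := oU.
  have qm : q = ivec R m.
    apply/subr0_eq/l1_eq0/eqP; rewrite eq_le l1_ge0 andbT.
    set d := q - ivec R m.
    have Uw : U (u + (e / 4) *: sgv d).
      apply: sub; rewrite addrAC subrr add0r l1Z gtr0_norm; last by lra.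
      by have := l1_sgv d; nra.
    have := FU _ Uw; rewrite (Hc _ (UV _ Uw)).
    have := FU _ itu; rewrite (Hc _ (UV _ itu)).
    rewrite !dotDr !dotZr => h1 h2.
    have : (e / 4) * dot d (sgv d) = 0 by rewrite /d dotBl; lra.
    by rewrite dot_sgv; nra.
  have cE : c = psi Om F (ivec R m).
    by have := FU _ itu; rewrite (Hc _ (UV _ itu)) qm => /addIr.
  rewrite -(open_subsetE _ oV) => x Vx; apply/touchP; last by rewrite Hc// cE qm.
  exact: interior_subset (VO x Vx).
- exists (psi Om F (ivec R m)) => x /closure_l1P clx.
  have tx : touch m x.
    apply: touch_closed => e e0; have [y Uy yx] := clx e e0.
    by exists y => //; exact: interior_subset.
  exact/(touchP m tx.1).
- move=> y ty; apply/closure_l1P => e e0.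
  pose L := l1 (y - u) + e.
  have L0 : 0 < L by rewrite /L; have := l1_ge0 (y - u); lra.
  exists (u + (1 - e / 2 / L) *: (y - u)).
    have h : 0 < e / 2 / L by rewrite !divr_gt0.
    have h1 : e / 2 / L <= 1.
      by rewrite ler_pdivrMr// mul1r /L; have := l1_ge0 (y - u); lra.
    by apply: touch_int_seg => //; lra.
  have -> : u + (1 - e / 2 / L) *: (y - u) - y = - ((e / 2 / L) *: (y - u)).
    by apply: injective_projections; rewrite !pairE; ring.
  rewrite l1N l1Z gtr0_norm ?divr_gt0//.
  by rewrite mulrAC ltr_pdivrMr// /L; have := l1_ge0 (y - u); nra.
Qed.

(** Nearby active gradients lie in one finite set, and those of them that are not
active at [x] have affine functions strictly above [F] around [x]. *)
Lemma active_usc x : interior Om x ->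
  \forall y \near x, forall m, active Om F y m -> active Om F x m.
Proof.
move=> ix; have Ox := interior_subset ix.
have [z Oz Fz] := body_max Hb cF.
have /interior_l1P[e e0 sub] := ix.
have fA := @finite_lattice_ball R (8 * F z / e).
have gap : \forall y \near x, forall m, [set m | l1 (ivec R m) <= 8 * F z / e] m ->
    ~ active Om F x m -> ~ active Om F y m.
  apply: near_finite_set fA _ => m Am.
  case: (pselect (active Om F x m)) => [ax|nax]; first by apply: filterE.
  have lt : F x < psi Om F (ivec R m) + dot (ivec R m) x.
    rewrite lt_neqAle psi_ub// andbT; apply/eqP => E.
    by apply: nax; apply/superdiff_psi.
  set g := _ + dot _ x in lt.
  have [d1 d10 H1] := (within_l1P _ _).1 cF x Ox ((g - F x) / 2) ltac:(lra).
  have [d2 d20 H2] := (within_l1P _ _).1 (@within_affine _ Om (ivec R m)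
    (psi Om F (ivec R m))) x Ox ((g - F x) / 2) ltac:(lra).
  apply/near_l1P; exists (Num.min e (Num.min d1 d2)).
    by rewrite !lt_min e0 d10.
  move=> y; rewrite !lt_min => /and3P[ye y1 y2] _ ay; have Oy := sub y ye.
  have := H1 y Oy y1; have := H2 y Oy y2.
  move/(superdiff_psi Hb _ cF Oy): ay => <-.
  by rewrite !ltr_norml -/g; lra.
near=> y => m ay; apply: contrapT => nax.
have yx : l1 (y - x) < e / 2.
  by near: y; apply/near_l1P; exists (e / 2) => //; lra.
have : forall m, [set m | l1 (ivec R m) <= 8 * F z / e] m ->
    ~ active Om F x m -> ~ active Om F y m by near: y.
apply; [|exact: nax|exact: ay].
have Oy : Om y by apply: sub; lra.
have sub' w : l1 (w - y) < e / 2 -> Om w.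
  move=> wy; apply: sub; have := l1D (w - y) (y - x).
  by rewrite addrA subrK; lra.
have := gradient_le_height (e := e / 2) ltac:(lra) F0 sub' ay.
by have := Fz y Oy => h1 h2; rewrite /= ler_pdivlMr//; lra.
Unshelve. all: by end_near. Qed.

(** At a corner which is not a vertex the active gradients are collinear, hence
the corner locus nearby is the line on which all of them agree. *)
Lemma nonvertex_near x m m' : interior Om x -> ~ vertices Om F x ->
  m != m' -> active Om F x m -> active Om F x m' ->
  \forall y \near x, corner_locus Om F y -> active Om F y m /\ active Om F y m'.
Proof.
move=> ix nv mm' am am'.
have Ox := interior_subset ix.
have col k : active Om F x k -> exists c : R,
    ivec R k - ivec R m = c *: (ivec R m' - ivec R m).
  move=> ak; apply: parallel_vec.
    by rewrite subr_eq0; apply: contra_neq mm' => /ivec_inj.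
  apply/eqP; apply: contrapT => /negP D; apply: nv; split => //.
  exact: (hull_noncollinear am am' ak D).
have aI := near_interior ix.
near=> y => cy; have iy : interior Om y by near: y.
have Oy := interior_subset iy.
have [k [k' [kk' ak ak']]] := (corner_locusP Hb tF iy).1 cy.
have usc : forall m, active Om F y m -> active Om F x m.
  by near: y; exact: active_usc.
have [c Ec] := col k (usc k ak); have [c' Ec'] := col k' (usc k' ak').
have Fx j : active Om F x j -> F x = psi Om F (ivec R j) + dot (ivec R j) x.
  by move=> /(superdiff_psi Hb _ cF Ox).
have Fy j : active Om F y j -> F y = psi Om F (ivec R j) + dot (ivec R j) y.
  by move=> /(superdiff_psi Hb _ cF Oy).
pose d := ivec R m' - ivec R m; pose w := y - x.
have Fk : F y = F x + dot (ivec R k) w.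
  by rewrite /w dotBr (Fy k ak) (Fx k (usc k ak)); ring.
have Fk' : F y = F x + dot (ivec R k') w.
  by rewrite /w dotBr (Fy k' ak') (Fx k' (usc k' ak')); ring.
have kE : ivec R k = ivec R m + c *: d by rewrite -Ec addrC subrK.
have k'E : ivec R k' = ivec R m + c' *: d by rewrite -Ec' addrC subrK.
have dw : dot d w = 0.
  have : (c - c') * dot d w = 0.
    by move: Fk; rewrite Fk' kE k'E dotDl [X in _ = _ + X]dotDl !dotZl mulrBl; lra.
  move/eqP; rewrite mulf_eq0 => /orP[|/eqP //].
  rewrite subr_eq0 => /eqP cc; case/eqP: kk'; apply: (@ivec_inj R).
  by rewrite kE k'E cc.
have Fm : F y = F x + dot (ivec R m) w.
  by rewrite Fk kE dotDl dotZl dw mulr0 addr0.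
have Fm' : F y = F x + dot (ivec R m') w.
  have -> : ivec R m' = ivec R m + d by rewrite /d addrC subrK.
  by rewrite dotDl dw addr0.
split; apply/superdiff_psi => //.
  by rewrite Fm (Fx m am) /w dotBr; ring.
by rewrite Fm' (Fx m' am') /w dotBr; ring.
Unshelve. all: by end_near. Qed.

(** On a component of the corner locus without its vertices, the set where two
given gradients are active is open and closed. *)
Lemma edge_touch E : edge Om F E ->
  exists m m', [/\ m != m', E `<=` touch m & E `<=` touch m'].
Proof.
set S := corner_locus Om F `\` vertices Om F => -[x Sx ->].
have [cx nvx] := Sx; have ix : interior Om x by case: cx.
have [m [m' [mm' am am']]] := (corner_locusP Hb tF ix).1 cx.
set C := connected_component S x.
have CS : C `<=` S by exact: connected_component_sub.
pose D := touch m `&` touch m'.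
have SO y : S y -> Om y by move=> -[[/interior_subset]].
have CD : C `&` D = C.
  apply: component_connected.
  - exists x; split; first exact: connected_component_refl.
    by split; split => //; exact: SO.
  - exists (interior [set z | S z -> D z]); first exact: open_interior.
    apply/seteqP; split => z [Cz].
      move=> [[Oz az] [_ az']]; split => //; have [cz nvz] := CS _ Cz.
      have iz : interior Om z by case: cz.
      have := nonvertex_near iz nvz mm' az az'.
      rewrite /interior /=; apply: filterS => w H Sw; have Ow := SO w Sw.
      by have [h1 h2] := H Sw.1; split; split.
    by move=> /interior_subset H; split => //; apply: H; exact: CS.
  - exists D => //; apply/closure_id/seteqP; split; first exact: subset_closure.
    move=> z /closure_l1P cl; split; apply: touch_closed => e e0;
      by have [y [h1 h2] yz] := cl e e0; exists y.
exists m, m'; split => // z /closure_l1P cl; apply: touch_closed => e e0;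
  have [y Cy yz] := cl e e0; exists y => //; move: Cy; rewrite -CD => -[_ []] //.
Qed.

(** A small step in the direction [v] selects the active gradients with the least
value on [v]; if there is only one, it stays alone in a neighbourhood. *)
Lemma exposed_active x v : interior Om x -> v != 0 ->
  (forall k k', active Om F x k -> active Om F x k' ->
     dot (ivec R k) v = dot (ivec R k') v -> k = k') ->
  exists m, [/\ active Om F x m, interior (touch m) !=set0 &
    forall k, active Om F x k -> dot (ivec R m) v <= dot (ivec R k) v].
Proof.
move=> ix v0 inj; have Ox := interior_subset ix.
have aI := near_interior ix.
have /near_l1P[d d0 H] : \forall y \near x, interior Om y /\
    forall m, active Om F y m -> active Om F x m.
  by apply: filterI => //; exact: active_usc.
have lv := l1_gt0 v0.
pose t := d / 2 / l1 v.
have t0 : 0 < t by rewrite /t !divr_gt0.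
pose y := x + t *: v.
have [iy usc] : interior Om y /\ forall m, active Om F y m -> active Om F x m.
  by apply: H; rewrite /y addrAC subrr add0r l1Z gtr0_norm// /t divfK ?gt_eqF//; lra.
have Oy := interior_subset iy.
have [m am] := series_has_active Hb tF iy.
have mk k : active Om F x k -> dot (ivec R m) v <= dot (ivec R k) v.
  move=> ak; have Fk := ak y Oy; have Fm := am x Ox; have Fxm := usc m am.
  have := (superdiff_psi Hb _ cF Oy).1 am; have := (superdiff_psi Hb _ cF Ox).1 Fxm.
  move: Fk; rewrite /y [x + _ - x]addrAC subrr add0r dotDr !dotZr => h1 h2 h3.
  have : t * dot (ivec R m) v <= t * dot (ivec R k) v by lra.
  by rewrite ler_pM2l.
have only k : active Om F y k -> k = m.
  move=> ak; apply: inj; [exact: usc|exact: usc|].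
  have axk := usc k ak; have axm := usc m am.
  have := (superdiff_psi Hb _ cF Oy).1 am; have := (superdiff_psi Hb _ cF Ox).1 axm.
  have := (superdiff_psi Hb _ cF Oy).1 ak; have := (superdiff_psi Hb _ cF Ox).1 axk.
  rewrite /y !dotDr !dotZr => h1 h2 h3 h4.
  have : t * dot (ivec R m) v = t * dot (ivec R k) v by lra.
  by move/(mulfI (lt0r_neq0 t0)).
exists m; split => //; first exact: usc.
exists y; have := active_usc iy.
have := near_interior iy.
rewrite /interior; apply: filterS2 => z iz uz; have Oz := interior_subset iz.
split => //; have [k ak] := series_has_active Hb tF iz.
by rewrite -(only k (uz k ak)).
Qed.

(** Two opposite directions that separate the active gradients expose two
different cells. *)
Lemma corner_two_cells x : interior Om x -> corner_locus Om F x ->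
  exists m m', [/\ m != m', active Om F x m /\ active Om F x m',
    interior (touch m) !=set0 & interior (touch m') !=set0].
Proof.
move=> ix cx; have [k [k' [kk' ak ak']]] := (corner_locusP Hb tF ix).1 cx.
have [e e0 sub] := (interior_l1P _ _).1 ix.
pose K := 4 * F x / e.
have bd m : active Om F x m -> l1 (ivec R m) <= K.
  move=> am; have := gradient_le_height e0 F0 sub am.
  by rewrite /K ler_pdivlMr// mulrC.
(* The first coordinates are integers and the second ones vary by at most [2 K],
   so a slope below [1 / (2 K)] separates the active gradients. *)
have K0 : 0 <= K by apply: le_trans (bd k ak); exact: l1_ge0.
pose del := (2 * K + 1)^-1.
have del0 : 0 < del by rewrite /del invr_gt0; lra.
pose v : R * R := (1, del).
have inj i j : active Om F x i -> active Om F x j ->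
    dot (ivec R i) v = dot (ivec R j) v -> i = j.
  move=> ai aj; rewrite /dot /v /ivec /= !mulr1 => E.
  have := bd i ai; have := bd j aj; rewrite /l1 /ivec /= => bi bj.
  have E' : ((i.1 - j.1)%:~R : R) = del * (j.2 - i.2)%:~R.
    by rewrite !intrB; lra.
  have ij2 : `|((j.2 - i.2)%:~R : R)| < 2 * K + 1.
    rewrite intrB; apply: le_lt_trans (ler_normB _ _) _.
    have := normr_ge0 (i.1%:~R : R); have := normr_ge0 (j.1%:~R : R); lra.
  have : `|((i.1 - j.1)%:~R : R)| < 1.
    rewrite E' normrM gtr0_norm// /del mulrC ltr_pdivrMr ?mul1r//; lra.
  rewrite -intr_norm -[X in _ < X]/(1%:~R) ltr_int.
  move=> lt; have ij1 : i.1 - j.1 = 0 by apply/eqP; rewrite -normr_le0 -ltzD1.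
  move: E'; rewrite ij1 => /esym/eqP; rewrite mulf_eq0 gt_eqF//= intr_eq0 subr_eq0.
  move=> /eqP ij; apply/eqP; rewrite -pair_eqE /pair_eq /= ij eqxx andbT.
  by rewrite -subr_eq0 ij1.
have v0 : v != 0 by rewrite /v xpair_eqE oner_eq0.
have [m [am tm Hm]] := exposed_active ix v0 inj.
have [||m' [am' tm' Hm']] := exposed_active (v := - v) ix.
- by rewrite oppr_eq0.
- move=> i j ai aj; rewrite -scaleN1r !dotZr => /(mulfI _) E.
  by apply: inj => //; apply: E; rewrite oppr_eq0 oner_eq0.
exists m, m'; split => //; apply: contra_neq kk' => mm'.
apply: inj => //.
have := Hm k ak; have := Hm k' ak'; have := Hm' k ak; have := Hm' k' ak'.
by rewrite -mm' -scaleN1r !dotZr; lra.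
Qed.

End Cells.

(** * Free gradients and marked points *)

Definition competitors (R : realType) (Om : set (R * R)) N (p : 'I_N -> R * R) :=
  [set G | tropical_series Om G /\ range p `<=` corner_locus Om G].

Section Stability.
Variables (R : realType) (Om : set (R * R)).
Hypothesis poly : rational_polygon Om.
Implicit Types (F G : R * R -> R) (x y z q v : R * R) (m k : int * int).

Lemma rational_polygon_body : convex_body Om.
Proof. by case: poly => cOm int0 [s [n [a [np E]]]]; exact: (polygon_body np E). Qed.
Let Hb := rational_polygon_body.

Lemma polygon_boundary_face y : (Om `\` interior Om) y ->
  exists2 B, boundary_face Om B & relint B y.
Proof. by case: poly => cOm int0 [s [n [a [np E]]]]; exact: (boundary_in_face np E). Qed.

Lemma zero_series : tropical_series Om (fun=> 0 : R).
Proof.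
apply: tropical_series_of_active => //.
  by apply: continuous_subspaceT => x; exact: cvg_cst.
by move=> x _; exists 0 => y Oy; rewrite /= add0r -[ivec R 0]/(0 : R * R) dot0l.
Qed.

Lemma corner_gt0 F x : tropical_series Om F -> corner_locus Om F x ->
  0 < F x.
Proof.
move=> tF cx; have ix : interior Om x by case: cx.
have [_ F0 _ _] := tF.
have Ox := interior_subset ix.
rewrite lt_neqAle eq_sym F0// andbT; apply/negP => /eqP Fx.
have [m [m' [mm' am am']]] := (corner_locusP Hb tF ix).1 cx.
have [e e0 sub] := (interior_l1P _ _).1 ix.
have z k : active Om F x k -> ivec R k = 0.
  move=> /(gradient_le_height e0 F0 sub); rewrite Fx mulr0 pmulr_rle0// => le.
  by apply: l1_eq0; apply/eqP; rewrite eq_le le l1_ge0.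
by case/eqP: mm'; apply: (@ivec_inj R); rewrite !z.
Qed.

(** Without competitors the infimum would be [0], which has no corner. *)
Lemma edge_competitors N (p : 'I_N -> R * R) E :
  edge Om (relaxation Om p) E -> competitors Om p !=set0.
Proof.
move=> [x [cx _] _]; apply/set0P/negP => /eqP C0.
have F0 : relaxation Om p = (fun=> 0).
  apply/funext => z; rewrite /relaxation -/(competitors Om p) C0 image_set0.
  exact: inf0.
by move: cx; rewrite F0 => /(corner_gt0 zero_series); rewrite ltxx.
Qed.

(** On an edge [F] is affine, so the gap between the affine function of gradient
[m] and [F] is affine and nonnegative there; vanishing at a relative interior
point, it vanishes on the edge. *)
Lemma relint_touch F E m x y : tropical_series Om F -> edge Om F E ->
  relint E x -> touch Om F m x -> E y -> touch Om F m y.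
Proof.
move=> tF eE [Ex /near_l1P[d d0 H]] tx Ey; have [cF _ _ _] := tF.
have [k [_ [_ Ek _]]] := edge_touch Hb tF eE.
have [tkx tky] := (Ek x Ex, Ek y Ey).
pose L := l1 (y - x) + 1; have L0 : 0 < L by rewrite /L; have := l1_ge0 (y - x); lra.
pose t := d / 2 / L; have t0 : 0 < t by rewrite /t !divr_gt0.
pose z := x - t *: (y - x).
have Ez : E z.
  apply: H.
    rewrite /z addrAC subrr add0r l1N l1Z gtr0_norm// /t mulrAC ltr_pdivrMr//.
    by rewrite /L; have := l1_ge0 (y - x); nra.
  move=> B [aB EB]; have -> : z = (1 - (- t)) *: x + (- t) *: y.
    by apply: injective_projections; rewrite /z !pairE; ring.
  by apply: (aB) => //; exact: EB.
have tkz := Ek z Ez.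
have Fx := (touchP Hb tF m tx.1).1 tx; have Fkx := (touchP Hb tF k tx.1).1 tkx.
have Fky := (touchP Hb tF k tky.1).1 tky.
have Fkz := (touchP Hb tF k tkz.1).1 tkz.
have my := psi_ub Hb (ivec R m) cF tky.1.
have mz := psi_ub Hb (ivec R m) cF tkz.1.
apply/(touchP Hb tF) ; first exact: tky.1.
apply/eqP; rewrite eq_le my /=.
move: Fkz mz; rewrite /z !dotBr !dotZr !dotBr => -> mz.
rewrite -subr_ge0 -(pmulr_rge0 _ t0).
have -> : F y - (psi Om F (ivec R m) + dot (ivec R m) y) =
  dot (ivec R k) y - dot (ivec R k) x - (dot (ivec R m) y - dot (ivec R m) x) by lra.
lra.
Qed.

(** For a gradient active on the boundary, the coefficient is the least one that
keeps the affine function nonnegative on [Om], whatever the series. *)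
Lemma boundary_touch_psi G m y : tropical_series Om G -> (Om `\` interior Om) y ->
  touch Om G m y -> psi Om G (ivec R m) = psi Om (fun=> 0) (ivec R m).
Proof.
move=> tG By ty; have [cG G0 Gb _] := tG; have [cZ _ _ _] := zero_series.
have := (touchP Hb tG m ty.1).1 ty; rewrite (Gb y By) => E.
apply/eqP; rewrite eq_le; apply/andP; split.
  by have := psi_ub Hb (ivec R m) cZ ty.1; lra.
have [z Oz az] := psi_attained Hb (ivec R m) cZ.
have := (superdiff_psi Hb _ cZ Oz).1 az.
have := psi_ub Hb (ivec R m) cG Oz; have := G0 z Oz; lra.
Qed.

Section TypeIso.
Variables (N : nat) (p p' : 'I_N -> R * R).
Let F := relaxation Om p.
Let F' := relaxation Om p'.
Hypothesis tF : tropical_series Om F.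
Variable Phi : set (R * R) -> set (R * R).
Hypothesis iso : marked_type_iso Om F F' p p' Phi.
Variables (i : 'I_N) (E : set (R * R)).
Hypothesis eE : edge Om F E.
Hypothesis Ep : relint E (p i).

Lemma iso_edge_image : edge Om F' (Phi E).
Proof. by apply: (iso_edge iso _).1 => //; constructor 2. Qed.

Lemma iso_series : tropical_series Om F'.
Proof. exact: relaxation_series (edge_competitors iso_edge_image). Qed.

Let cF : {within Om, continuous F}. Proof. by case: tF. Qed.
Let cF' : {within Om, continuous F'}. Proof. by case: iso_series. Qed.

Lemma iso_touch_cell m : interior (touch Om F m) !=set0 ->
  exists2 A, cell Om F A /\ touch Om F m `<=` A & Phi A `<=` touch Om F' m.
Proof.
move=> tm; have [A [cA gA tA]] := touch_cell Hb tF tm.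
exists A => //; apply: cell_touch => //.
- exact: iso_series.
- by apply: (iso_cell iso _).1 => //; constructor 1.
- exact: (iso_gradient iso m cA).1.
Qed.

(** Incidence says that the image of the cell of gradient [m] meets the relative
interior of the image edge, on which the moved point lies. *)
Lemma iso_mark_touch m : interior (touch Om F m) !=set0 -> touch Om F m (p i) ->
  touch Om F' m (p' i).
Proof.
move=> tm tp; have [A [cA tA] PA] := iso_touch_cell tm.
have fA : face Om F A by constructor 1.
have fE : face Om F E by constructor 2.
have [x [Ax Ex]] : incident (Phi A) (Phi E).
  by apply: (iso_incident iso fA fE).1; exists (p i); split => //; exact: tA.
apply: (relint_touch iso_series iso_edge_image Ex); first exact: PA.
by case: ((iso_mark iso i fE).1 Ep).
Qed.

(** The cell of a gradient whose coefficient is blocked meets the relative interior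
of a side or a vertex of the polygon. This face is fixed by the isomorphism, so
the image cell meets it too, and the coefficient stays the same constant. *)
Lemma iso_blocked m y : interior (touch Om F m) !=set0 ->
  (Om `\` interior Om) y -> active Om F y m ->
  psi Om F' (ivec R m) = psi Om (fun=> 0) (ivec R m).
Proof.
move=> tm By ay; have [A [cA tA] PA] := iso_touch_cell tm.
have [B fB rB] := polygon_boundary_face By.
have fA : face Om F A by constructor 1.
have fB' : face Om F B by constructor 4.
have [x [Ax Bx]] : incident (Phi A) (Phi B).
  apply: (iso_incident iso fA fB').1; exists y; split => //.
  by apply: tA; split => //; case: By.
rewrite (iso_boundary iso fB) in Bx.
apply: (boundary_touch_psi iso_series) (PA _ Ax).
by apply: boundary_face_sub fB _ _; case: Bx.
Qed.

End TypeIso.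

Lemma generic_corner N (p : 'I_N -> R * R) :
  tropical_series Om (relaxation Om p) -> strongly_generic Om p ->
  forall i, corner_locus Om (relaxation Om p) (p i).
Proof.
move=> tF [[_ ip] onE _ _] i.
have [E eE [Ep _]] := onE i; have [m [m' [mm' Em Em']]] := edge_touch Hb tF eE.
apply/(corner_locusP Hb tF (ip i)); exists m, m'.
by split => //; [case: (Em _ Ep)|case: (Em' _ Ep)].
Qed.

Lemma sum_indicator (T : eqType) (g : T -> R) (s : seq T) (m : T) :
  uniq s -> \sum_(k <- s) (m == k)%:R * g k = if m \in s then g m else 0.
Proof.
move=> us; case: ifPn => ms.
  rewrite (bigD1_seq m)//= eqxx mul1r big1 ?addr0// => k km.
  by rewrite eq_sym (negbTE km) mul0r.
rewrite big_seq big1// => k ks; have [mk|_] := eqVneq m k; last by rewrite mul0r.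
by rewrite mk ks in ms.
Qed.

(** A marked point lies on two cells, hence gives a linear equation between their
coefficients, and the equations persist for all nearby configurations. Blocked
coefficients being constant, more points than free coefficients would leave a
linear relation between the points, against their independent mobility. *)
Lemma free_ge_points N (p : 'I_N -> R * R) (s : seq (int * int)) :
  strongly_generic Om p -> uniq s -> (0 < N)%N ->
  (forall m, free_coef Om (relaxation Om p) m -> m \in s) -> (N <= size s)%N.
Proof.
set F := relaxation Om p => gen us N0 fs.
have [[_ ip] onE _ [e e0 stab]] := gen.
have [E0 eE0 _] := onE (Ordinal N0).
have C0 := edge_competitors eE0.
have tF : tropical_series Om F by exact: relaxation_series C0.
have [cF _ _ _] := tF.
have cp i := generic_corner tF gen i.
have Fpos : exists2 x, Om x & 0 < F x.
  exists (p (Ordinal N0)); first exact: interior_subset.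
  exact: corner_gt0.
have [M HM] := choice (fun i => corner_two_cells Hb tF (ip i) (cp i)).
have [M' HM'] := choice HM.
have blocked m : m \notin s -> ~ free_coef Om F m by move=> ms /fs; rewrite (negbTE ms).
pose l m : R := psi Om (fun=> 0) (ivec R m).
pose d i : R * R := ivec R (M' i) - ivec R (M i).
have key (p' : 'I_N -> R * R) : (forall i, `|p' i - p i| < e) ->
    exists g : int * int -> R, forall i,
      dot (d i) (p' i) = (if M i \in s then g (M i) else l (M i)) -
        (if M' i \in s then g (M' i) else l (M' i)).
  move=> /stab[Phi iso]; exists (fun m => psi Om (relaxation Om p') (ivec R m)) => i.
  have [E eE rE] := onE i.
  have tF' := iso_series iso eE.
  have [_ [am am'] tm tm'] := HM' i.
  have Op : Om (p i) by exact: interior_subset.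
  have t1 := iso_mark_touch tF iso eE rE tm (conj Op am).
  have t2 := iso_mark_touch tF iso eE rE tm' (conj Op am').
  have psiE m : interior (touch Om F m) !=set0 ->
      (if m \in s then psi Om (relaxation Om p') (ivec R m) else l m) =
      psi Om (relaxation Om p') (ivec R m).
    move=> itm; case: ifPn => // /blocked/(nonfree_boundary Hb tF Fpos)[y By ay].
    by rewrite (iso_blocked tF iso eE itm By ay).
  rewrite !psiE//.
  have := (touchP Hb tF' _ t1.1).1 t1; have := (touchP Hb tF' _ t2.1).1 t2.
  by rewrite /d dotBl => -> ?; lra.
rewrite leqNgt; apply/negP => sN.
pose A : 'M[R]_(N, size s) := \matrix_(i, j)
  ((M i == nth 0 s j)%:R - (M' i == nth 0 s j)%:R).
have /rowV0Pn[w /sub_kermxP wA w0] : kermx A != 0.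
  rewrite kermx_eq0; apply: contraL sN => /eqP rA.
  by rewrite -leqNgt -rA rank_leq_col.
pose b i := (if M i \in s then 0 else l (M i)) - (if M' i \in s then 0 else l (M' i)).
have rel (p' : 'I_N -> R * R) : (forall i, `|p' i - p i| < e) ->
    \sum_i w 0 i * dot (d i) (p' i) = \sum_i w 0 i * b i.
  move=> /key[g Hg].
  have Eg i : dot (d i) (p' i) = \sum_j A i j * g (nth 0 s j) + b i.
    have -> : \sum_j A i j * g (nth 0 s j) =
        \sum_(k <- s) (M i == k)%:R * g k - \sum_(k <- s) (M' i == k)%:R * g k.
      rewrite -sumrB (big_nth 0) big_mkord; apply: eq_bigr => j _.
      by rewrite mxE mulrBl.
    rewrite !sum_indicator// Hg /b.
    by case: (M i \in s); case: (M' i \in s); ring.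
  under eq_bigr do rewrite Eg mulrDr.
  rewrite big_split /= -[RHS]add0r; congr (_ + _).
  under eq_bigr do rewrite mulr_sumr.
  rewrite exchange_big /= big1// => j _.
  have := congr1 (fun B : 'rV_(size s) => B 0 j) wA; rewrite !mxE => wAj.
  under eq_bigr do rewrite mulrA.
  by rewrite -mulr_suml wAj mul0r.
have [i0 wi0] : exists i, w 0 i != 0.
  apply/existsP; rewrite -negb_forall; apply: contra w0 => /forallP H.
  by apply/eqP/rowP => i; rewrite mxE; apply/eqP.
pose t := e / 2 / (`|d i0| + 1).
have L0 : 0 < `|d i0| + 1 by rewrite ltr_pwDr.
have t0 : 0 < t by rewrite /t !divr_gt0.
have r1 := rel p ltac:(by move=> i; rewrite subrr normr0).
have := rel (fun i => if i == i0 then p i + t *: d i else p i).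
rewrite -r1 (bigD1 i0)//= [RHS](bigD1 i0)//= eqxx.
have -> : \sum_(i | i != i0) w 0 i * dot (d i) (if i == i0 then p i + t *: d i else p i)
  = \sum_(i | i != i0) w 0 i * dot (d i) (p i).
  by apply: eq_bigr => i /negbTE ->.
have prem i : `|(if i == i0 then p i + t *: d i else p i) - p i| < e.
  case: eqVneq => [->|_]; last by rewrite subrr normr0.
  rewrite addrAC subrr add0r normrZ gtr0_norm// /t mulrAC ltr_pdivrMr//.
  by have := normr_ge0 (d i0); nra.
have dd : 0 < dot (d i0) (d i0).
  have [mm' _ _ _] := HM' i0.
  have : d i0 != 0 by rewrite subr_eq0 eq_sym; apply: contra_neq mm' => /ivec_inj.
  case: (d i0) => d1 d2; rewrite /dot /= -pair_eqE /pair_eq /= negb_and -!expr2 => h.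
  by rewrite lt_neqAle eq_sym paddr_eq0 ?sqr_ge0// !sqrf_eq0 negb_and h addr_ge0 ?sqr_ge0.
move=> /(_ prem)/addIr; rewrite dotDr dotZr mulrDr -[RHS]addr0 => /addrI/eqP.
by rewrite mulf_eq0 (negbTE wi0) /= mulf_eq0 (gt_eqF t0) (gt_eqF dd).
Qed.

(** The injection of the free gradients into the marked points given by minimality
is onto, because genericity bounds the number of points by that of the free
gradients. *)
Lemma free_points_bij N (p : 'I_N -> R * R) (F := relaxation Om p) :
  strongly_generic Om p -> (0 < N)%N ->
  [/\ tropical_series Om F, (exists2 x, Om x & 0 < F x) &
   exists s : seq (int * int), exists f : int * int -> 'I_N,
   [/\ uniq s, (forall m, m \in s <-> free_coef Om F m),
       perm_eq (map f s) (enum 'I_N) & forall m, m \in s -> active Om F (p (f m)) m]].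
Proof.
move=> gen N0; have [[_ ip] onE _ _] := gen.
have [E0 eE0 _] := onE (Ordinal N0).
have C0 := edge_competitors eE0.
have tF : tropical_series Om F by exact: relaxation_series C0.
have [cF F0 _ _] := tF.
have cp i := generic_corner tF gen i.
have fin : finite_set [set m | free_coef Om F m].
  apply: (@sub_finite_set _ _ (\bigcup_(i in [set: 'I_N]) [set m | active Om F (p i) m])).
    move=> m fm; have [||i [k [+ ak _]]] := free_unique Hb C0 cp (S := [:: m]).
    - by [].
    - by move=> k; rewrite inE => /eqP ->.
    by rewrite inE => /eqP E; exists i => //=; rewrite -E.
  apply: bigcup_finite => [|i _]; first exact: finite_finset.
  exact: active_finite.
have [s0 Es0] := (finite_seqP _).1 fin.
pose s := undup s0.
have inS m : m \in s <-> free_coef Om F m.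
  have -> : free_coef Om F m = [set` s0] m by rewrite -Es0.
  by rewrite mem_undup.
have [||f [finj fact]] := @greedy_injection _ 'I_N (fun i m => active Om F (p i) m) s.
- by constructor; exact: Ordinal N0.
- move=> S S0 Ss; apply: free_unique => // m mS; exact/inS/Ss.
split => //.
  by exists (p (Ordinal N0)); [exact: interior_subset|exact: corner_gt0].
exists s, f; split => //; first exact: undup_uniq.
have us : uniq (map f s) by rewrite map_inj_in_uniq// undup_uniq.
have Ns : (N <= size s)%N.
  by apply: (free_ge_points gen) => //; [exact: undup_uniq|move=> m /inS].
apply: uniq_perm => //; first exact: enum_uniq.
have sub : {subset map f s <= enum 'I_N} by move=> i _; rewrite mem_enum.
have le : (size (enum 'I_N) <= size (map f s))%N by rewrite size_map size_enum_ord.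
by have [_] := uniq_min_size us sub le.
Qed.

End Stability.

(** * Size of the gradients *)

Lemma dot_sum (R : realType) (I : Type) (r : seq I) (P : pred I)
    (g : I -> R * R) (v : R * R) :
  dot (\sum_(i <- r | P i) g i) v = \sum_(i <- r | P i) dot (g i) v.
Proof.
elim/big_rec2 : _ => [|i u w _ <-]; first exact: dot0l.
exact: dotDl.
Qed.

Lemma l1_sum (R : realType) (I : Type) (r : seq I) (P : pred I)
    (g : I -> R * R) :
  l1 (\sum_(i <- r | P i) g i) <= \sum_(i <- r | P i) l1 (g i).
Proof.
elim/big_rec2 : _ => [|i u w _ H]; first by rewrite /l1 normr0 addr0.
by apply: le_trans (l1D _ _) _; rewrite lerD2l.
Qed.

(** Farkas' lemma, by induction on the generators. If [g t] is needed, some [v0] is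
negative on [q] and on [g t] and nonnegative on the other generators. Adding
multiples of [g t], nonnegative ones for these generators, makes everything
orthogonal to [v0], and the hypothesis passes to the modified vectors. *)
Lemma farkas (R : realType) (T : eqType) (s : seq T) (g : T -> R * R) (q : R * R) :
  uniq s ->
  (forall v, (forall t, t \in s -> 0 <= dot (g t) v) -> 0 <= dot q v) ->
  exists2 lam : T -> R, (forall t, 0 <= lam t) & q = \sum_(t <- s) lam t *: g t.
Proof.
elim: s g q => [|t s IH] g q.
  move=> _ H; exists (fun=> 0) => //; rewrite big_nil.
  have := H (- q) (fun t => ltac:(by [])).
  rewrite -scaleN1r dotZr mulN1r oppr_ge0 => qq.
  have qq0 : q.1 * q.1 + q.2 * q.2 <= 0 by [].
  have := sqr_ge0 q.1; have := sqr_ge0 q.2; rewrite !expr2 => h2 h1.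
  have e1 : q.1 * q.1 = 0 by lra.
  have e2 : q.2 * q.2 = 0 by lra.
  apply: injective_projections => /=; apply/eqP.
    by move/eqP: e1; rewrite mulf_eq0 orbb.
  by move/eqP: e2; rewrite mulf_eq0 orbb.
move=> /= /andP[ts us] H.
have glue (lam : T -> R) c (h : T -> R * R) :
    \sum_(k <- s) (if k == t then c else lam k) *: h k = \sum_(k <- s) lam k *: h k.
  rewrite big_seq [RHS]big_seq; apply: eq_bigr => k ks.
  by case: eqVneq => // kt; rewrite -kt ks in ts.
case: (pselect (forall v, (forall k, k \in s -> 0 <= dot (g k) v) -> 0 <= dot q v)).
  move=> /(IH g q us)[lam lam0 qE].
  exists (fun k => if k == t then 0 else lam k); first by move=> k; case: ifP.
  by rewrite big_cons eqxx scale0r add0r glue.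
move=> /existsNP[v0 /not_implyP[sv0 /negP]]; rewrite -ltNge => qv0.
have tv0 : dot (g t) v0 < 0.
  rewrite ltNge; apply/negP => tv0; suff : 0 <= dot q v0 by rewrite leNgt qv0.
  by apply: H => k; rewrite inE => /orP[/eqP ->//|/sv0].
pose c k := - (dot (g k) v0 / dot (g t) v0).
pose g' k := g k + c k *: g t.
pose cq := dot q v0 / dot (g t) v0.
have cq0 : 0 <= cq by rewrite /cq -mulrNN -invrN divr_ge0//; lra.
have c0 k : k \in s -> 0 <= c k.
  by move=> ks; rewrite /c -mulrN -invrN mulr_ge0// ?sv0// invr_ge0; lra.
have [v Hv|lam lam0 q'E] := IH g' (q - cq *: g t) us.
  pose v' := v - (dot (g t) v / dot (g t) v0) *: v0.
  have tv' : dot (g t) v' = 0.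
    by rewrite /v' dotBr dotZr divfK ?lt_eqF// subrr.
  have : 0 <= dot q v'.
    apply: H => k; rewrite inE => /orP[/eqP ->|ks]; first by rewrite tv'.
    have := Hv k ks; rewrite /g' dotDl dotZl /v' dotBr dotZr /c.
    by congr (0 <= _); field; rewrite lt_eqF.
  rewrite dotBl dotZl /v' dotBr dotZr /cq.
  by congr (0 <= _); field; rewrite lt_eqF.
exists (fun k => if k == t then cq + \sum_(k <- s) lam k * c k else lam k).
  move=> k; case: ifP => // _; rewrite addr_ge0// big_seq sumr_ge0// => j js.
  by rewrite mulr_ge0// c0.
rewrite big_cons eqxx glue.
have -> : q = cq *: g t + (q - cq *: g t) by rewrite addrC subrK.
rewrite q'E scalerDl -addrA; congr (_ + _).
rewrite scaler_suml -big_split /=; apply: eq_bigr => k _.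
by rewrite /g' scalerDr scalerA addrC.
Qed.

(** The strict inequality for positive [x] excludes rounding an integer to itself. *)
Lemma truncn_below (R : realType) (x : R) : 0 <= x ->
  exists k : nat, [/\ k%:R <= x, x <= k%:R + 1 & 0 < x -> k%:R < x].
Proof.
move=> x0; have /andP[t1 t2] := truncn_itv x0.
have [E|ne] := eqVneq x (Num.trunc x)%:R.
  case ET : (Num.trunc x) => [|k].
    by exists 0%N; rewrite E ET; split; lra.
  by exists k; rewrite E ET -natr1; split; lra.
exists (Num.trunc x); split => //; first by rewrite natr1 ltW.
by move=> _; rewrite lt_neqAle eq_sym ne.
Qed.

Section Bounds.
Variables (R : realType) (Om : set (R * R)).
Hypothesis poly : rational_polygon Om.
Implicit Types (F G : R * R -> R) (x y z q v : R * R) (m k : int * int).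
Let Hb := rational_polygon_body poly.

Lemma body_bounded : exists2 B : R, 0 < B & forall x, Om x -> l1 x <= B.
Proof.
have cl : {within Om, continuous (@l1 R)}.
  apply/within_l1P => x Ox e e0; exists e => // y Oy yx.
  have h1 := l1D (y - x) x; have h2 := l1D (x - y) y; move: h1 h2.
  by rewrite !subrK [l1 (x - y)]l1C ltr_norml; lra.
have [c Oc Hc] := body_max Hb cl.
exists (l1 c + 1); first by have := l1_ge0 c; lra.
by move=> x /Hc; lra.
Qed.

Lemma compact_depth (K : set (R * R)) : compact K -> K `<=` interior Om ->
  exists2 e : R, 0 < e & forall x, K x -> forall y, l1 (y - x) < e -> Om y.
Proof.
move=> cK KO; have [K0|/set0P Kn0] := eqVneq K set0.
  by exists 1 => // x; rewrite K0.
case: (poly) => cOm int0 [s [n [a [np E]]]].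
have [r _|d d0 H] := @finite_small R 'I_s setT (fun r e => forall x, K x ->
    l1 (ivec R (n r)) * e < dot (ivec R (n r)) x + a r) finite_finset.
  have [c Kc Hc] := compact_EVT_min Kn0 cK (@within_affine _ K (ivec R (n r)) (a r)).
  rewrite inE in Kc.
  have pc : 0 < dot (ivec R (n r)) c + a r.
    exact: (polygon_interior np E c).1 (KO c Kc) r.
  have L0 : 0 < l1 (ivec R (n r)) + 1 by have := l1_ge0 (ivec R (n r)); lra.
  exists ((dot (ivec R (n r)) c + a r) / (l1 (ivec R (n r)) + 1)).
    by rewrite divr_gt0.
  move=> e /andP[e0]; rewrite ler_pdivlMr// => le x Kx.
  by have := Hc x ltac:(by rewrite inE); lra.
exists d => // x Kx y yx; rewrite E => r /=.
have := H r I d ltac:(by rewrite d0 lexx) x Kx.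
have := dot_le_l1 (ivec R (n r)) (y - x); rewrite dotBr ler_norml.
by have := l1_ge0 (ivec R (n r)); nra.
Qed.

(** A gradient [m] is free as soon as [F x0] exceeds the variation of [m] on [Om].
So the number of free gradients is at least of the order of [F x0 ^ 2]. *)
Lemma height_bound F (B : R) (s : seq (int * int)) x0 : tropical_series Om F ->
  (forall x, Om x -> l1 x <= B) -> 0 < B ->
  (forall m, free_coef Om F m -> m \in s) -> (0 < size s)%N -> Om x0 ->
  F x0 <= 8 * B * Num.sqrt (size s)%:R.
Proof.
move=> tF HB B0 fs s0 Ox0; have [cF _ _ _] := tF.
set N := size s in s0 *.
have sq1 : 1 <= Num.sqrt N%:R :> R.
  by rewrite -[X in X <= _]sqrtr1 ler_sqrt ?ler0n// ler1n.
pose n := (Num.trunc (Num.sqrt N%:R : R)).+1.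
have nN : (N < n * n)%N.
  rewrite -(ltr_nat R) natrM -[X in X < _]sqr_sqrtr ?ler0n// expr2.
  have lt : Num.sqrt N%:R < n%:R :> R by exact: truncnS_gt.
  by apply: ltr_pM => //; exact: sqrtr_ge0.
have nle : n%:R <= 2 * Num.sqrt N%:R :> R.
  have /andP[h _] := truncn_itv (sqrtr_ge0 (N%:R : R)).
  by rewrite /n -natr1; lra.
clearbody n; suff : F x0 <= 4 * B * n%:R.
  move=> h; apply: (le_trans h).
  have := ler_wpM2l (ltW B0) nle; lra.
rewrite leNgt; apply/negP => lt.
pose L := [seq ((i%:Z, j%:Z) : int * int) | i <- iota 0 n, j <- iota 0 n].
have uL : uniq L.
  by apply: allpairs_uniq; rewrite ?iota_uniq// => -[i j] [k l] _ _ /= [-> ->].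
have LS : {subset L <= s}.
  move=> m /allpairsP[[i j] /= [iI jI ->]]; move: iI jI.
  rewrite /= !mem_iota !add0n /= => ilt jlt.
  apply: fs; exists (F x0 - 4 * B * n%:R); first by rewrite subr_gt0.
  move=> x Ox; have := psi_ub Hb (ivec R (i%:Z, j%:Z)) cF Ox0.
  have := dot_le_l1 (ivec R (i%:Z, j%:Z)) (x - x0); rewrite dotBr ler_norml => /andP[+ _].
  have -> : l1 (ivec R (i%:Z, j%:Z)) = i%:R + j%:R.
    by rewrite /l1 /ivec /= !ger0_norm ?ler0n.
  have : l1 (x - x0) <= 2 * B.
    have := l1D x (- x0); rewrite l1N; have := HB x Ox; have := HB x0 Ox0; lra.
  have il : i%:R <= n%:R :> R by rewrite ler_nat ltnW.
  have jl : j%:R <= n%:R :> R by rewrite ler_nat ltnW.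
  have i0 : 0 <= i%:R :> R by rewrite ler0n.
  have j0 : 0 <= j%:R :> R by rewrite ler0n.
  have := l1_ge0 (x - x0).
  set l := l1 (x - x0) => l0 lB h1 h2.
  have : (i%:R + j%:R) * l <= (n%:R + n%:R) * (2 * B).
    by apply: ler_pM; rewrite ?addr_ge0 ?lerD.
  by lra.
have := uniq_leq_size uL LS; rewrite size_allpairs size_iota leqNgt => /negP; apply.
exact: nN.
Qed.

(** Let [y] minimize [q] on [Om], so that [q] is a nonnegative combination of the
normals of the sides through [y]. Rounding the coefficients strictly down gives a
lattice gradient [m] that is minimal at [y] too. If [q] is far from the free
gradients, [m] is not free, so [F x] is at most [m] evaluated on [x - y]. This is
less than [q] evaluated on [x - y], which is at most [F x] since [F y >= 0]. *)
Lemma gradient_near_free : exists2 W : R, 0 <= W & forall F (Rm : R), 0 <= Rm ->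
  tropical_series Om F -> (exists2 x, Om x & 0 < F x) ->
  (forall m, free_coef Om F m -> l1 (ivec R m) <= Rm) ->
  forall x q, interior Om x -> superdiff Om F x q -> l1 q <= Rm + W.
Proof.
case: (poly) => cOm int0 [s [n [a [np OE]]]].
exists (\sum_r l1 (ivec R (n r))); first by apply: sumr_ge0 => r _; exact: l1_ge0.
move=> F Rm Rm0 tF Fpos Hfree x q ix sq; have [cF F0 Fb _] := tF.
have Ox := interior_subset ix.
have [y Oy Hy] := body_max Hb (@within_affine _ Om (- q) 0).
have qy z : Om z -> dot q y <= dot q z.
  by move=> /Hy; rewrite -scaleN1r !dotZl; lra.
pose act_r r := dot (ivec R (n r)) y + a r == 0.
pose J := [seq r <- enum 'I_s | act_r r].
have Jy r : r \in J -> dot (ivec R (n r)) y = - a r.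
  by rewrite mem_filter => /andP[/eqP + _]; lra.
have Jpos z r : Om z -> r \in J -> 0 <= dot (ivec R (n r)) (z - y).
  by rewrite OE /= => /(_ r) h rJ; rewrite dotBr (Jy r rJ); lra.
have Jx r : r \in J -> 0 < dot (ivec R (n r)) (x - y).
  by move=> rJ; have := (polygon_interior np OE x).1 ix r; rewrite dotBr (Jy r rJ); lra.
have uJ : uniq J by rewrite filter_uniq// enum_uniq.
have [v Hv|lam lam0 qE] := @farkas R _ J (fun r => ivec R (n r)) q uJ.
  have [r _|d d0 H] := @finite_small R 'I_s setT (fun r e =>
      0 <= dot (ivec R (n r)) (y + e *: v) + a r) finite_finset.
    have [rJ|rJ] := boolP (r \in J).
      exists 1 => // e e0; rewrite dotDr dotZr (Jy r rJ).
      by rewrite addrAC addNr add0r mulr_ge0 ?Hv//; lra.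
    have pr : 0 < dot (ivec R (n r)) y + a r.
      rewrite lt_neqAle eq_sym; apply/andP; split.
        by move: rJ; rewrite mem_filter mem_enum andbT.
      by move: Oy; rewrite OE; apply.
    have L0 : 0 < `|dot (ivec R (n r)) v| + 1 by rewrite ltr_pwDr.
    exists ((dot (ivec R (n r)) y + a r) / (`|dot (ivec R (n r)) v| + 1)).
      by rewrite divr_gt0.
    move=> e /andP[e0]; rewrite ler_pdivlMr// => le.
    rewrite dotDr dotZr; have := lerNnormlW (lexx `|dot (ivec R (n r)) v|).
    by nra.
  have Oyv : Om (y + d *: v).
    by rewrite OE => r /=; apply: H => //; rewrite d0 lexx.
  have := qy _ Oyv; rewrite dotDr dotZr => h.
  by rewrite -(pmulr_rge0 _ d0); lra.
have [k Hk] := choice (fun r => truncn_below (lam0 r)).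
pose m := \sum_(r <- J) (n r *+ k r).
have mE : ivec R m = \sum_(r <- J) (k r)%:R *: ivec R (n r).
  rewrite /m; elim/big_rec2 : _ => [//|r u w _ <-]; rewrite ivecD; congr (_ + _).
  elim: (k r) => [|j IH]; first by rewrite mulr0n scale0r.
  by rewrite mulrS ivecD IH -natr1 scalerDl scale1r addrC.
have qm : q - ivec R m = \sum_(r <- J) (lam r - (k r)%:R) *: ivec R (n r).
  by rewrite qE mE -sumrB; apply: eq_bigr => r _; rewrite scalerBl.
have near : l1 (q - ivec R m) <= \sum_r l1 (ivec R (n r)).
  rewrite qm; apply: le_trans (l1_sum _ _ _) _.
  rewrite /J big_filter big_enum_cond/= -/(index_enum _).
  rewrite [X in _ <= X](bigID act_r) /= ler_wpDr//.
    by apply: sumr_ge0 => r _; exact: l1_ge0.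
  apply: ler_sum => r _; rewrite l1Z ger0_norm; last by have [] := Hk r; lra.
  rewrite -[X in _ <= X]mul1r ler_wpM2r ?l1_ge0//; have [] := Hk r; lra.
rewrite leNgt; apply/negP => far.
have nfm : ~ free_coef Om F m.
  move=> /Hfree mR; have := l1D (q - ivec R m) (ivec R m); rewrite subrK.
  by lra.
have [y' [Oy' ny'] ay'] := nonfree_boundary Hb tF Fpos nfm.
have psim : psi Om F (ivec R m) <= - dot (ivec R m) y.
  have := (superdiff_psi Hb _ cF Oy').1 ay'; rewrite (Fb y' (conj Oy' ny')) => E.
  have : 0 <= dot (ivec R m) (y' - y).
    rewrite mE dot_sum big_seq; apply: sumr_ge0 => r rJ.
    by rewrite dotZl mulr_ge0// Jpos.
  by rewrite dotBr; lra.
have Fx1 := psi_ub Hb (ivec R m) cF Ox.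
have Fx2 := sq y Oy; have Fy := F0 y Oy.
have le0 : dot (q - ivec R m) (x - y) <= 0.
  by move: Fx2; rewrite dotBl !dotBr; lra.
have lt0 : 0 < dot (q - ivec R m) (x - y).
  have term r : r \in J -> 0 <= dot ((lam r - (k r)%:R) *: ivec R (n r)) (x - y).
    by move=> rJ; rewrite dotZl mulr_ge0 ?(ltW (Jx r rJ))//; have [] := Hk r; lra.
  have [r rJ lr] : exists2 r, r \in J & 0 < lam r.
    apply: contrapT => none.
    have q0 : q = 0.
      rewrite qE big_seq big1// => r rJ.
      have -> : lam r = 0; last by rewrite scale0r.
      apply/eqP; rewrite eq_le lam0 andbT leNgt; apply/negP => lr.
      by apply: none; exists r.
    move: far; rewrite q0 /l1 /= normr0 addr0; apply/negP; rewrite -leNgt.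
    by apply: addr_ge0 => //; apply: sumr_ge0 => r _; exact: addr_ge0.
  rewrite qm dot_sum (bigD1_seq r)//= ltr_pwDl//.
    rewrite dotZl mulr_gt0 ?Jx//; have [_ _] := Hk r => /(_ lr); lra.
  by rewrite big_seq_cond; apply: sumr_ge0 => j /andP[jJ _]; exact: term.
by move: le0; rewrite leNgt lt0.
Qed.

(** A free gradient is active at a marked point, whose depth is bounded below in
terms of [K], while the height of [F] is of the order of the square root of the
number of points. *)
Lemma gradient_bound (K : set (R * R)) : compact K -> K `<=` interior Om ->
  exists2 C : R, 0 < C & forall N (p : 'I_N -> R * R),
    (0 < N)%N -> strongly_generic Om p -> (forall i, K (p i)) ->
    (forall m, free_coef Om (relaxation Om p) m ->
       l1 (ivec R m) <= C * Num.sqrt N%:R) /\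
    (forall x q, interior Om x -> superdiff Om (relaxation Om p) x q ->
       l1 q <= C * Num.sqrt N%:R).
Proof.
move=> cK KO; have [B B0 HB] := body_bounded.
have [e e0 He] := compact_depth cK KO; have [W W0 HW] := gradient_near_free.
pose C1 := 32 * B / e.
have C10 : 0 < C1 by rewrite /C1 divr_gt0// mulr_gt0.
exists (C1 + W); first lra.
move=> N p N0 gen Kp.
have [tF Fpos [s [f [us fs pf af]]]] := free_points_bij poly gen N0.
have [cF F0 _ _] := tF.
have sN : size s = N by have := perm_size pf; rewrite size_map size_enum_ord.
have sq1 : 1 <= Num.sqrt N%:R :> R.
  by rewrite -[X in X <= _]sqrtr1 ler_sqrt ?ler0n// ler1n.
have free_le m : free_coef Om (relaxation Om p) m -> l1 (ivec R m) <= C1 * Num.sqrt N%:R.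
  move=> /fs ms.
  have := gradient_le_height e0 F0 (He _ (Kp (f m))) (af m ms).
  have := @height_bound _ B s (p (f m)) tF HB B0 (fun m => (fs m).2).
  rewrite sN => /(_ N0 (interior_subset (KO _ (Kp _)))) h1 h2.
  by rewrite /C1 mulrAC ler_pdivlMr// mulrC; lra.
split=> [m /free_le h|x q ix sq].
  by apply: le_trans h _; rewrite ler_wpM2r ?sqrtr_ge0//; lra.
have := HW _ (C1 * Num.sqrt N%:R) _ tF Fpos free_le x q ix sq.
by rewrite mulr_ge0 ?sqrtr_ge0 ?(ltW C10)// => /(_ isT); nra.
Qed.

End Bounds.

(** * Test functions and integrals of point masses *)

Section TestFunctions.
Variables (R : realType) (Om : set (R * R)).
Hypothesis Hb : convex_body Om.
Variable phi : R * R -> R.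
Hypothesis Cphi : Cc1 (interior Om) phi.
Implicit Types (x y z v : R * R).
Let U : set (R * R) := interior Om.

Lemma differential_dot x v : U x ->
  'D_v phi x = v.1 * partial1 phi x + v.2 * partial2 phi x.
Proof.
case: Cphi => dphi _ _ _ Ux; have df := dphi x Ux.
rewrite /partial1 /partial2 !deriveE//.
have -> : 'd phi x v = 'd phi x (v.1 *: ((1, 0) : R * R) + v.2 *: ((0, 1) : R * R)).
  congr ('d phi x _).
  by apply: injective_projections; rewrite !pairE /= ?mulr1 ?mulr0 ?addr0 ?add0r.
by rewrite linearD !linearZ.
Qed.

Lemma partial_le_gradnorm x :
  `|partial1 phi x| <= gradnorm phi x /\ `|partial2 phi x| <= gradnorm phi x.
Proof.
rewrite /gradnorm -!sqrtr_sqr; split; apply: ler_wsqrtr.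
  by rewrite lerDl sqr_ge0.
by rewrite lerDr sqr_ge0.
Qed.

Let cont_bounded (L : set (R * R)) (f : R * R -> R) : compact L -> L `<=` U ->
  (forall x, U x -> {for x, continuous f}) ->
  exists2 B : R, 0 <= B & forall x, L x -> `|f x| <= B.
Proof.
move=> cL LU cf; have [->|/set0P L0] := eqVneq L set0; first by exists 0.
have cn : {within L, continuous (fun x => `|f x|)}.
  apply/within_l1P => x Lx e e0.
  have /cvgrPdist_lt/(_ e e0)/near_l1P[d d0 H] := cf x (LU x Lx).
  exists d => // y _ yx; apply: le_lt_trans (ler_dist_dist _ _) _.
  by rewrite distrC; exact: H.
have [c Lc Hc] := compact_EVT_max L0 cL cn.
by exists `|f c| => // x Lx; apply: Hc; rewrite inE.
Qed.

(** The gradient is bounded on the compact support and vanishes off it, so the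
supremum is a genuine one. *)
Lemma gradnorm_le x : U x -> gradnorm phi x <= supnorm U (gradnorm phi).
Proof.
move=> Ux; rewrite -[X in X <= _]ger0_norm ?sqrtr_ge0//.
apply: sup_upper_bound; last by exists x.
split; first by exists `|gradnorm phi x|; exists x.
case: Cphi => dphi c1 c2 [L [cL LU L0]].
have [B1 B10 H1] := cont_bounded cL LU c1.
have [B2 B20 H2] := cont_bounded cL LU c2.
exists (Num.sqrt (B1 ^+ 2 + B2 ^+ 2)) => _ [y Uy <-].
rewrite ger0_norm ?sqrtr_ge0//; apply: ler_wsqrtr.
case: (pselect (L y)) => [Ly|nLy].
  rewrite lerD// -[_ ^+ 2]real_normK ?num_real// lerXn2r ?nnegrE//.
    exact: H1.
  exact: H2.
have zero v : 'D_v phi y = 0.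
  have <- : 'D_v (cst (0 : R)) y = 0 by rewrite derive_cst.
  apply: near_eq_derive.
  have oU : open (U `&` ~` L).
    apply: openI; first exact: open_interior.
    by apply: closed_openC; apply: compact_closed => //; exact: norm_hausdorff.
  have : nbhs y (U `&` ~` L) by apply: open_nbhs_nbhs; split.
  by apply: filterS => z [Uz Lz]; rewrite L0.
by rewrite /partial1 /partial2 !zero expr0n addr0 addr_ge0 ?sqr_ge0.
Qed.

Lemma supnorm_ge0 (A : set (R * R)) (f : R * R -> R) : 0 <= supnorm A f.
Proof.
rewrite /supnorm; set E := [set _ | _ in _].
case: (pselect (has_sup E)) => [[[b Eb] ub]|/sup_out ->//].
have b0 : 0 <= b by case: Eb => x _ <-.
by apply: (le_trans b0); apply: sup_upper_bound => //; split => //; exists b.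
Qed.

Lemma lipschitz_interior x y : U x -> U y ->
  `|phi y - phi x| <= supnorm U (gradnorm phi) * l1 (y - x).
Proof.
move=> Ux Uy; pose v := y - x; pose g (t : R) := phi (x + t *: v).
have Uz t : 0 <= t <= 1 -> U (x + t *: v).
  move=> t01; case: Hb => _ _ seg; case: (ltP t 1) => t1.
    by apply: seg => //; [exact: interior_subset|lra].
  by have -> : t = 1; [lra|rewrite scale1r /v addrC subrK].
have gE t : (fun h : R => h^-1 *: ((g \o shift t) (h *: (1 : R)) - g t)) =
    (fun h : R => h^-1 *: ((phi \o shift (x + t *: v)) (h *: v) - phi (x + t *: v))).
  apply/funext => h; rewrite /g /=; congr (_ *: (phi _ - _)).
  by rewrite [h%:A]mulr1 (scalerDl v h t) addrCA.
have dg t : 0 <= t <= 1 -> derivable g t 1.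
  move=> t01; rewrite /derivable gE; apply: diff_derivable.
  by case: Cphi => dphi _ _ _; apply: dphi; exact: Uz.
have Dg t : 'D_1 g t = 'D_v phi (x + t *: v) by rewrite /derive gE.
have [t||c c01 E] := @MVT R g (fun t => 'D_v phi (x + t *: v)) 0 1 ltr01.
- by rewrite in_itv /= => t01; rewrite -Dg; apply: derivableP; apply: dg; lra.
- by apply: derivable_within_continuous => t; rewrite in_itv /=; exact: dg.
have Uc : U (x + c *: v) by apply: Uz; move: c01; rewrite in_itv /=; lra.
move: E; rewrite /g scale1r scale0r addr0 subr0 mulr1.
have -> : x + v = y by rewrite /v addrC subrK.
move=> ->.
rewrite differential_dot//; apply: le_trans (ler_normD _ _) _.
rewrite !normrM /l1 -/v mulrDr.
have [h1 h2] := partial_le_gradnorm (x + c *: v); have h3 := gradnorm_le Uc.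
by apply: lerD; rewrite mulrC ler_wpM2r//; [exact: le_trans h1 h3|exact: le_trans h2 h3].
Qed.

Definition extend0 x := if x \in U then phi x else 0.

(** A segment that ends at a boundary point leaves the support before its end, so
the case of a boundary point reduces to that of two interior points. *)
Lemma lipschitz_extend x y : Om x -> Om y ->
  `|extend0 y - extend0 x| <= supnorm U (gradnorm phi) * l1 (y - x).
Proof.
have G0 := supnorm_ge0 U (gradnorm phi).
have bdry z w : U z -> Om w -> ~ U w ->
    `|phi z| <= supnorm U (gradnorm phi) * l1 (z - w).
  move=> Uz Ow nUw; case: Cphi => _ _ _ [L [cL LU L0]].
  have oL : open (~` L).
    by apply: closed_openC; apply: compact_closed => //; exact: norm_hausdorff.
  have nLw : (~` L) w by move=> /LU.
  have /open_l1P/(_ w nLw)[d d0 H] := oL.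
  pose l := l1 (w - z) + d; have l0 : 0 < l by rewrite /l; have := l1_ge0 (w - z); lra.
  pose t := d / 2 / l; have t0 : 0 < t by rewrite /t !divr_gt0.
  have t1 : t <= 1.
    by rewrite /t ler_pdivrMr// mul1r /l; have := l1_ge0 (w - z); lra.
  pose u := z + (1 - t) *: (w - z).
  have Uu : U u by case: Hb => _ _ seg; apply: seg => //; lra.
  have nLu : ~ L u.
    apply: H; have -> : u - w = - (t *: (w - z)).
      by apply: injective_projections; rewrite /u !pairE; ring.
    rewrite l1N l1Z gtr0_norm// /t mulrAC ltr_pdivrMr// /l.
    by have := l1_ge0 (w - z); nra.
  have := lipschitz_interior Uu Uz; rewrite (L0 u Uu nLu) subr0 => h.
  apply: le_trans h _; apply: ler_wpM2l => //.
  have -> : z - u = (1 - t) *: (z - w).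
    by apply: injective_projections; rewrite /u !pairE; ring.
  by rewrite l1Z ger0_norm; [have := l1_ge0 (z - w); nra|lra].
move=> Ox Oy; rewrite /extend0; case: ifPn => [/set_mem Uy|/negP nUy];
  case: ifPn => [/set_mem Ux|/negP nUx].
- exact: lipschitz_interior.
- by rewrite subr0; apply: bdry => // Ux; apply: nUx; exact: mem_set.
- by rewrite sub0r normrN l1C; apply: bdry => // Uy; apply: nUy; exact: mem_set.
- by rewrite subr0 normr0 mulr_ge0// l1_ge0.
Qed.

End TestFunctions.

Section Measurability.
Variable R : realType.
Local Notation mR := (measurableTypeR R).

Lemma open_measurable2 (A : set (R * R)) : open A ->
  measurable (A : set (mR * mR)).
Proof.
move=> /open_l1P oA.
(* the rational boxes contained in [A] cover it *)
pose box (q : rat * rat * rat * rat) : set (R * R) :=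
  `]ratr q.1.1.1, ratr q.1.1.2[ `*` `]ratr q.1.2, ratr q.2[.
pose f q := if pselect (box q `<=` A) then box q else set0.
have -> : A = \bigcup_q f q.
  apply/seteqP; split => x; last first.
    by move=> [q _]; rewrite /f; case: pselect => // sub; exact: sub.
  move=> Ax; have [e e0 sub] := oA x Ax.
  have rin (a b : R) : a < b -> exists q : rat, a < ratr q < b.
    by move=> /rat_in_itvoo[q]; rewrite in_itv /=; exists q.
  have [a1 h1] := rin (x.1 - e / 2) x.1 ltac:(lra).
  have [b1 h2] := rin x.1 (x.1 + e / 2) ltac:(lra).
  have [a2 h3] := rin (x.2 - e / 2) x.2 ltac:(lra).
  have [b2 h4] := rin x.2 (x.2 + e / 2) ltac:(lra).
  have boxA : box (a1, b1, a2, b2) `<=` A.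
    move=> y []; rewrite /= !in_itv /= => k1 k2; apply: sub; rewrite /l1 !pairE.
    suff : `|y.1 - x.1| < e / 2 /\ `|y.2 - x.2| < e / 2 by lra.
    by rewrite !ltr_norml; lra.
  exists (a1, b1, a2, b2) => //; rewrite /f.
  case: (pselect (box (a1, b1, a2, b2) `<=` A)) => // h.
  by rewrite /box; split; rewrite /= in_itv /=; lra.
apply: countable_bigcupT_measurable; first exact: countableP.
move=> q; rewrite /f; case: pselect => h; last exact: measurable0.
by apply: measurableX; exact: measurable_itv.
Qed.

Lemma closed_measurable2 (A : set (R * R)) : closed A ->
  measurable (A : set (mR * mR)).
Proof. by move=> /closed_openC/open_measurable2/measurableC; rewrite setCK. Qed.

Lemma open_continuous_measurable2 (U : set (R * R)) (f : R * R -> R) : open U ->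
  (forall x, U x -> {for x, continuous f}) ->
  measurable_fun (U : set (mR * mR)) (f : mR * mR -> R).
Proof.
move=> oU cf; apply: (measurability _ (RGenOpens.measurableE R)).
move=> _ [_ [a [b ->] <-]]; apply: open_measurable2; rewrite openE => x [Ux fx].
rewrite /interior; apply: filterI; first by apply: open_nbhs_nbhs; split.
by apply: (cf x Ux); apply: open_nbhs_nbhs; split => //; exact: interval_open.
Qed.

End Measurability.

Section Atoms.
Context d (T : measurableType d) (R : realType).
Import HBNNSimple.

(** The integral only depends on the values of the set function on the level sets
of simple functions. *)
Lemma integral_bare (m1 : set T -> \bar R) (m2 : {measure set T -> \bar R})
    (D : set T) (f : T -> \bar R) :
  (forall A, measurable A -> m1 A = m2 A) ->
  (\int[m1]_(x in D) f x = \int[m2]_(x in D) f x)%E.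
Proof.
move=> m12; rewrite /integral.
have E (g : T -> \bar R) :
  [set sintegral m1 h | h in [set h : {nnsfun T >-> R} | forall x, ((h x)%:E <= g x)%E]] =
  [set sintegral m2 h | h in [set h : {nnsfun T >-> R} | forall x, ((h x)%:E <= g x)%E]].
  have s (h : {nnsfun T >-> R}) : sintegral m1 h = sintegral m2 h.
    by apply: eq_fsbigr => r _; rewrite m12.
  by apply/seteqP; split => _ [h hg <-]; exists h.
by rewrite !E.
Qed.

Lemma integral_atoms (mu : set T -> \bar R) (D : set T) (k : nat)
    (a : nat -> {nonneg R}) (v : nat -> T) (f : T -> R) :
  measurable D -> measurable_fun D f -> (forall i, (i < k)%N -> D (v i)) ->
  (forall A, measurable A ->
     mu A = (\sum_(i < k) ((a i)%:num)%:E * \d_(v i) A)%E) ->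
  (\int[mu]_(x in D) (f x)%:E = (\sum_(i < k) (a i)%:num * f (v i))%:E)%E.
Proof.
move=> mD mf vD muE.
pose m i : {measure set T -> \bar R} := mscale (a i) (dirac (v i)).
rewrite (@integral_bare mu (msum m k)) => [|A mA]; last by rewrite muE.
have mE : measurable_fun D (EFin \o f) by exact/measurable_EFinP.
have key (g : T -> \bar R) : (forall x, D x -> (0 <= g x)%E) -> measurable_fun D g ->
    (\int[msum m k]_(x in D) g x = \sum_(i < k) ((a i)%:num)%:E * g (v i))%E.
  move=> g0 mg; rewrite ge0_integral_measure_sum//; apply: eq_bigr => i _.
  rewrite ge0_integral_mscale// integral_dirac// diracE mem_set ?mul1e//.
  exact: vD.
rewrite integralE !key//; last 2 first.
- exact: measurable_funeneg.
- exact: measurable_funepos.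
have parts (g : T -> R) : (\sum_(i < k) ((a i)%:num)%:E * (g (v i))%:E =
    (\sum_(i < k) (a i)%:num * g (v i))%:E)%E.
  by rewrite -sumEFin; apply: eq_bigr => i _; rewrite EFinM.
have posE x : ((fun x => (f x)%:E)^\+ x = (Num.max (f x) 0)%:E)%E by rewrite funeposE EFin_max.
have negE x : ((fun x => (f x)%:E)^\- x = (Num.max (- f x) 0)%:E)%E.
  by rewrite funenegE -EFinN EFin_max.
under eq_bigr do rewrite posE.
under [X in (_ - X)%E]eq_bigr do rewrite negE.
rewrite (parts (fun x => Num.max (f x) 0)) (parts (fun x => Num.max (- f x) 0)).
rewrite -EFinB; congr EFin; rewrite -sumrB; apply: eq_bigr => i _.
rewrite -mulrBr; congr (_ * _).
by rewrite /Num.max; case: ltP => h1; case: ltP => h2; lra.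
Qed.

End Atoms.

(** * Area in the gradient plane *)

Section ScaledMeasure.
Variable R : realType.
Local Notation mR := (measurableTypeR R).
Local Notation P := (mR * mR)%type.
Implicit Types (u q : R * R) (t c : R).

Definition hline u c : set (R * R) := [set q | dot u q = c].

Definition unit_square (m : int * int) : set (R * R) :=
  `[m.1%:~R, (m.1 + 1)%:~R[ `*` `[m.2%:~R, (m.2 + 1)%:~R[.

Lemma hline_closed u c : closed (hline u c).
Proof.
have oC : open (~` hline u c).
  apply/open_l1P => x /= xc.
  have x0 : 0 < `|dot u x - c| by rewrite normr_gt0 subr_eq0; apply/eqP.
  have [d d0 H] := (within_l1P _ _).1 (@within_affine _ setT u 0) x I _ x0.
  exists d => // y /(H y I); rewrite !add0r => yx yc; move: yx.
  by rewrite yc distrC ltxx.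
by have := open_closedC oC; rewrite setCK.
Qed.

Lemma hline_measurable u c : measurable (hline u c : set P).
Proof. by apply: closed_measurable2; exact: hline_closed. Qed.

Lemma unit_square_measurable m : measurable (unit_square m : set P).
Proof. by apply: measurableX; exact: measurable_itv. Qed.

Lemma leb2_hline u c : u != 0 -> leb2 (hline u c : set P) = 0%E.
Proof.
move=> u0; rewrite /leb2; have [u2|u2] := eqVneq u.2 0.
  have u1 : u.1 != 0.
    by apply: contra_neq u0 => u1; apply: injective_projections.
  have -> : (hline u c : set P) = ([set c / u.1] : set mR) `*` (setT : set mR).
    apply/seteqP; split => -[x y]; rewrite /hline /dot /= u2 mul0r addr0.
      by move=> <-; split => //=; rewrite mulrAC divff// mul1r.
    by move=> [/= -> _]; field.
  have m1 : measurable ([set c / u.1] : set mR).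
    by rewrite -set_itv1; exact: measurable_itv.
  by rewrite product_measure1E//= lebesgue_measure_set1 mul0e.
rewrite /product_measure1; apply: integral0_eq => x _ /=.
have -> : xsection (hline u c : set P) x = [set (c - u.1 * x) / u.2].
  apply/seteqP; split => y; rewrite /xsection /= inE /hline /dot /=.
    by move=> <-; rewrite addrAC subrr add0r mulrAC divff// mul1r.
  by move=> ->; field.
exact: lebesgue_measure_set1.
Qed.

(** The measure of the dilated set [t A], by which the gradients of [t F] are
compared with those of [F] and with the integer lattice. *)
Lemma scaled_measure t : 0 < t ->
  exists mu : {measure set P -> \bar R},
  [/\ forall A : set P, mu A = leb2 [set q : P | A (t^-1 *: (q : R * R))],
      forall u c, u != 0 -> mu (hline u c) = 0%E &
      forall m, mu (unit_square m) = (t * t)%:E].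
Proof.
move=> t0; pose f (q : P) : P := (t^-1 * q.1, t^-1 * q.2).
have mf : measurable_fun setT f.
  by apply: measurable_fun_pair; apply: measurable_funM.
pose mu : {measure set P -> \bar R} :=
  measure_function_pushforward__canonical__measure_function_Measure
    (@lebesgue_measure R \x @lebesgue_measure R)%E mf.
exists mu; split.
- by [].
- move=> u c u0; rewrite /= /pushforward.
  have -> : f @^-1` hline u c = hline u (t * c).
    apply/seteqP; split => -[x y]; rewrite /= /hline /dot /=.
      by move=> <-; field; rewrite gt_eqF.
    move=> E; apply: (mulfI (lt0r_neq0 t0)); rewrite -E.
    by field; rewrite gt_eqF.
  exact: leb2_hline.
- move=> m; rewrite /= /pushforward.
  have -> : f @^-1` unit_square m =
     (`[t * m.1%:~R, t * (m.1 + 1)%:~R[ : set mR) `*`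
     (`[t * m.2%:~R, t * (m.2 + 1)%:~R[ : set mR).
    have E (a b x : R) : (a <= t^-1 * x < b) = (t * a <= x < t * b).
      by rewrite mulrC ler_pdivlMr// ltr_pdivrMr// [a * t]mulrC [b * t]mulrC.
    apply/seteqP; split => -[x y]; rewrite /= /unit_square /= !in_itv /=.
      by rewrite !E.
    by rewrite -!E.
  rewrite product_measure1E; [|exact: measurable_itv|exact: measurable_itv].
  have L (i : int) : lebesgue_measure (`[t * i%:~R, t * (i + 1)%:~R[ : set mR) = t%:E.
    rewrite lebesgue_measure_itv /= lte_fin ltr_pM2l// ltr_int ltzD1 lexx.
    by rewrite -EFinD intrD; congr EFin; ring.
  by transitivity (t%:E * t%:E)%E => //; congr (_ * _)%E; exact: L.
Qed.

End ScaledMeasure.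

Section FiniteUnions.
Context d (T : measurableType d) (R : realType) (mu : {measure set T -> \bar R}).

Lemma measure_seq_union (I : eqType) (s : seq I) (E : I -> set T) : uniq s ->
  (forall i, i \in s -> measurable (E i)) ->
  (forall i j, i \in s -> j \in s -> i != j -> E i `&` E j = set0) ->
  measurable [set q | exists2 i, i \in s & E i q] /\
  mu [set q | exists2 i, i \in s & E i q] = (\sum_(i <- s) mu (E i))%E.
Proof.
elim: s => [|i s IH] /=.
  move=> _ _ _; rewrite big_nil.
  have -> : [set q | exists2 i, i \in [::] & E i q] = set0.
    by apply/seteqP; split => // q [].
  by split; [exact: measurable0|exact: measure0].
move=> /andP[is_ us] mE dE.
have [|||mU EU] := IH.
- exact: us.
- by move=> j js; apply: mE; rewrite inE js orbT.
- by move=> j k js ks; apply: dE; rewrite inE ?js ?ks orbT.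
have -> : [set q | exists2 j, j \in i :: s & E j q] =
    E i `|` [set q | exists2 j, j \in s & E j q].
  apply/seteqP; split => q.
    by move=> [j]; rewrite inE => /orP[/eqP ->|js] Ejq; [left|right; exists j].
  by move=> [Eiq|[j js Ejq]]; [exists i; rewrite ?mem_head|exists j; rewrite ?inE ?js ?orbT].
have mi : measurable (E i) by apply: mE; rewrite mem_head.
split; first exact: measurableU.
rewrite measureU//; first by rewrite big_cons; congr (_ + _)%E; exact: EU.
apply/seteqP; split => // q [Eiq [j js Ejq]].
have : (E i `&` E j) q by [].
by rewrite dE ?mem_head ?inE ?js ?orbT//; apply: contraNneq is_ => ->.
Qed.

End FiniteUnions.

(** * Superdifferentials up to null sets *)

Section GradientSets.
Variables (R : realType) (Om : set (R * R)) (F : R * R -> R).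
Hypothesis Hb : convex_body Om.
Hypothesis tF : tropical_series Om F.
Local Notation mR := (measurableTypeR R).
Local Notation P := (mR * mR)%type.
Implicit Types (x y z q v : R * R) (m k : int * int).

Let cF : {within Om, continuous F}. Proof. by case: tF. Qed.
Let F0 : forall x, Om x -> 0 <= F x. Proof. by case: tF. Qed.
Local Notation S := (superdiff Om F).

Lemma superdiff_closed x : closed (S x).
Proof.
have -> : S x = \bigcap_(y in Om) [set q | F y <= F x + dot q (y - x)].
  by apply/seteqP; split => q H y; exact: H.
apply: closed_bigI => y _; rewrite -[X in closed X]setCK; apply: open_closedC.
apply/open_l1P => q /= /negP; rewrite -ltNge => lt.
have L0 : 0 < l1 (y - x) + 1 by have := l1_ge0 (y - x); lra.
exists ((F y - F x - dot q (y - x)) / (l1 (y - x) + 1)).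
  by rewrite divr_gt0//; lra.
move=> r; rewrite ltr_pdivlMr// => rq; apply/negP; rewrite -ltNge.
have := dot_le_l1 (r - q) (y - x); rewrite dotBl ler_norml => /andP[_].
by have := l1_ge0 (r - q); nra.
Qed.

(** Locally [F] is the minimum of its active affine functions, so the
superdifferential is the convex hull of the active gradients. The hull is
described here by its support function. *)
Lemma superdiff_hull x q : interior Om x -> S x q <->
  (forall v, exists m, active Om F x m /\ dot (ivec R m) v <= dot q v).
Proof.
move=> ix; have Ox := interior_subset ix; split; last first.
  move=> H y Oy; have [m [am le]] := H (y - x).
  by apply: le_trans (am y Oy) _; rewrite lerD2l.
move=> sq v; have /near_l1P[d d0 H] := series_local Hb tF ix.
have L0 : 0 < l1 v + 1 by have := l1_ge0 v; lra.
pose t := d / 2 / (l1 v + 1); have t0 : 0 < t by rewrite /t !divr_gt0.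
have [|iy [m [am _ E]]] := H (x + t *: v).
  rewrite addrAC subrr add0r l1Z gtr0_norm// /t mulrAC ltr_pdivrMr//.
  by have := l1_ge0 v; nra.
exists m; split => //; have := sq _ (interior_subset iy).
by rewrite E [x + _ - x]addrAC subrr add0r !dotZr lerD2l ler_pM2l.
Qed.

Definition perp v : R * R := (- v.2, v.1).

(** The union of the lines through two lattice points: a null set that contains the
superdifferentials of dimension at most one. *)
Definition lattice_lines : set (R * R) :=
  \bigcup_(k in [set k : (int * int) * (int * int) | k.1 != k.2])
    hline (perp (ivec R k.2 - ivec R k.1))
          (dot (perp (ivec R k.2 - ivec R k.1)) (ivec R k.1)).

Lemma lattice_line_in m m' q : m != m' ->
  dot (perp (ivec R m' - ivec R m)) (q - ivec R m) = 0 -> lattice_lines q.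
Proof.
move=> mm' E; exists (m, m') => //; rewrite /hline /=.
by move: E; rewrite dotBr => /eqP; rewrite subr_eq0 => /eqP.
Qed.

(** If the active gradients lie on a line, so does their hull; the line contains two
lattice points, or the hull is a single lattice point. *)
Lemma superdiff_sub_lines x v (c : R) : interior Om x -> v != 0 ->
  (forall m, active Om F x m -> dot (ivec R m) v = c) -> S x `<=` lattice_lines.
Proof.
move=> ix v0 H q /(superdiff_hull q ix) sq.
have qv : dot q v = c.
  apply/eqP; rewrite eq_le; apply/andP; split.
    have [m [/H am]] := sq (- v); rewrite -scaleN1r !dotZr am; lra.
  by have [m [/H am]] := sq v; rewrite am.
have [m0 [a0 _]] := sq 0.
case: (pselect (exists2 m, active Om F x m & m != m0)) => [[m am mm0]|only].
  rewrite eq_sym in mm0; apply: (lattice_line_in mm0).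
  have : dot (ivec R m - ivec R m0) v = 0 by rewrite dotBl !H// subrr.
  have : dot (q - ivec R m0) v = 0 by rewrite dotBl qv H// subrr.
  set w := q - _; set d := ivec R m - _; rewrite /dot /perp /= => w0 d0.
  have E1 : v.1 * (- d.2 * w.1 + d.1 * w.2) = 0.
    have -> : v.1 * (- d.2 * w.1 + d.1 * w.2) =
      - d.2 * (w.1 * v.1 + w.2 * v.2) + w.2 * (d.1 * v.1 + d.2 * v.2) by ring.
    by rewrite w0 d0 !mulr0 addr0.
  have E2 : v.2 * (- d.2 * w.1 + d.1 * w.2) = 0.
    have -> : v.2 * (- d.2 * w.1 + d.1 * w.2) =
      d.1 * (w.1 * v.1 + w.2 * v.2) - w.1 * (d.1 * v.1 + d.2 * v.2) by ring.
    by rewrite w0 d0 !mulr0 subr0.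
  apply/eqP; apply: contraNT v0 => ne.
  move/eqP: E1; rewrite mulf_eq0 (negbTE ne) orbF => /eqP z1.
  move/eqP: E2; rewrite mulf_eq0 (negbTE ne) orbF => /eqP z2.
  by apply/eqP; apply: injective_projections.
have qm : q = ivec R m0.
  apply/subr0_eq/l1_eq0/eqP; rewrite eq_le l1_ge0 andbT.
  have [m [am]] := sq (- sgv (q - ivec R m0)).
  have -> : m = m0 by apply: contrapT => /eqP mm0; apply: only; exists m.
  rewrite -scaleN1r !dotZr -dot_sgv dotBl; lra.
apply: (@lattice_line_in m0 (m0 + (1, 0))).
  by rewrite -subr_eq0 opprD addrA subrr add0r oppr_eq0 xpair_eqE oner_eq0.
by rewrite qm subrr dot0r.
Qed.

(** A common supergradient of two points makes [F] affine on the segment between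
them, so the active gradients at its midpoint lie on a line. *)
Lemma superdiff_inter x y q : interior Om x -> interior Om y -> x != y ->
  S x q -> S y q -> lattice_lines q.
Proof.
move=> ix iy xy sx sy; have Ox := interior_subset ix; have Oy := interior_subset iy.
have Fx := (superdiff_psi Hb _ cF Ox).1 sx; have Fy := (superdiff_psi Hb _ cF Oy).1 sy.
pose z := x + 2^-1 *: (y - x).
have iz : interior Om z by case: Hb => _ _ seg; apply: seg => //; lra.
have Oz := interior_subset iz.
have Fz1 := series_concave Hb tF ix Oy (t := 2^-1) ltac:(lra).
have Fz2 := psi_ub Hb q cF Oz.
have Fz : F z = psi Om F q + dot q z.
  apply/eqP; rewrite eq_le Fz2 /=; apply: le_trans Fz1.
  by rewrite /z Fx Fy dotDr dotZr dotBr; lra.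
have sz : S z q by apply/superdiff_psi.
have Fz' : F z = (F x + F y) / 2.
  by rewrite Fz Fx Fy /z dotDr dotZr dotBr; lra.
apply: (superdiff_sub_lines (v := x - y) (c := F x - F y) iz _ _ sz).
  by rewrite subr_eq0.
move=> m am; have := am x Ox; have := am y Oy.
have -> : y - z = 2^-1 *: (y - x).
  by apply: injective_projections; rewrite /z !pairE; field.
have -> : x - z = 2^-1 *: (x - y).
  by apply: injective_projections; rewrite /z !pairE; field.
rewrite !dotZr Fz' !dotBr; lra.
Qed.

(** The points where the Monge-Ampere measure has mass. *)
Definition atom x := interior Om x /\ ~ (S x `<=` lattice_lines).

(** Two points with the same active gradients have them on a line, so an atom is
determined by its set of active gradients, a subset of a finite box. *)
Lemma atom_finite (K : R) :
  (forall x q, interior Om x -> S x q -> l1 q <= K) -> finite_set atom.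
Proof.
move=> HK; have /finite_seqP[s Es] := @finite_lattice_ball R K.
pose h x := [seq m <- s | `[< active Om F x m >]].
have inj x y : atom x -> atom y -> h x = h y -> x = y.
  move=> [ix nx] [iy ny] hxy; apply: contrapT => /eqP xy; apply: nx.
  have Ox := interior_subset ix; have Oy := interior_subset iy.
  have axy m : active Om F x m -> active Om F y m.
    move=> am; have ms : m \in s.
      by have : [set` s] m by rewrite -Es; exact: HK ix am.
    have : m \in h x by rewrite mem_filter ms andbT; exact/asboolP.
    by rewrite hxy mem_filter => /andP[/asboolP].
  apply: (superdiff_sub_lines (v := x - y) (c := F x - F y) ix).
    by rewrite subr_eq0.
  move=> m am; have := am y Oy; have := axy m am x Ox.
  by rewrite !dotBr; lra.
pose B := [set mask (b : (size s).-tuple bool) s | b in [set: (size s).-tuple bool]].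
have fB : finite_set B by apply: finite_image; exact: finite_finset.
pose g L := xget (0 : R * R) [set x | atom x /\ h x = L].
apply: (sub_finite_set _ (finite_image g fB)) => x ax.
exists (h x).
  exists (map_tuple (fun m => `[< active Om F x m >]) (in_tuple s)) => //=.
  by rewrite -filter_mask.
rewrite /g; case: xgetP => [y _ [ay hy]|/(_ x)[]//].
exact: inj.
Qed.

Definition gradients (B : set (R * R)) : set (R * R) :=
  \bigcup_(x in B `&` interior Om) S x.

(** The superdifferential only depends on the finite set of active gradients, so
the union consists of countably many closed sets whatever [B] is. *)
Lemma gradients_measurable (B : set (R * R)) : measurable (gradients B : set P).
Proof.
pose hull (s : seq (int * int)) :=
  [set q | forall v, exists m, m \in s /\ dot (ivec R m) v <= dot q v].
pose Q (s : seq (int * int)) := exists x, [/\ B x, interior Om x &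
   forall m, active Om F x m <-> m \in s].
pose f s := if pselect (Q s) then hull s else set0.
have hullE x s : interior Om x -> (forall m, active Om F x m <-> m \in s) ->
    hull s = S x.
  move=> ix H; apply/seteqP; split => q.
    by move=> h; apply/superdiff_hull => // v; have [m [/H am le]] := h v; exists m.
  by move=> /(superdiff_hull q ix) h v; have [m [/H am le]] := h v; exists m.
have -> : gradients B = \bigcup_s f s.
  apply/seteqP; split => q; last first.
    move=> [s _]; rewrite /f; case: pselect => //= -[x [Bx ix H]].
    by rewrite (hullE x)// => Sq; exists x.
  move=> [x [Bx ix] Sq].
  have [s Es] := (finite_seqP _).1 (active_finite F0 ix).
  have H m : active Om F x m <-> m \in s.
    by have -> : active Om F x m = [set` s] m by rewrite -Es.
  exists s => //; rewrite /f; case: pselect => [h /=|nQ]; first by rewrite (hullE x).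
  by exfalso; apply: nQ; exists x.
apply: countable_bigcupT_measurable; first exact: countableP.
move=> s; rewrite /f; case: pselect => [[x [Bx ix H]] /=|nQ]; last exact: measurable0.
by apply: closed_measurable2; rewrite (hullE x)//; exact: superdiff_closed.
Qed.

Section Measure.
Variable mu : {measure set P -> \bar R}.
Hypothesis mu_line : forall u c, u != 0 -> mu (hline u c) = 0%E.

Lemma lattice_lines_null :
  measurable (lattice_lines : set P) /\ mu lattice_lines = 0%E.
Proof.
pose L (k : (int * int) * (int * int)) : set P :=
  if k.1 != k.2 then hline (perp (ivec R k.2 - ivec R k.1))
          (dot (perp (ivec R k.2 - ivec R k.1)) (ivec R k.1)) else set0.
pose G (n : nat) : set P := if unpickle n is Some k then L k else set0.
have LE : lattice_lines = \bigcup_n G n.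
  apply/seteqP; split => q.
    move=> [k /= kk Hq]; exists (pickle k); first exact: I.
    by rewrite /G pickleK /L kk.
  move=> [n _]; rewrite /G; case: (unpickle n) => // k; rewrite /L.
  by case: ifP => // kk Hq; exists k.
have mL l : measurable (L l).
  by rewrite /L; case: ifP => _; [exact: hline_measurable|exact: measurable0].
have mG n : measurable (G n).
  by rewrite /G; case: unpickle => [k|]; [exact: mL|exact: measurable0].
have mLL : measurable (lattice_lines : set P).
  by rewrite LE; exact: bigcupT_measurable.
split => //; apply/negligibleP => //; rewrite LE; apply: negligible_bigcup => n.
apply/negligibleP => //; rewrite /G; case: unpickle => [k|]; last exact: measure0.
rewrite /L; case: ifPn => kk; last exact: measure0.
apply: mu_line; apply: contra_neq kk => /(congr1 (fun v : R * R => (v.2, - v.1))).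
rewrite /perp /= opprK oppr0 => E; apply/esym/(@ivec_inj R)/subr0_eq.
by apply: injective_projections; [have := congr1 fst E|have := congr1 snd E].
Qed.

(** Off a null set distinct points have disjoint superdifferentials, and only the
atoms have any, so the pulled-back measure is a sum of point masses. *)
Lemma gradients_atoms (W : seq (R * R)) (B : set (R * R)) : uniq W ->
  (forall x, x \in W <-> atom x) ->
  mu (gradients B) =
  (\sum_(v <- W) mu (S v `\` lattice_lines) * \d_(v : P) B)%E.
Proof.
move=> uW WE; have [mL L0] := lattice_lines_null.
have mS x : measurable (S x `\` lattice_lines : set P).
  by apply: measurableD => //; apply: closed_measurable2; exact: superdiff_closed.
have mG := gradients_measurable B.
have -> : mu (gradients B) = mu (gradients B `\` lattice_lines).
  rewrite (measureDI _ mG mL) [X in (_ + X)%E](_ : _ = 0%E) ?adde0//.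
  by apply: (subset_measure0 _ _ _ L0) => //; exact: measurableI.
have -> : gradients B `\` lattice_lines =
    [set q | exists2 v, v \in [seq v <- W | v \in B] & (S v `\` lattice_lines) q].
  apply/seteqP; split => q.
    move=> [[x [Bx ix] Sq] nLq]; exists x => //; rewrite mem_filter mem_set//=.
    by apply/WE; split => // sub; apply: nLq; exact: sub.
  move=> [v]; rewrite mem_filter => /andP[/set_mem Bv /WE[iv _]] [Sq nLq].
  by split => //; exists v.
have [||_ ->] := @measure_seq_union _ P R mu _ [seq v <- W | v \in B]
  (fun v => S v `\` lattice_lines) (filter_uniq _ uW).
- by move=> v _; exact: mS.
- move=> v w; rewrite !mem_filter => /andP[_ /WE[iv _]] /andP[_ /WE[iw _]] vw.
  apply/seteqP; split => // q [[Sv nL] [Sw _]]; apply: nL.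
  exact: superdiff_inter vw Sv Sw.
rewrite big_filter big_mkcond; apply: eq_bigr => v _.
by rewrite diracE; case: (v \in B); rewrite ?mule1 ?mule0.
Qed.

End Measure.

End GradientSets.

(** * Oscillation of the touching points over a lattice cell *)

Definition int_range (n : nat) : seq int :=
  [seq k%:Z - n%:Z | k <- iota 0 (2 * n + 1)].

Lemma int_range_uniq n : uniq (int_range n).
Proof.
by rewrite map_inj_uniq ?iota_uniq// => i j /= /addIr [].
Qed.

Lemma mem_int_range n (i : int) : (i \in int_range n) = (`|i| <= n%:Z).
Proof.
apply/mapP/idP.
  move=> [k]; rewrite mem_iota add0n addn1 ltnS => /= kn ->.
  rewrite ler_norml lerBlDr lerNl opprB lerBlDr -!PoszD !lez_nat addnn -mul2n kn.
  by rewrite leq_addr.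
rewrite ler_norml => /andP[h1 h2].
have i0 : 0 <= i + n%:Z by rewrite -lerBlDr sub0r.
exists (absz (i + n%:Z)); last by rewrite gez0_abs// addrK.
rewrite mem_iota /= add0n addn1 ltnS -lez_nat gez0_abs// mul2n -addnn PoszD.
by rewrite lerD2r.
Qed.

(** The sum telescopes to first differences near the ends of the range. *)
Lemma line_second_diff (R : realType) (f : int -> R) (B : R) n :
  (forall z, `|f (z + 1) - f z| <= B) ->
  \sum_(i <- int_range n) (f (i + 3) + f (i - 3) - 2 * f i) <= 18 * B.
Proof.
move=> fB; rewrite big_map.
pose e (k : nat) := f (k%:Z - n%:Z - 3).
have eB k : `|e k.+1 - e k| <= B.
  have := fB (k%:Z - n%:Z - 3); rewrite /e.
  by congr (`|f _ - _| <= _); rewrite (intS k); ring.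
pose E k := e k.+3 - e k.
have EB k : `|E k| <= 3 * B.
  have := eB k; have := eB k.+1; have := eB k.+2.
  by rewrite /E !ler_norml; lra.
rewrite (eq_bigr (fun k : nat => (E k.+3 - E k.+2) + (E k.+2 - E k.+1) + (E k.+1 - E k))).
  have -> : iota 0 (2 * n + 1) = index_iota 0 (2 * n + 1) by rewrite /index_iota subn0.
  rewrite big_split big_split /=; set M := (2 * n + 1)%N.
  rewrite (_ : \sum_(0 <= k < M) (E k.+3 - E k.+2) = E M.+2 - E 2%N); last first.
    exact: (telescope_sumr (fun k => E k.+2)).
  rewrite (_ : \sum_(0 <= k < M) (E k.+2 - E k.+1) = E M.+1 - E 1%N); last first.
    exact: (telescope_sumr (fun k => E k.+1)).
  rewrite telescope_sumr//.
  have := EB M.+2; have := EB M.+1; have := EB M; have := EB 2%N; have := EB 1%N.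
  by have := EB 0%N; rewrite !ler_norml; lra.
move=> k _; rewrite /E /e.
have -> : k%:Z - n%:Z + 3 = k.+3.+3%:Z - n%:Z - 3.
  by rewrite 6!intS; ring.
have -> : k%:Z - n%:Z = k.+3%:Z - n%:Z - 3 by rewrite 3!intS; ring.
have -> : k.+3%:Z - n%:Z - 3 - 3 = k%:Z - n%:Z - 3 by rewrite 3!intS; ring.
ring.
Qed.

Lemma unit_square_floor (R : realType) (m : int * int) (q : R * R) :
  unit_square m q -> m = (Num.floor q.1, Num.floor q.2).
Proof.
case: m => i j [] /=; rewrite !in_itv /= => h1 h2.
by rewrite (floor_def h1) (floor_def h2).
Qed.

Section Oscillation.
Variables (R : realType) (Om : set (R * R)) (F : R * R -> R).
Hypothesis Hb : convex_body Om.
Hypothesis cF : {within Om, continuous F}.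
Implicit Types (x y q v : R * R) (m k : int * int).

Definition second_diff k m : R :=
  psi Om F (ivec R (m + k)) + psi Om F (ivec R (m - k)) - 2 * psi Om F (ivec R m).

Definition osc m : R := second_diff (3, 0) m + second_diff (0, 3) m.

Lemma second_diff_ge x q y m k : Om x -> superdiff Om F x q -> Om y ->
  active Om F y m ->
  dot (ivec R k) (y - x) - dot (q - ivec R m) (y - x) <= second_diff k m.
Proof.
move=> Ox sx Oy ay.
have h1 := psi_ub Hb (ivec R (m + k)) cF Ox.
have h2 := psi_ub Hb (ivec R (m - k)) cF Oy.
have h3 := (superdiff_psi Hb _ cF Oy).1 ay; have h4 := sx y Oy.
move: h1 h2 h4; rewrite /second_diff ivecD ivecB.
rewrite [dot (ivec R m + _) _]dotDl [dot (ivec R m - ivec R k) y]dotBl.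
rewrite [dot (q - _) _]dotBl !dotBr; lra.
Qed.

(** Monotonicity: with [g = y - x], the second difference in the direction [k]
bounds [dot k g] up to [dot (q - m) g], which is at most [l1 g]. The step [3] is
what makes the sum over the two axes exceed [3 l1 g - 2 l1 g]. *)
Lemma osc_ge x q y m : Om x -> superdiff Om F x q -> Om y -> active Om F y m ->
  unit_square m q -> l1 (y - x) <= osc m.
Proof.
move=> Ox sx Oy ay [] /=; rewrite !in_itv /= !intrD => q1 q2.
have D k := second_diff_ge k Ox sx Oy ay.
have sdN k : second_diff (- k) m = second_diff k m.
  by rewrite /second_diff opprK [psi _ _ _ + _]addrC.
have d1 := D (3, 0); have d2 := D (- (3, 0)); rewrite sdN in d2.
have d3 := D (0, 3); have d4 := D (- (0, 3)); rewrite sdN in d4.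
have qm : dot (q - ivec R m) (y - x) <= l1 (y - x).
  rewrite /dot /l1 !pairE /ivec /=.
  have h (a b : R) : 0 <= a <= 1 -> a * b <= `|b|.
    by move=> a01; have := ler_norm b; have := normr_ge0 b; nra.
  by apply: lerD; apply: h; lra.
move: d1 d2 d3 d4 qm; set g := y - x; set c := dot (q - _) g.
have ivecN k : dot (ivec R (- k)) g = - dot (ivec R k) g.
  by rewrite /dot /ivec /= !mulrNz; ring.
have e1 : dot (ivec R (3, 0)) g = 3 * g.1 by rewrite /dot /ivec /= mul0r addr0.
have e2 : dot (ivec R (0, 3)) g = 3 * g.2 by rewrite /dot /ivec /= mul0r add0r.
rewrite /osc /l1 !ivecN e1 e2 => d1 d2 d3 d4 qm.
have h1 : 3 * `|g.1| - c <= second_diff (3, 0) m.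
  by case: (ler0P g.1) => _; lra.
have h2 : 3 * `|g.2| - c <= second_diff (0, 3) m.
  by case: (ler0P g.2) => _; lra.
lra.
Qed.

(** [psi] is Lipschitz because [Om] is bounded, and each row and column of the box
contributes a bounded amount. *)
Lemma osc_sum (B : R) n : (forall x, Om x -> l1 x <= B) ->
  \sum_(m <- [seq (i, j) | i <- int_range n, j <- int_range n]) osc m <=
  36 * B * (2 * n + 1)%:R.
Proof.
move=> HB.
have lip q v : `|psi Om F (q + v) - psi Om F q| <= l1 v * B.
  have [x Ox ax] := psi_attained Hb (q + v) cF.
  have [y Oy ay] := psi_attained Hb q cF.
  have h1 := (superdiff_psi Hb _ cF Ox).1 ax; have h2 := (superdiff_psi Hb _ cF Oy).1 ay.
  have h3 := psi_ub Hb (q + v) cF Oy; have h4 := psi_ub Hb q cF Ox.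
  have := dot_le_l1 v x; have := dot_le_l1 v y.
  have := ler_wpM2l (l1_ge0 v) (HB x Ox); have := ler_wpM2l (l1_ge0 v) (HB y Oy).
  move: h1 h2 h3 h4; rewrite !dotDl !ler_norml; lra.
have sz : size (int_range n) = (2 * n + 1)%N by rewrite size_map size_iota.
rewrite big_allpairs /= /osc.
under eq_bigr do rewrite big_split /=.
rewrite big_split /= exchange_big /=.
have -> : 36 * B * (2 * n + 1)%:R =
  \sum_(j <- int_range n) 18 * B + \sum_(j <- int_range n) 18 * B.
  rewrite !big_const_seq count_predT sz !iter_addr_0 -mulr_natr; ring.
apply: lerD; apply: ler_sum => j _.
  pose f (i : int) := psi Om F (ivec R (i, j)).
  rewrite (eq_bigr (fun i => f (i + 3) + f (i - 3) - 2 * f i)).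
    apply: line_second_diff => z; rewrite /f.
    have -> : ivec R (z + 1, j) = ivec R (z, j) + ivec R (1, 0).
      by rewrite -ivecD; congr ivec; apply: injective_projections; rewrite //= addr0.
    apply: le_trans (lip _ _) _.
    by rewrite /l1 /ivec /= normr1 normr0 addr0 mul1r.
  move=> i _; rewrite /second_diff /f; congr (psi _ _ _ + psi _ _ _ - _);
    by congr ivec; apply: injective_projections; rewrite //= ?addr0 ?subr0.
pose f (i : int) := psi Om F (ivec R (j, i)).
rewrite (eq_bigr (fun i => f (i + 3) + f (i - 3) - 2 * f i)).
  apply: line_second_diff => z; rewrite /f.
  have -> : ivec R (j, z + 1) = ivec R (j, z) + ivec R (0, 1).
    by rewrite -ivecD; congr ivec; apply: injective_projections; rewrite //= addr0.
  apply: le_trans (lip _ _) _.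
  by rewrite /l1 /ivec /= normr1 normr0 add0r mul1r.
move=> i _; rewrite /second_diff /f; congr (psi _ _ _ + psi _ _ _ - _);
  by congr ivec; apply: injective_projections; rewrite //= ?addr0 ?subr0.
Qed.

End Oscillation.

(** * Transport between atoms and marked points *)

Section Transport.
Variables (R : realType) (Om : set (R * R)) (F : R * R -> R).
Hypothesis Hb : convex_body Om.
Hypothesis tF : tropical_series Om F.
Local Notation mR := (measurableTypeR R).
Local Notation P := (mR * mR)%type.
Local Notation S := (superdiff Om F).
Implicit Types (x y q v : R * R) (m k : int * int).

Let cF : {within Om, continuous F}. Proof. by case: tF. Qed.

Variables (mu : {measure set P -> \bar R}) (kap : R).
Hypothesis mu_line : forall u c, u != 0 -> mu (hline u c) = 0%E.
Hypothesis mu_square : forall m, mu (unit_square m) = kap%:E.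
Variables (K : R) (n : nat).
Hypothesis HK : forall x q, interior Om x -> S x q -> l1 q <= K.
Hypothesis Kn : K <= n%:R.
Variable W : seq (R * R).
Hypothesis uW : uniq W.
Hypothesis WE : forall x, x \in W <-> atom Om F x.

Let L := [seq (i, j) | i <- int_range n, j <- int_range n].
(** Over interior points these sets are pairwise disjoint, and empty unless [v] is
an atom. *)
Definition clean_superdiff v : set (R * R) := S v `\` @lattice_lines R.

Let uL : uniq L.
Proof.
by apply: allpairs_uniq; [exact: int_range_uniq|exact: int_range_uniq|move=> [i j] [k l] _ _].
Qed.

Let floor_range (x : R) : `|x| <= n%:R -> Num.floor x \in int_range n.
Proof.
rewrite mem_int_range !ler_norml => /andP[h1 h2]; apply/andP; split.
  by rewrite -[- n%:Z]/(- n%:Z) floor_ge_int intrN.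
by rewrite -(ler_int R); apply: le_trans h2; exact: floor_le.
Qed.

Let in_square q : l1 q <= K -> exists2 m, m \in L & unit_square m q.
Proof.
move=> qK; exists (Num.floor q.1, Num.floor q.2).
  apply: allpairs_f; apply: floor_range; move: qK Kn; rewrite /l1.
    by have := normr_ge0 q.2; lra.
  by have := normr_ge0 q.1; lra.
by split; rewrite /= in_itv /=; exact: floor_itv.
Qed.

Let clean_measurable v : measurable (clean_superdiff v : set P).
Proof.
apply: measurableD; first by apply: closed_measurable2; exact: superdiff_closed.
by case: (lattice_lines_null mu_line).
Qed.

Let piece v m : set P := clean_superdiff v `&` unit_square m.

Let piece_measurable v m : measurable (piece v m).
Proof. by apply: measurableI => //; exact: unit_square_measurable. Qed.

Let piece_le v m : (mu (piece v m) <= kap%:E)%E.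
Proof.
rewrite -(mu_square m); apply: le_measure; rewrite ?inE.
- exact: piece_measurable.
- exact: unit_square_measurable.
- by move=> q [].
Qed.

Let w v m : R := fine (mu (piece v m)).

Let wE v m : mu (piece v m) = (w v m)%:E.
Proof.
rewrite /w fineK// ge0_fin_numE ?measure_ge0//.
by apply: le_lt_trans (piece_le v m) _; rewrite ltry.
Qed.

Let w_ge0 v m : 0 <= w v m.
Proof. by rewrite /w fine_ge0 ?measure_ge0. Qed.

Let clean_sum v : v \in W -> mu (clean_superdiff v) = (\sum_(m <- L) w v m)%:E.
Proof.
move=> /WE[iv _].
have -> : clean_superdiff v = [set q | exists2 m, m \in L & piece v m q].
  apply/seteqP; split => q; last by move=> [m _ []].
  move=> cq; have [m mL qm] := in_square (HK iv cq.1).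
  by exists m.
have [||_ ->] := @measure_seq_union _ P R mu _ L (piece v) uL.
- by move=> m _; exact: piece_measurable.
- move=> m m' _ _ mm'; apply/seteqP; split => // q [[_ h1] [_ h2]].
  by move: mm'; rewrite (unit_square_floor h1) (unit_square_floor h2) eqxx.
by rewrite -sumEFin; apply: eq_bigr => m _; exact: wE.
Qed.

Lemma clean_superdiff_finite v : v \in W -> (mu (clean_superdiff v) < +oo)%E.
Proof. by move=> /clean_sum ->; rewrite ltry. Qed.

Let square_union m :
  let U := [set q | exists2 v, v \in W & piece v m q] in
  measurable (U : set P) /\ mu U = (\sum_(v <- W) w v m)%:E.
Proof.
have [||mU E] := @measure_seq_union _ P R mu _ W (fun v => piece v m) uW.
- by move=> v _; exact: piece_measurable.
- move=> u v /WE[iu _] /WE[iv _] uv.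
  apply/seteqP; split => // q [[[Su nL] _] [[Sv _] _]]; apply: nL.
  exact: superdiff_inter uv Su Sv.
split; first exact: mU.
by apply: etrans E _; rewrite -sumEFin; apply: eq_bigr => v _; exact: wE.
Qed.

Let square_sum_le m : \sum_(v <- W) w v m <= kap.
Proof.
have [mU E] := square_union m.
rewrite -lee_fin -E -(mu_square m); apply: le_measure; rewrite ?inE.
- exact: mU.
- exact: unit_square_measurable.
by move=> q [v _ []].
Qed.

Let square_leftover m : \sum_(v <- W) w v m < kap ->
  exists q, unit_square m q /\ forall x, interior Om x -> ~ S x q.
Proof.
move=> lt; apply: contrapT => H.
have [mU E] := square_union m; have [mL L0] := lattice_lines_null mu_line.
suff : (kap%:E <= (\sum_(v <- W) w v m)%:E)%E by rewrite lee_fin leNgt lt.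
rewrite -E -(mu_square m) -(measureU0 mU mL L0).
apply: le_measure; rewrite ?inE.
- exact: unit_square_measurable.
- exact: measurableU.
move=> q qm; case: (pselect (lattice_lines q)) => [|nL]; first by right.
left; apply: contrapT => nU; apply: H; exists q; split => // x ix Sx; apply: nU.
exists x; last by split.
by apply/WE; split => // sub; apply: nL; exact: sub.
Qed.

Variables (phi : R * R -> R) (G B : R).
Hypothesis phi_lip : forall x y, Om x -> Om y -> `|phi y - phi x| <= G * l1 (y - x).
Hypothesis phi0 : forall x, Om x -> ~ interior Om x -> phi x = 0.
Hypothesis G0 : 0 <= G.
Hypothesis HB : forall x, Om x -> l1 x <= B.
Variables (s : seq (int * int)) (pt : int * int -> R * R).
Hypothesis us : uniq s.
Hypothesis ms : forall m, m \in s -> l1 (ivec R m) <= K.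
Hypothesis Hpt : forall m, m \in s -> interior Om (pt m) /\ active Om F (pt m) m.
Hypothesis Hbd : forall m, m \notin s ->
  exists2 y, (Om `\` interior Om) y & active Om F y m.

(** Each unit cell of gradients carries the mass [kap]. It is transported from the
atoms to a point where the lower left corner of the cell is active. Gradients of
the cell which are supergradients at no interior point are supergradients on the
boundary, where the test function vanishes. *)
Lemma transport_estimate :
  `|\sum_(v <- W) fine (mu (clean_superdiff v)) * phi v - kap * \sum_(m <- s) phi (pt m)|
  <= kap * G * (36 * B * (2 * n + 1)%:R).
Proof.
have [xm Hxm] : exists xm : int * int -> R * R, forall m,
    [/\ Om (xm m), active Om F (xm m) m, m \in s -> xm m = pt m &
        m \notin s -> phi (xm m) = 0].
  suff H m : exists x, [/\ Om x, active Om F x m, m \in s -> x = pt m &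
      m \notin s -> phi x = 0].
    by have [f Hf] := choice H; exists f.
  have [mS|mS] := boolP (m \in s).
    have [ip ap] := Hpt mS; exists (pt m); split => //.
    exact: interior_subset.
  have [y [Oy iy] ay] := Hbd mS; exists y; split => //.
  by move=> _; exact: phi0.
have kap0 : 0 <= kap.
  by apply: le_trans (square_sum_le 0); apply: sumr_ge0.
have sumL : \sum_(m <- s) phi (pt m) = \sum_(m <- L) phi (xm m).
  have pe : perm_eq s [seq m <- L | m \in s].
    apply: uniq_perm => //; first exact: filter_uniq.
    move=> m; rewrite mem_filter; case mS : (m \in s) => //=.
    case: m mS => i j mS; have := ms mS; rewrite /l1 /ivec /= => le.
    apply/esym; apply: allpairs_f; rewrite mem_int_range -(ler_int R) intr_norm.
      by apply: (le_trans _ Kn); have := normr_ge0 (j%:~R : R); lra.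
    by apply: (le_trans _ Kn); have := normr_ge0 (i%:~R : R); lra.
  rewrite (perm_big _ pe) big_filter big_mkcond; apply: eq_bigr => m _.
  by have [_ _ h1 h2] := Hxm m; case: ifPn => [/h1 -> //|/h2 ->].
have -> : \sum_(v <- W) fine (mu (clean_superdiff v)) * phi v =
    \sum_(m <- L) \sum_(v <- W) w v m * phi v.
  rewrite exchange_big /= big_seq [RHS]big_seq; apply: eq_bigr => v vW.
  by rewrite clean_sum//= mulr_suml.
rewrite sumL mulr_sumr -sumrB; apply: le_trans (ler_norm_sum _ _ _) _.
have osc_le : \sum_(m <- L) osc Om F m <= 36 * B * (2 * n + 1)%:R.
  exact: osc_sum.
apply: le_trans (ler_wpM2l (mulr_ge0 kap0 G0) osc_le).
rewrite mulr_sumr; apply: ler_sum => m _.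
have [Ox ax _ _] := Hxm m.
have near q x : Om x -> S x q -> unit_square m q ->
    `|phi x - phi (xm m)| <= G * osc Om F m.
  move=> Oz Sz qm; rewrite distrC; apply: le_trans (phi_lip Oz Ox) _.
  by apply: ler_wpM2l => //; exact: osc_ge Oz Sz Ox ax qm.
set rest := kap - \sum_(v <- W) w v m.
have rest0 : 0 <= rest by rewrite subr_ge0; exact: square_sum_le.
have -> : \sum_(v <- W) w v m * phi v - kap * phi (xm m) =
    \sum_(v <- W) w v m * (phi v - phi (xm m)) - rest * phi (xm m).
  rewrite /rest mulrBl mulr_suml; under [X in _ = X - _]eq_bigr do rewrite mulrBr.
  by rewrite sumrB; ring.
apply: le_trans (ler_normB _ _) _.
have h1 : `|\sum_(v <- W) w v m * (phi v - phi (xm m))| <=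
    (\sum_(v <- W) w v m) * (G * osc Om F m).
  rewrite mulr_suml; apply: le_trans (ler_norm_sum _ _ _) _.
  rewrite big_seq [X in _ <= X]big_seq; apply: ler_sum => v /WE[iv _].
  rewrite normrM ger0_norm//.
  have [->|wn] := eqVneq (w v m) 0; first by rewrite !mul0r.
  apply: ler_wpM2l => //.
  have [q [[Sq _] qm]] : piece v m !=set0.
    apply/set0P; apply: contra_neq wn => E.
    by rewrite /w E measure0.
  exact: near (interior_subset iv) Sq qm.
have h2 : `|rest * phi (xm m)| <= rest * (G * osc Om F m).
  rewrite normrM ger0_norm//; have [->|rn] := eqVneq rest 0; first by rewrite !mul0r.
  apply: ler_wpM2l => //.
  have [q [qm nS]] : exists q, unit_square m q /\ forall x, interior Om x -> ~ S x q.
    by apply: square_leftover; rewrite -subr_gt0 lt_neqAle eq_sym rn.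
  have [y Oy Sy] := psi_attained Hb q cF.
  have iy : ~ interior Om y by move=> iy; exact: nS iy Sy.
  by have := near q y Oy Sy qm; rewrite (phi0 Oy iy) sub0r normrN.
apply: (le_trans (lerD h1 h2)); rewrite -mulrDl addrC /rest subrK mulrA.
by [].
Qed.

End Transport.

(** * The estimate *)

Section Assembly.
Variables (R : realType) (Om : set (R * R)).
Hypothesis poly : rational_polygon Om.
Local Notation mR := (measurableTypeR R).
Local Notation P := (mR * mR)%type.
Let Hb := rational_polygon_body poly.

Lemma superdiff_scale (F : R * R -> R) (t : R) x q : 0 < t ->
  superdiff Om (fun y => t * F y) x q <-> superdiff Om F x (t^-1 *: q).
Proof.
move=> t0; have E y : (t * F y <= t * F x + dot q (y - x)) =
    (F y <= F x + dot (t^-1 *: q) (y - x)).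
  by rewrite -[RHS](ler_pM2l t0) dotZl mulrDr mulVKf// gt_eqF.
by split => H y Oy; have := H y Oy; rewrite /= E.
Qed.

Lemma interior_measurable_fun (phi : R * R -> R) : Cc1 (interior Om) phi ->
  measurable (interior Om : set P) /\
  measurable_fun (interior Om : set P) (phi : P -> R).
Proof.
case=> dphi _ _ _; have oU : open (interior Om) by exact: open_interior.
split; first exact: open_measurable2.
apply: open_continuous_measurable2 => // x Ux.
exact/differentiable_continuous/dphi.
Qed.

Lemma integral_points N (p : 'I_N -> R * R) (phi : R * R -> R) (kap : R) :
  0 <= kap -> (forall i, interior Om (p i)) -> Cc1 (interior Om) phi ->
  (\int[fun B => kap%:E * nu p B]_(x in interior Om) (phi x)%:E =
    (kap * \sum_i phi (p i))%:E)%E.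
Proof.
move=> kap0 ip /interior_measurable_fun[mU mphi].
pose v j : P := nth (0 : R * R) [seq p i | i <- enum 'I_N] j.
have vE (i : 'I_N) : v i = p i.
  by rewrite /v (nth_map i) ?size_enum_ord// nth_ord_enum.
rewrite (@integral_atoms _ P R _ _ N (fun=> NngNum kap0) v phi mU mphi).
- by rewrite mulr_sumr; congr EFin; apply: eq_bigr => i _; rewrite vE.
- by move=> i iN; have := vE (Ordinal iN) => /= ->; exact: ip.
- move=> A _; rewrite /nu ge0_sume_distrr//.
  by apply: eq_bigr => i _; rewrite vE.
Qed.

(** For the multiple [t F] the gradients form the lattice scaled by [t], whose
cells have area [t ^ 2]. *)
Lemma scaled_estimate (K : set (R * R)) : compact K -> K `<=` interior Om ->
  exists2 C : R, 0 <= C & forall N (p : 'I_N -> R * R) (phi : R * R -> R) (t : R),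
    (0 < N)%N -> strongly_generic Om p -> (forall i, K (p i)) ->
    Cc1 (interior Om) phi -> 0 < t ->
    (`| \int[MA Om (fun x => t * relaxation Om p x)%R]_(x in interior Om) (phi x)%:E
        - \int[fun B => (t * t)%:E * nu p B]_(x in interior Om) (phi x)%:E |
      <= (t * t * (C * Num.sqrt N%:R * C1norm (interior Om) phi))%:E)%E.
Proof.
move=> cK KO; have [B B0 HB] := body_bounded poly.
have [C C0 HC] := gradient_bound poly cK KO.
exists (36 * B * (2 * C + 3)); first by rewrite !mulr_ge0//; lra.
move=> N p phi t N0 gen Kp Cphi t0.
have [Hfree Hgrad] := HC N p N0 gen Kp.
have [tF Fpos [s [f [us fs pf af]]]] := free_points_bij poly gen N0.
set F := relaxation Om p in Hfree Hgrad tF Fpos fs af *.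
have ip i : interior Om (p i) by exact: KO.
have [mU mphi] := interior_measurable_fun Cphi.
have [mu [muE mu_line mu_square]] := scaled_measure t0.
set Kb := C * Num.sqrt N%:R in Hfree Hgrad.
have Kb0 : 0 <= Kb by rewrite mulr_ge0 ?sqrtr_ge0 ?(ltW C0).
pose n := (Num.trunc Kb).+1.
have Kn : Kb <= n%:R by exact/ltW/truncnS_gt.
have [W0 EW] := (finite_seqP _).1 (atom_finite Hb tF Hgrad).
pose W := undup W0.
have uW : uniq W by exact: undup_uniq.
have WE x : x \in W <-> atom Om F x.
  have -> : atom Om F x = [set` W0] x by rewrite -EW.
  by rewrite mem_undup.
pose v (i : nat) : R * R := nth 0 W i.
pose a i : {nonneg R} :=
  NngNum (fine_ge0 (measure_ge0 mu (clean_superdiff Om F (v i) : set P))).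
have MAE (A : set P) : MA Om (fun x => t * F x) A =
    (\sum_(i < size W) ((a i)%:num)%:E * \d_(v i : P) A)%E.
  have -> : MA Om (fun x => t * F x) A = mu (gradients Om F A).
    rewrite muE /MA; congr leb2; apply/seteqP; split => q [x [Ax ix] Sx];
      by exists x => //; apply/(superdiff_scale F x q t0).
  rewrite (gradients_atoms Hb tF mu_line A uW WE) (big_nth 0) big_mkord.
  apply: eq_bigr => i _; rewrite /= fineK// ge0_fin_numE ?measure_ge0//.
  apply: (clean_superdiff_finite mu_line mu_square Hgrad Kn WE).
  exact: mem_nth.
rewrite (@integral_atoms _ P R _ _ (size W) a v phi mU mphi).
- rewrite integral_points ?mulr_ge0 ?(ltW t0)// -EFinB abse_EFin lee_fin.
  have -> : \sum_(i < size W) (a i)%:num * phi (v i) =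
      \sum_(v <- W) fine (mu (clean_superdiff Om F v)) * extend0 Om phi v.
    rewrite (big_nth 0) big_mkord; apply: eq_bigr => i _; congr (_ * _).
    have /WE[iv _] : v i \in W by exact: mem_nth.
    by rewrite /extend0 mem_set.
  have -> : \sum_i phi (p i) = \sum_(m <- s) extend0 Om phi (p (f m)).
    rewrite -(big_map f predT (fun i => extend0 Om phi (p i))) (perm_big _ pf).
    rewrite big_enum /=; apply: eq_bigr => i _.
    by rewrite /extend0 mem_set.
  have G0 : 0 <= supnorm (interior Om) (gradnorm phi) by exact: supnorm_ge0.
  have ext0 x : Om x -> ~ interior Om x -> extend0 Om phi x = 0.
    by move=> Ox nx; rewrite /extend0 memNset.
  have Hs m : m \in s -> l1 (ivec R m) <= Kb by move=> /fs; exact: Hfree.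
  have Hpt m : m \in s -> interior Om (p (f m)) /\ active Om F (p (f m)) m.
    by move=> ms; split => //; exact: af.
  have Hbd m : m \notin s -> exists2 y, (Om `\` interior Om) y & active Om F y m.
    by move=> ms; apply: nonfree_boundary => // /fs; rewrite (negbTE ms).
  have := transport_estimate Hb tF mu_line mu_square Hgrad Kn uW WE
    (lipschitz_extend Hb Cphi) ext0 G0 HB us Hs Hpt Hbd.
  move/le_trans; apply.
  have nle : (2 * n + 1)%:R <= (2 * C + 3) * Num.sqrt N%:R :> R.
    have sq1 : 1 <= Num.sqrt N%:R :> R.
      by rewrite -[X in X <= _]sqrtr1 ler_sqrt ?ler0n// ler1n.
    have /andP[h _] := truncn_itv Kb0.
    by rewrite natrD natrM /n -natr1; move: h; rewrite /Kb; lra.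
  rewrite -mulrA ler_wpM2l ?mulr_ge0 ?(ltW t0)//.
  apply: le_trans (_ : C1norm (interior Om) phi * (36 * B * (2 * n + 1)%:R) <= _).
    rewrite ler_wpM2r//; first by rewrite !mulr_ge0// ltW.
    by rewrite /C1norm lerDr; exact: supnorm_ge0.
  rewrite mulrC ler_wpM2r//.
    by rewrite /C1norm addr_ge0//; exact: supnorm_ge0.
  by rewrite -[X in _ <= X]mulrA ler_wpM2l// mulr_ge0// ltW.
- by move=> i iW; have /WE[] : v i \in W by exact: mem_nth.
- by move=> A _; exact: MAE.
Qed.

End Assembly.

Theorem theorem7p3 (R : realType) (Om K : set (R * R)) :
  rational_polygon Om -> compact K -> K `<=` interior Om ->
  exists C : R, forall (N : nat) (p : 'I_N -> R * R) (phi : R * R -> R),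
    (0 < N)%N -> strongly_generic Om p -> (forall i, K (p i)) ->
    Cc1 (interior Om) phi ->
    (`| \int[MA Om (relaxation Om p)]_(x in interior Om) (phi x)%:E
        - \int[nu p]_(x in interior Om) (phi x)%:E |
      <= (C * Num.sqrt N%:R * C1norm (interior Om) phi)%:E)%E
    /\
    (`| \int[MA Om (fun x => (Num.sqrt N%:R)^-1 * relaxation Om p x)%R]_(x in
            interior Om) (phi x)%:E
        - \int[fun B => ((N%:R^-1)%:E * nu p B)%E]_(x in interior Om)
            (phi x)%:E |
      <= (C / Num.sqrt N%:R * C1norm (interior Om) phi)%:E)%E.
Proof.
move=> poly cK KO; have [C C0 HC] := scaled_estimate poly cK KO.
exists C => N p phi N0 gen Kp Cphi; split.
  have := HC N p phi 1 N0 gen Kp Cphi ltr01; rewrite !mul1r.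
  have -> : (fun x => 1 * relaxation Om p x) = relaxation Om p.
    by apply/funext => x; rewrite mul1r.
  by have -> : (fun B => 1%:E * nu p B)%E = nu p by apply/funext => B; rewrite mul1e.
have sq0 : 0 < Num.sqrt N%:R :> R by rewrite sqrtr_gt0 ltr0n.
have := HC N p phi (Num.sqrt N%:R)^-1 N0 gen Kp Cphi ltac:(by rewrite invr_gt0).
have -> : (Num.sqrt N%:R)^-1 * (Num.sqrt N%:R)^-1 = N%:R^-1 :> R.
  by rewrite -invfM -expr2 sqr_sqrtr ?ler0n.
suff -> : N%:R^-1 * (C * Num.sqrt N%:R * C1norm (interior Om) phi) =
    C / Num.sqrt N%:R * C1norm (interior Om) phi by [].
rewrite -[in N%:R^-1](@sqr_sqrtr R N%:R) ?ler0n// expr2.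
by field; rewrite gt_eqF.
Qed.
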